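(* Assume that $X$ is a topological space homeomorphic to a definable set and $h\colon X\to\mathbb{N}$ is a function in $HCF(X)$, $h=\sum_{\alpha\in I}\mathbb{1}_{U_\alpha}$, where the supports $\{U_\alpha\}_{\alpha\in I}$ are subspaces homeomorphic to definable subsets. If the Euler-Poincaré characteristic of all the supports $U_\alpha$ is $N$ and different from zero, then the number of observables is $$|I|=\frac{1}{N}\int_X h\,d\chi .$$
   Context: An o-minimal structure over $\mathbb{R}$ is a collection $\mathcal{A}=\{\mathcal{A}_n\}_{n\in\mathbb{N}}$, where each $\mathcal{A}_n$ is an algebra of subsets of $\mathbb{R}^n$, such that: (1) $A\in\mathcal{A}_n$, $B\in\mathcal{A}_m$ imply $A\times B\in\mathcal{A}_{n+m}$; (2) $A\in\mathcal{A}_n$ implies $\pi(A)\in\mathcal{A}_{n-1}$, where $\pi$ is the projection into the first $n-1$ coordinates; (3) $\{(x_1,\ldots,x_n)\in\mathbb{R}^n: x_i=x_j\}\in\mathcal{A}_n$ for all $1\le i<j\le n$; (4) $\{(x,y)\in\mathbb{R}^2: x<y\}\in\mathcal{A}_2$; (5) $\mathcal{A}_1$ is the collection of finite unions of points and open intervals of $\mathbb{R}$. Such a structure is fixed; a set $A\subset\mathbb{R}^n$ is definable if $A\in\mathcal{A}_n$, and a map between definable sets is definable if its graph is definable. An open $n$-simplex is a set $\{t_0v_0+\cdots+t_nv_n\in\mathbb{R}^m: \sum_i t_i=1,\ t_i>0\ \forall i\}$, where $v_0,\ldots,v_n$ are affinely independent points in $\mathbb{R}^m$, $m\ge n$. A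 generalized simplicial complex is a finite collection $\mathcal{K}$ of open simplices in $\mathbb{R}^n$ such that, given two open simplices in the complex, the intersection of their closures is the empty set or the closure of an open simplex in the complex. Its Euler-Poincaré characteristic is $\chi(\mathcal{K})=\sum_{i=0}^n(-1)^ic_i$, where $c_i$ is the number of open $i$-simplices; in particular an open $n$-simplex has characteristic $(-1)^n$. $|\mathcal{K}|$ denotes the geometric realization (the union of the open simplices). A triangulation of a topological space $X$ is a homeomorphism $|\mathcal{K}|\to X$ with $\mathcal{K}$ a generalized simplicial complex; the open simplices of the triangulation are the images in $X$ of the open simplices of $\mathcal{K}$. The Euler-Poincaré characteristic of a definable set is the characteristic of the generalized simplicial complex associated with a definable triangulation of it. For a topological space $Y$ homeomorphic to a definable set $B$, $\chi(Y):=\chi(B)$; this is well defined because homeomorphic definable sets have equal characteristic, even if the homeomorphism is not definable (a theorem of Beke). Let $X$ be homeomorphic to a definable set $A$ by the homeomorphism $\beta\colon X\to A$. $HCF(X)$ is the $\mathbb{Z}$-module of homeo-integrable functions, that is, functions $h\colon X\to\mathbb{Z}$ which are bounded, have compact support and whose level sets are homeomorphic to definable subsets of $A$ by restrictions of the homeomorphism $\beta$. Each $h\in HCF(X)$ is written as a finite sum $h=\sum_\alpha c_\alpha\mathbb{1}_{\sigma_\alpha}$, where $c_\alpha\in\mathbb{Z}$ and $\sigma_\alpha$ are the open simplices of a triangulation of $X$ compatible with the support of $h$ (the support is a union of open simplices); the integral with respect to the Euler-Poincaré characteristic is then $\int_X h\,d\chi:=\sum_\alpha c_\alpha\chi(\sigma_\alpha)$.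 $\mathbb{1}_U$ denotes the characteristic function of $U$. The observables are the objects indexed by $I$, the one with index $\alpha$ having support $U_\alpha$. *)

(* Defs.v *)
From HB Require Import structures.
From mathcomp Require Import all_boot all_order all_algebra.
From mathcomp Require Import all_classical all_reals all_analysis.

Set Implicit Arguments.
Unset Strict Implicit.
Unset Printing Implicit Defensive.

Import Order.TTheory GRing.Theory Num.Theory.
Import numFieldNormedType.Exports.

Local Open Scope classical_set_scope.
Local Open Scope ring_scope.

(* Points of R^n are row vectors ['rV[R]_n]; a set [A : set T] used as a type is
   [set_type A], which carries the subspace topology. *)

Definition point_or_open_interval (R : realType) (J : set R) : Prop :=
  (exists a : R, J = [set a]) \/
  (* infinite endpoints are allowed *)
  (exists a b : \bar R, J = [set x : R | (a < x%:E)%E /\ (x%:E < b)%E]).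

Record ominimal_structure (R : realType) := OMinimalStructure {
  definable :> forall n : nat, set (set 'rV[R]_n) ;
  definable0 : forall n, definable (set0 : set 'rV[R]_n) ;
  definableC : forall n, setC_closed (definable (n := n)) ;
  definableU : forall n, setU_closed (definable (n := n)) ;
  definableX : forall n m (A : set 'rV[R]_n) (B : set 'rV[R]_m),
    definable A -> definable B ->
    definable [set x : 'rV[R]_(n + m) | A (lsubmx x) /\ B (rsubmx x)] ;
  definable_proj : forall n (A : set 'rV[R]_(n + 1)),
    definable A -> definable ((fun x => lsubmx x) @` A) ;
  definable_diag : forall n (i j : 'I_n), (i < j)%N ->
    definable [set x : 'rV[R]_n | x ord0 i = x ord0 j] ;
  definable_lt :
    definable [set x : 'rV[R]_2 | x ord0 ord0 < x ord0 ord_max] ;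
  definable1P : forall A : set 'rV[R]_1, definable A <->
    exists (k : nat) (J : 'I_k -> set R),
      (forall i, point_or_open_interval (J i)) /\
      A = [set x | exists i, J i (x ord0 ord0)]
}.

Definition homeomorphism (X Y : topologicalType) (f : X -> Y) : Prop :=
  continuous f /\
  exists g : Y -> X, [/\ continuous g, cancel f g & cancel g f].

Definition graph (R : realType) n m (A : set 'rV[R]_n) (B : set 'rV[R]_m)
    (f : A -> B) : set 'rV[R]_(n + m) :=
  range (fun x : A => row_mx (set_val x) (set_val (f x))).

Definition definable_map (R : realType) (S : ominimal_structure R) n m
    (A : set 'rV[R]_n) (B : set 'rV[R]_m) (f : A -> B) : Prop :=
  [/\ S n A, S m B & S (n + m)%N (graph f)].

Definition affinely_independent (R : realType) n d
    (v : 'I_d.+1 -> 'rV[R]_n) : Prop :=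
  row_free (\matrix_(i < d) (v (lift ord0 i) - v ord0)).

Definition open_simplex (R : realType) n d
    (v : 'I_d.+1 -> 'rV[R]_n) : set 'rV[R]_n :=
  [set x | exists t : 'I_d.+1 -> R,
     [/\ forall i, 0 < t i, \sum_i t i = 1 & x = \sum_i t i *: v i]].

(* Two points where the textual definition "the closures of two open simplices
   are disjoint or meet in the closure of an open simplex of the complex" cannot
   be taken word for word:
   - distinct open simplices have to be disjoint, as otherwise the intervals
     (0,3) and (1,2) would form a complex and the characteristic would not be an
     invariant of the underlying set;
   - the open simplex whose closure is the intersection need not be a member of
     the complex: if it had to be, an open annulus would have no triangulation,
     and the plane would have none compatible with a closed disc.
   Complexes satisfying the membership requirement are included. *)
Record gen_complex (R : realType) (n : nat) := GenComplex {
  simplex : finType ;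
  sdim : simplex -> nat ;
  vertex : forall s : simplex, 'I_(sdim s).+1 -> 'rV[R]_n ;
  cell := fun s : simplex => open_simplex (vertex (s := s)) ;
  vertex_indep : forall s, affinely_independent (vertex (s := s)) ;
  cell_disjoint : forall s s', s <> s' -> cell s `&` cell s' = set0 ;
  closure_cellI : forall s s',
    closure (cell s) `&` closure (cell s') = set0 \/
    exists d (w : 'I_d.+1 -> 'rV[R]_n), affinely_independent w /\
      closure (cell s) `&` closure (cell s') = closure (open_simplex w)
}.

Definition realization (R : realType) n (K : gen_complex R n) :
    set 'rV[R]_n :=
  \bigcup_(s in [set: simplex K]) cell s.

Definition complex_char (R : realType) n (K : gen_complex R n) : int :=
  \sum_(i < n.+1) (-1) ^+ i * (#|[pred s : simplex K | sdim s == i]|)%:Z.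

Definition triangulation (R : realType) n (K : gen_complex R n)
    (X : topologicalType) (T : realization K -> X) : Prop :=
  homeomorphism T.

Definition tri_cell (R : realType) n (K : gen_complex R n)
    (X : topologicalType) (T : realization K -> X) (s : simplex K) : set X :=
  T @` [set p | cell s (set_val p)].

(* [chi(B) = c].  A relation rather than a function: an o-minimal structure that
   does not contain addition and multiplication can have definable sets without
   any definable triangulation. *)
Definition has_char (R : realType) (S : ominimal_structure R) m
    (B : set 'rV[R]_m) (c : int) : Prop :=
  exists n (K : gen_complex R n) (T : realization K -> B),
    [/\ triangulation T, definable_map S T & complex_char K = c].

(* Subsets of [X] are transported by [beta], where [beta : X -> A] is the fixed
   homeomorphism onto a definable set. *)
Section Transport.
Variables (R : realType) (S : ominimal_structure R) (m : nat).
Variables (A : set 'rV[R]_m) (X : topologicalType) (beta : X -> A).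

Definition model (U : set X) : set 'rV[R]_m :=
  (fun x => set_val (beta x)) @` U.

Definition tame (U : set X) : Prop := S m (model U).

(* [chi(U) := chi(beta(U))], [U] being homeomorphic to the definable set
   [beta(U)]; by Beke's theorem any other definable set homeomorphic to [U] has
   the same characteristic. *)
Definition has_space_char (U : set X) (c : int) : Prop :=
  has_char S (model U) c.

Definition HCF (h : X -> int) : Prop :=
  [/\ exists M : int, forall x, `|h x| <= M,
      compact (closure [set x | h x != 0])
    & forall k : int, tame [set x | h x = k]].

(* [v] is the integral of [h]: for a triangulation of [X] on whose open simplices
   [h] is constant, hence compatible with the support of [h], [v] is the sum of
   [c_s * chi(sigma_s)].  The triangulation itself is not assumed definable. *)
Definition has_euler_integral (h : X -> int) (v : int) : Prop :=
  exists n (K : gen_complex R n) (T : realization K -> X)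
         (c chi : simplex K -> int),
    [/\ triangulation T,
        forall s, has_space_char (tri_cell T s) (chi s),
        forall x, h x = \sum_s c s * \1_(tri_cell T s) x
      & v = \sum_s c s * chi s].

End Transport.

(* Main.v *)
(* The Euler integral of a step function on the line, in which a point counts
   for 1 and an open interval for -1, can be iterated over the coordinates of R^m.
   The result makes no reference to a structure: on the indicator function of an
   open d-simplex it is (-1)^d, hence on that of a complex it is the
   characteristic of the complex, whether or not the simplices are definable.
   For definable integrands the order of integration is irrelevant; integrating
   the graph of a definable triangulation in both orders shows that every
   definably triangulated set B has characteristic the iterated integral of 1_B.
   As the iterated integral is linear, it gives the same value to the two
   expressions of h, namely |I| N and the Euler integral of h.

   That the iterated integrals exist is the uniform finiteness theorem for
   o-minimal structures. Over the real numbers its proof simplifies because an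
   interval is not a countable union of finite sets: a property with countably
   many (for instance rational) parameters has a constant parameter on some
   interval. *)

Require Import Defs.
From mathcomp Require Import all_boot all_order all_algebra.
From mathcomp Require Import all_classical all_reals all_analysis.
From mathcomp Require Import zify ring lra finmap.

Set Implicit Arguments.
Unset Strict Implicit.
Unset Printing Implicit Defensive.

Import Order.TTheory GRing.Theory Num.Theory.
Import numFieldNormedType.Exports.

Local Open Scope classical_set_scope.
Local Open Scope ring_scope.

(** * Definable predicates *)

Section Environments.
Variable R : realType.
Implicit Types (e : nat -> R) (P Q : (nat -> R) -> Prop).

(** A direct comparison of the two expressions of [h] would call for a triangulation refining both.
    None is at hand: the structure may lack addition, so that triangulation theorems do not apply
    and even a slanted segment may fail to be definable.

    Hence two classes of integrands coexist. Constructible functions, with finitely many values and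
    definable level sets, are stable under integration and allow the order of integration to be
    exchanged. Indicators of open simplices are integrated coordinate by coordinate, in one fixed
    order, by linear algebra. The two classes meet in the set [realization K], definable as the
    source of a definable triangulation even when its cells are not.

    Uniform finiteness keeps the range of an integral finite. Instead of a full cell decomposition,
    its proof uses weak cells on which only the number of points of a fiber is controlled; what lies
    over finitely many values of a coordinate is passed to families with fewer parameters. The
    exchange of two integrations is reduced to graphs and subgraphs of monotone functions by
    removing the discontinuities of the vertical sections one at a time. *)

Definition upd e i (y : R) : nat -> R := fun k => if k == i then y else e k.

Lemma upd_same e i y : upd e i y i = y.
Proof. by rewrite /upd eqxx. Qed.

Lemma upd_other e i y k : k != i -> upd e i y k = e k.
Proof. by rewrite /upd => /negPf ->. Qed.

Lemma upd_upd e i x y : upd (upd e i x) i y = upd e i y.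
Proof. by apply/funext => k; rewrite /upd; case: eqP. Qed.

Lemma upd_id e i : upd e i (e i) = e.
Proof. by apply/funext => k; rewrite /upd; case: eqP => [->|]. Qed.

Lemma updC e i j x y : i != j ->
  upd (upd e i x) j y = upd (upd e j y) i x.
Proof.
move=> ij; apply/funext => k; rewrite /upd.
by case: eqP => // ->; rewrite eq_sym (negPf ij).
Qed.

Definition row_env n e : 'rV[R]_n := \row_(i < n) e i.

Lemma row_env_eqP n e e' :
  row_env n e = row_env n e' <-> forall k, (k < n)%N -> e k = e' k.
Proof.
split=> [ee k kn|ee].
  by have := congr1 (fun v : 'rV_n => v ord0 (Ordinal kn)) ee; rewrite !mxE.
by apply/rowP => i; rewrite !mxE ee.
Qed.

End Environments.

Section Definability.
Variables (R : realType) (S : ominimal_structure R).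
Implicit Types (e : nat -> R) (P Q : (nat -> R) -> Prop) (n i j k : nat).

(* Definable sets are handled as first-order predicates on infinitely many
   coordinates, of which only the first [n] matter; formulas are then closed
   under renaming and quantification of arbitrary coordinates, and a bound
   variable is coordinate [0] of a shifted environment. *)
Definition dfn n P := exists2 A : set 'rV[R]_n, S n A &
  forall e, P e <-> A (row_env n e).

Definition df P := exists n, dfn n P.

Lemma dfn_dep n P : dfn n P ->
  forall e e', (forall k, (k < n)%N -> e k = e' k) -> P e -> P e'.
Proof.
by move=> [A _ PA] e e' /row_env_eqP ee /PA Pe; apply/PA; rewrite -ee.
Qed.

Lemma dfn_ext n P Q : (forall e, P e <-> Q e) -> dfn n P -> dfn n Q.
Proof. by move=> PQ [A SA PA]; exists A => // e; rewrite -PQ. Qed.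

Lemma df_ext P Q : (forall e, P e <-> Q e) -> df P -> df Q.
Proof. by move=> PQ [n nP]; exists n; apply: dfn_ext nP. Qed.

Lemma definableT n : S n setT.
Proof. by rewrite -setC0; apply/definableC/definable0. Qed.

Lemma row_env_l n m e : lsubmx (row_env (n + m) e) = row_env n e.
Proof. by apply/rowP => i; rewrite !mxE. Qed.

Lemma row_env_r n m e :
  rsubmx (row_env (n + m) e) = row_env m (fun k => e (n + k)%N).
Proof. by apply/rowP => i; rewrite !mxE. Qed.

Lemma dfn_pad n m P : dfn n P -> dfn (n + m) P.
Proof.
move=> [A SA PA].
exists [set x : 'rV[R]_(n + m) | A (lsubmx x) /\ setT (rsubmx x)].
  exact: (definableX SA (definableT m)).
by move=> e; rewrite /= row_env_l PA; split=> // -[].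
Qed.

Lemma dfn_le n m P : (n <= m)%N -> dfn n P -> dfn m P.
Proof. by move=> /subnKC <-; apply: dfn_pad. Qed.

Lemma df_common P Q : df P -> df Q -> exists n, dfn n P /\ dfn n Q.
Proof.
move=> [n nP] [m mQ]; exists (maxn n m).
by split; [apply: dfn_le nP; rewrite leq_maxl|apply: dfn_le mQ; rewrite leq_maxr].
Qed.

Lemma dfn_shift n m P : dfn m P -> dfn (n + m) (fun e => P (fun k => e (n + k)%N)).
Proof.
move=> [A SA PA].
exists [set x : 'rV[R]_(n + m) | setT (lsubmx x) /\ A (rsubmx x)].
  exact: (definableX (definableT n) SA).
by move=> e; rewrite /= row_env_r PA; split=> // -[].
Qed.

Lemma dfn_not n P : dfn n P -> dfn n (fun e => ~ P e).
Proof. by move=> [A SA PA]; exists (~` A); [exact: definableC|move=> e; rewrite PA]. Qed.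

Lemma dfn_or n P Q : dfn n P -> dfn n Q -> dfn n (fun e => P e \/ Q e).
Proof.
move=> [A SA PA] [B SB QB]; exists (A `|` B); first exact: definableU.
by move=> e; rewrite PA QB.
Qed.

Lemma dfn_and n P Q : dfn n P -> dfn n Q -> dfn n (fun e => P e /\ Q e).
Proof.
move=> nP nQ; have := dfn_not (dfn_or (dfn_not nP) (dfn_not nQ)).
by apply: dfn_ext => e; rewrite not_orE !notE.
Qed.

Lemma df_not P : df P -> df (fun e => ~ P e).
Proof. by move=> [n nP]; exists n; apply: dfn_not. Qed.

Lemma df_or P Q : df P -> df Q -> df (fun e => P e \/ Q e).
Proof. by move=> dP /(df_common dP) [n [? ?]]; exists n; apply: dfn_or. Qed.

Lemma df_and P Q : df P -> df Q -> df (fun e => P e /\ Q e).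
Proof. by move=> dP /(df_common dP) [n [? ?]]; exists n; apply: dfn_and. Qed.

Lemma df_imp P Q : df P -> df Q -> df (fun e => P e -> Q e).
Proof.
move=> /df_not dP dQ; apply: df_ext (df_or dP dQ) => e.
by rewrite implyE.
Qed.

Lemma df_cst (p : Prop) : df (fun=> p).
Proof.
exists 0; have [hp|np] := pselect p.
  by exists setT; [exact: definableT|move=> e; split].
by exists set0; [exact: definable0|move=> e; split].
Qed.

Lemma dfn_eq_lt n i j : (i < j < n)%N -> dfn n (fun e => e i = e j).
Proof.
move=> /andP[ij jn]; have iN := ltn_trans ij jn.
exists [set x : 'rV[R]_n | x ord0 (Ordinal iN) = x ord0 (Ordinal jn)].
  exact: definable_diag.
by move=> e /=; rewrite !mxE.
Qed.

Lemma dfn_eq n i j : (i < n)%N -> (j < n)%N -> dfn n (fun e => e i = e j).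
Proof.
move=> iN jN; have [ij|ji|->] := ltngtP i j.
- by apply: dfn_eq_lt; rewrite ij.
- have : dfn n (fun e => e j = e i) by apply: dfn_eq_lt; rewrite ji.
  by apply: dfn_ext => e; split.
- by exists setT; [exact: definableT|move=> e; split].
Qed.

Lemma dfn_all n m (P : nat -> (nat -> R) -> Prop) :
  (forall k, (k < m)%N -> dfn n (P k)) ->
  dfn n (fun e => forall k, (k < m)%N -> P k e).
Proof.
elim: m => [|m IH] dP; first by exists setT; [exact: definableT|move=> e; split].
have dIH := IH (fun k km => dP k (ltnW km)).
apply: dfn_ext (dfn_and dIH (dP m (ltnSn m))) => e; split=> [[a b] k|a].
  by rewrite ltnS leq_eqVlt => /predU1P[->|/a].
by split=> [k km|]; apply: a; rewrite // ltnW.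
Qed.

Lemma df_all m (P : nat -> (nat -> R) -> Prop) :
  (forall k, (k < m)%N -> df (P k)) ->
  df (fun e => forall k, (k < m)%N -> P k e).
Proof.
elim: m => [|m IH] dP; first by apply: df_ext (df_cst True) => e; split.
have dIH := IH (fun k km => dP k (ltnW km)).
apply: df_ext (df_and dIH (dP m (ltnSn m))) => e; split=> [[a b] k|a].
  by rewrite ltnS leq_eqVlt => /predU1P[->|/a].
by split=> [k km|]; apply: a; rewrite // ltnW.
Qed.

Lemma df_exn m (P : nat -> (nat -> R) -> Prop) :
  (forall k, (k < m)%N -> df (P k)) ->
  df (fun e => exists2 k, (k < m)%N & P k e).
Proof.
move=> dP; have dA := df_not (df_all (fun k km => df_not (dP k km))).
apply: df_ext dA => e; split=> [|[k km Pk] /(_ k km)//].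
by move=> /existsNP[k /not_implyP[km /contrapT Pk]]; exists k.
Qed.

Lemma dfn_proj n P : dfn n.+1 P -> dfn n (fun e => exists y, P (upd e n y)).
Proof.
rewrite -addn1 => -[A SA PA].
exists ((fun x => lsubmx x) @` A); first exact: definable_proj.
move=> e; split=> [[y /PA Ay]|[v Av ve]].
  exists (row_env (n + 1) (upd e n y)) => //.
  rewrite row_env_l; apply/row_env_eqP => k kn.
  by rewrite upd_other // ltn_eqF.
exists (v ord0 (rshift n ord0)); apply/PA.
suff <- : v = row_env (n + 1) (upd e n (v ord0 (rshift n ord0))) by [].
apply/rowP => i; rewrite !mxE; case: (split_ordP i) => [j ->|j ->].
  rewrite upd_other/= ?ltn_eqF//.
  by have := congr1 (fun v : 'rV_n => v ord0 j) ve; rewrite !mxE.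
by rewrite !ord1 /upd /= addn0 eqxx.
Qed.

Lemma dfn_projs n m P : dfn (n + m) P ->
  dfn n (fun e => exists w, P (fun k => if (k < n)%N then e k else w k)).
Proof.
elim: m P => [|m IH] P.
  rewrite addn0 => nP; apply: dfn_ext (nP) => e; split=> [Pe|[w]].
    by exists e; congr P : Pe; apply/funext => k; case: ifP.
  by apply: (dfn_dep nP) => k ->.
rewrite addnS => /dfn_proj /IH; apply: dfn_ext => e; split=> [[w [y Py]]|[w Pw]].
  exists (upd w (n + m) y); congr P : Py; apply/funext => k; rewrite /upd.
  by case: (ltnP k n) => // kn; rewrite ltn_eqF// ltn_addr.
exists w, (w (n + m)%N); congr P : Pw; apply/funext => k; rewrite /upd.
case: eqP => // ->; case: ltnP => //; lia.
Qed.

(** Diagonals, products and projections simulate an arbitrary substitution: a block of [n] fresh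
    coordinates is forced to equal the selected old ones, and is then projected away. *)
Lemma dfn_ren n m P (s : nat -> nat) : (forall k, (k < n)%N -> (s k < m)%N) ->
  dfn n P -> dfn m (fun e => P (fun k => e (s k))).
Proof.
move=> sP nP.
have dA : dfn (m + n) (fun e => P (fun k => e (m + k)%N) /\
   forall k, (k < n)%N -> e (m + k)%N = e (s k)).
  apply: dfn_and; first exact: dfn_shift.
  apply: dfn_all => k kn; apply: dfn_eq; first lia.
  by have := sP _ kn; lia.
apply: dfn_ext (dfn_projs dA) => e; split=> [[w [Pw ew]]|Pe].
  apply: (dfn_dep nP) Pw => k kn; have := ew k kn.
  by rewrite sP// [in X in X -> _]ltnNge leq_addr.
exists (fun k => e (s (k - m)%N)); split=> [|k kn].
  apply: (dfn_dep nP) Pe => k kn; rewrite ifF ?addKn//.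
  by rewrite ltnNge leq_addr.
by rewrite sP// addKn ifF// ltnNge leq_addr.
Qed.

Lemma df_ren P (s : nat -> nat) : df P -> df (fun e => P (fun k => e (s k))).
Proof.
(* The sum dominates each [s k] with [k < n]. *)
move=> [n nP]; exists (\sum_(k < n) s k).+1.
by apply: dfn_ren nP => k kn; rewrite ltnS (bigD1 (Ordinal kn))//= leq_addr.
Qed.

(** The axioms project the last coordinate only, so coordinate [i] is first renamed to a new last
    one. *)
Lemma df_exu P i : df P -> df (fun e => exists y, P (upd e i y)).
Proof.
move=> [m mP]; pose n := maxn m i.+1.
have nP : dfn n P by apply: dfn_le mP; rewrite leq_maxl.
have ni : (i < n)%N by rewrite leq_maxr.
have /dfn_proj dA : dfn n.+1 (fun e => P (fun k => e (if k == i then n else k))).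
  by apply: dfn_ren nP => k kn; case: ifP => // _; rewrite ltnW.
exists n; apply: dfn_ext dA => e.
have ue y k : (k < n)%N -> upd e n y (if k == i then n else k) = upd e i y k.
  move=> kn; rewrite [in RHS]/upd; case: ifP => _; first by rewrite upd_same.
  by rewrite upd_other// ltn_eqF.
by split=> -[y Py]; exists y; apply: (dfn_dep nP) Py => k kn; rewrite ue.
Qed.

(** Quantifying over coordinate [0] leaves the others shifted by one; renaming along [predn] undoes
    the shift. In this form definability is proved by following the syntax of a formula. *)
Lemma df_ex (P : R -> (nat -> R) -> Prop) :
  df (fun e => P (e 0) (fun k => e k.+1)) -> df (fun e => exists y, P y e).
Proof. move=> /(@df_exu _ 0%N)/(@df_ren _ predn) H; exact: H. Qed.

Lemma df_fa (P : R -> (nat -> R) -> Prop) :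
  df (fun e => P (e 0) (fun k => e k.+1)) -> df (fun e => forall y, P y e).
Proof.
move=> dP; apply: df_ext (df_not (df_ex (P := fun y e => ~ P y e) (df_not dP))) => e.
split=> [H y|H [y nP]]; last exact: nP (H y).
by apply: contrapT => nP; apply: H; exists y.
Qed.

Lemma df_ex2 (P Q : R -> (nat -> R) -> Prop) :
  df (fun e => P (e 0) (fun k => e k.+1)) ->
  df (fun e => Q (e 0) (fun k => e k.+1)) -> df (fun e => exists2 y, P y e & Q y e).
Proof.
move=> dP dQ; apply: df_ext (df_ex (P := fun y e => P y e /\ Q y e) (df_and dP dQ)).
by move=> e; split=> [[y [? ?]]|[y]]; exists y.
Qed.

Lemma df_eq i j : df (fun e => e i = e j).
Proof. by exists (maxn i j).+1; apply: dfn_eq; lia. Qed.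

Lemma df_ltP i j : df (fun e => e i < e j).
Proof.
have : df (fun e => e 0 < e 1%N).
  exists 2; exists [set x : 'rV[R]_2 | x ord0 ord0 < x ord0 ord_max].
    exact: definable_lt.
  by move=> e /=; rewrite !mxE.
by move=> /(@df_ren _ (fun k => if k is 0 then i else j)).
Qed.

Lemma df_leP i j : df (fun e => e i <= e j).
Proof.
apply: df_ext (df_not (df_ltP j i)) => e.
by rewrite leNgt; split=> /negP.
Qed.

Lemma df_itv (J : set R) i : point_or_open_interval J -> df (fun e => J (e i)).
Proof.
move=> hJ; have : df (fun e => J (e 0)).
  exists 1; exists [set x : 'rV[R]_1 | J (x ord0 ord0)].
    apply/definable1P; exists 1, (fun=> J); split=> //.
    by apply/seteqP; split=> [x Jx|x [_]]//; exists ord0.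
  by move=> e /=; rewrite !mxE.
by move=> /(@df_ren _ (fun=> i)).
Qed.

Lemma df_eqc i (c : R) : df (fun e => e i = c).
Proof. by apply: (@df_itv [set c]); left; exists c. Qed.

(** Points of the line are definable, so real parameters may be substituted: the coordinate is
    equated to the constant and quantified away. *)
Lemma df_updc P i c : df P -> df (fun e => P (upd e i c)).
Proof.
move=> dP; have dc : df (fun e => P e /\ e i = c) by apply: df_and => //; exact: df_eqc.
apply: df_ext (df_exu i dc) => e; split=> [[y [Py]]|Pc].
  by rewrite upd_same => <-.
by exists c; rewrite upd_same.
Qed.

Lemma df_ltc i (c : R) : df (fun e => e i < c).
Proof. by have /(df_updc i.+1 c) := df_ltP i i.+1; apply: df_ext => e;
  rewrite upd_same upd_other// ltn_eqF. Qed.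

Lemma df_gtc i (c : R) : df (fun e => c < e i).
Proof. by have /(df_updc i.+1 c) := df_ltP i.+1 i; apply: df_ext => e;
  rewrite upd_same upd_other// ltn_eqF. Qed.

Definition ren_cst (t : (nat -> R) -> nat -> R) :=
  exists (s : nat -> option nat) (c : nat -> R),
    forall e k, t e k = if s k is Some j then e j else c k.

Lemma df_fix P m n (c : nat -> R) : df P ->
  df (fun e => P (fun k => if (m <= k < m + n)%N then c k else e k)).
Proof.
elim: n P => [|n IH] P dP.
  apply: df_ext dP => e; suff -> : (fun k => if (m <= k < m + 0)%N then c k else e k) = e by [].
  by apply/funext => k; rewrite addn0; case: ifP => //; lia.
have /IH := df_updc (m + n) (c (m + n)%N) dP; apply: df_ext => e.
set u := upd _ _ _; suff -> : u = (fun k => if (m <= k < m + n.+1)%N then c k else e k) by [].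
by apply/funext => k; rewrite /u /upd; case: eqP => [->|?];
  repeat (case: ifP => ? //); lia.
Qed.

Lemma df_comp P t : ren_cst t -> df P -> df (fun e => P (t e)).
Proof.
move=> [s [c tE]] [n nP].
(* constants are first read off coordinates beyond all those used by [s] *)
pose m := (\sum_(k < n) odflt 0 (s k)).+1.
have dP : df (fun e => P (fun k => e (odflt (m + k)%N (s k)))).
  by apply: (@df_ren P (fun k => odflt (m + k)%N (s k))); exists n.
apply: df_ext (df_fix m n (fun k => c (k - m)%N) dP) => e.
suff tk : forall k, (k < n)%N -> t e k =
  if (m <= odflt (m + k) (s k) < m + n)%N then c (odflt (m + k) (s k) - m)%N
  else e (odflt (m + k)%N (s k)).
  by split; apply: (dfn_dep nP) => k kn; rewrite tk.
move=> k kn; rewrite tE; case E : (s k) => [j|] /=.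
  rewrite ifF//; have : (j < m)%N.
    by rewrite ltnS (bigD1 (Ordinal kn))//= E /= leq_addr.
  by lia.
by rewrite ifT ?addKn //; lia.
Qed.

Lemma ren_ren (s : nat -> nat) : ren_cst (fun e k => e (s k)).
Proof. by exists (fun k => Some (s k)), (fun=> 0). Qed.

Lemma ren_id : ren_cst id.
Proof. by exists Some, (fun=> 0). Qed.

Lemma ren_upd t i j : ren_cst t -> ren_cst (fun e => upd (t e) i (e j)).
Proof.
move=> [s [c tE]]; exists (fun k => if k == i then Some j else s k), c => e k.
by rewrite /upd; case: eqP.
Qed.

Lemma ren_updc t i y : ren_cst t -> ren_cst (fun e => upd (t e) i y).
Proof.
move=> [s [c tE]]; exists (fun k => if k == i then None else s k), (upd c i y) => e k.
by rewrite /upd; case: eqP => // _; rewrite tE; case: (s k).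
Qed.

Lemma ren_c e0 : ren_cst (fun=> e0).
Proof. by exists (fun=> None), e0. Qed.

End Definability.

(** * Definable sets and functions on the line *)

Section LineTopology.
Variable R : realType.
Implicit Types (x : R) (P Q : R -> Prop).

Definition near_right x P := exists2 b, x < b & forall y, x < y -> y < b -> P y.
Definition near_ninfty P := exists b : R, forall y, y < b -> P y.
Definition near_pt x P :=
  exists a b, [/\ a < x, x < b & forall y, a < y -> y < b -> P y].
Definition has_interval P :=
  exists a b : R, a < b /\ forall y, a < y -> y < b -> P y.

Lemma near_pt_self x P : near_pt x P -> P x.
Proof. by move=> [a [b [ax xb]]]; apply. Qed.

Lemma near_pt_imp x P Q : (forall y, P y -> Q y) -> near_pt x P -> near_pt x Q.
Proof. by move=> PQ [a [b [ax xb H]]]; exists a, b; split=> // y ay yb; apply/PQ/H. Qed.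

Lemma near_right_imp x P Q : (forall y, P y -> Q y) -> near_right x P -> near_right x Q.
Proof. by move=> PQ [b xb H]; exists b => // y ay yb; apply/PQ/H. Qed.

Lemma near_ninfty_imp P Q : (forall y, P y -> Q y) -> near_ninfty P -> near_ninfty Q.
Proof. by move=> PQ [b H]; exists b => y yb; apply/PQ/H. Qed.

Lemma near_pt_and x P Q : near_pt x P -> near_pt x Q -> near_pt x (fun y => P y /\ Q y).
Proof.
move=> [a [b [ax xb H]]] [a' [b' [ax' xb' H']]].
exists (Num.max a a'), (Num.min b b'); rewrite gt_max ax ax' lt_min xb xb'.
by split=> // y; rewrite gt_max lt_min => /andP[? ?] /andP[? ?]; split; [apply: H|apply: H'].
Qed.

Lemma near_right_and x P Q : near_right x P -> near_right x Q -> near_right x (fun y => P y /\ Q y).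
Proof.
move=> [b xb H] [b' xb' H'].
exists (Num.min b b'); rewrite ?lt_min ?xb ?xb' //.
by move=> y xy; rewrite lt_min => /andP[? ?]; split; [apply: H|apply: H'].
Qed.

Lemma near_ninfty_and P Q : near_ninfty P -> near_ninfty Q -> near_ninfty (fun y => P y /\ Q y).
Proof.
move=> [b H] [b' H']; exists (Num.min b b').
by move=> y; rewrite lt_min => /andP[? ?]; split; [apply: H|apply: H'].
Qed.

Lemma near_pt_all (T : eqType) (s : seq T) x (P : T -> R -> Prop) :
  (forall t, t \in s -> near_pt x (P t)) -> near_pt x (fun y => forall t, t \in s -> P t y).
Proof.
elim: s => [|t s IH] H.
  by exists (x - 1), (x + 1); split=> //; lra.
have := near_pt_and (H t (mem_head _ _)) (IH (fun u us => H u (@mem_behead _ (t :: s) u us))).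
by apply: near_pt_imp => y [Pt Ps] u; rewrite inE => /predU1P[->|/Ps].
Qed.

Lemma near_pt_lt x c : x < c -> near_pt x (fun y => y < c).
Proof. by move=> xc; exists (x - 1), c; split=> //; lra. Qed.

Lemma near_pt_gt x c : c < x -> near_pt x (fun y => c < y).
Proof. by move=> xc; exists c, (x + 1); split=> //; lra. Qed.

Lemma near_pt_rt x P : near_pt x P -> near_right x P.
Proof. by move=> [a [b [ax xb H]]]; exists b => // y xy yb; apply: H => //; lra. Qed.

Lemma near_right_ex x P : near_right x P -> exists y, P y.
Proof. by move=> [b xb H]; exists ((x + b) / 2); apply: H; lra. Qed.

Lemma near_ninfty_ex P : near_ninfty P -> exists y, P y.
Proof. by move=> [b H]; exists (b - 1); apply: H; lra. Qed.

Lemma near_ninfty_exlt c P : near_ninfty P -> exists2 y, y < c & P y.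
Proof.
move=> [b H]; exists (Num.min b c - 1).
  have : Num.min b c <= c by rewrite ge_min lexx orbT.
  by lra.
apply: H; have : Num.min b c <= b by rewrite ge_min lexx.
by lra.
Qed.

Lemma has_interval_imp P Q : (forall y, P y -> Q y) -> has_interval P -> has_interval Q.
Proof. by move=> PQ [a [b [ab H]]]; exists a, b; split=> // y ay yb; apply/PQ/H. Qed.

Lemma near_pt_itv x P : near_pt x P -> has_interval P.
Proof. by move=> [a [b [ax xb H]]]; exists a, b; split=> //; lra. Qed.

Lemma lebesgue_measure_oo_gt0 (a b : R) : a < b ->
  (0 < lebesgue_measure `]a, b[%classic)%E.
Proof.
by move=> ab; rewrite lebesgue_measure_itv /= lte_fin ab -EFinD lte_fin subr_gt0.
Qed.

Lemma has_interval_uncountable (a b : R) (B : set R) : a < b ->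
  (forall y, a < y -> y < b -> B y) -> ~ countable B.
Proof.
move=> ab aB cB; have := lebesgue_measure_oo_gt0 ab.
rewrite countable_lebesgue_measure0 ?ltxx//.
apply: sub_countable cB; apply: subset_card_le => y /=.
by rewrite in_itv /= => /andP[]; apply: aB.
Qed.

Lemma has_interval_infinite P : has_interval P -> infinite_set [set y | P y].
Proof.
by move=> [a [b [ab H]]] /finite_set_countable; apply: has_interval_uncountable ab _.
Qed.

(* Real induction, in a form that serves for connectedness and compactness
   arguments alike. *)
Lemma segment_chain (r : R -> R -> Prop) (a b : R) :
  (forall x y z, r x y -> r y z -> r x z) -> a < b ->
  (forall z, a <= z -> z <= b -> exists u v, [/\ u < z, z < v &
     forall x y, u < x -> x < y -> y < v -> a <= x -> y <= b -> r x y]) ->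
  r a b.
Proof.
move=> tr ab loc.
(* [Z] collects the points reached from [a]. The strict bound [a < y] spares reflexivity, which [r]
   need not have. *)
pose Z := [set z | a <= z <= b /\ forall y, a < y -> y <= z -> r a y].
have Za : Z a.
  by split=> [|y ay ya]; [rewrite lexx ltW|have := lt_le_trans ay ya; rewrite ltxx].
have hs : has_sup Z by split; [exists a|exists b => z [/andP[]]].
pose c := sup Z.
have ac : a <= c by apply: sup_upper_bound.
have cb : c <= b by apply: sup_le_ub; [exists a|move=> z [/andP[]]].
have [u [v [uc cv ruv]]] := loc c ac cb.
have [z0 Zz0 uz0] : exists2 z, Z z & u < z.
  have [z Zz] := sup_adherent (eps := c - u) ltac:(lra) hs.
  by rewrite -/c => ?; exists z => //; lra.
have z0c : z0 <= c by apply: sup_upper_bound.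
have [/andP[az0 z0b] rz0] := Zz0.
have ext y : a < y -> y <= b -> y < v -> r a y.
  move=> ay yb yv; have [yz|zy] := leP y z0; first exact: rz0.
  have rzy : r z0 y by apply: ruv.
  have [az|] := ltP a z0; first by apply: tr rzy; exact: rz0.
  by move=> za; have <- : z0 = a by apply/eqP; rewrite eq_le za.
have [bv|vb] := ltP b v; first exact: ext.
have : Z ((c + v) / 2).
  by split=> [|y ay yc]; [apply/andP; split; lra|apply: ext; lra].
by move=> /(sup_upper_bound hs); rewrite -/c; lra.
Qed.

End LineTopology.

Section DefinableLine.
Variables (R : realType) (S : ominimal_structure R).
Local Notation df := (df S).
Implicit Types (e : nat -> R) (P Q : (nat -> R) -> Prop).

Lemma df_and3 P Q P' : df P -> df Q -> df P' -> df (fun e => [/\ P e, Q e & P' e]).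
Proof.
move=> dP dQ dP'; apply: df_ext (df_and dP (df_and dQ dP')) => e.
by split=> [[? [? ?]]|[? ? ?]].
Qed.

Lemma df_near_right i (P : R -> (nat -> R) -> Prop) :
  df (fun e => P (e 0) (fun k => e k.+1)) ->
  df (fun e => near_right (e i) (fun y => P y e)).
Proof.
move=> dP; apply: df_ex2; first exact: df_ltP.
apply: df_fa; apply: df_imp; first exact: df_ltP.
by apply: df_imp; [exact: df_ltP|exact: (df_ren (fun k => if k is k.+1 then k.+2 else 0) dP)].
Qed.

Lemma df_near_ninfty (P : R -> (nat -> R) -> Prop) :
  df (fun e => P (e 0) (fun k => e k.+1)) ->
  df (fun e => near_ninfty (fun y => P y e)).
Proof.
move=> dP; apply: df_ex; apply: df_fa; apply: df_imp; first exact: df_ltP.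
exact: (df_ren (fun k => if k is k.+1 then k.+2 else 0) dP).
Qed.

Lemma df_near_pt i (P : R -> (nat -> R) -> Prop) :
  df (fun e => P (e 0) (fun k => e k.+1)) ->
  df (fun e => near_pt (e i) (fun y => P y e)).
Proof.
move=> dP; apply: df_ex; apply: df_ex; apply: df_and3; try exact: df_ltP.
apply: df_fa; apply: df_imp; first exact: df_ltP.
by apply: df_imp; [exact: df_ltP|exact: (df_ren (fun k => if k is k.+1 then k.+3 else 0) dP)].
Qed.

Lemma df_has_interval (P : R -> (nat -> R) -> Prop) :
  df (fun e => P (e 0) (fun k => e k.+1)) ->
  df (fun e => has_interval (fun y => P y e)).
Proof.
move=> dP; apply: df_ex; apply: df_ex; apply: df_and; first exact: df_ltP.
apply: df_fa; apply: df_imp; first exact: df_ltP.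
by apply: df_imp; [exact: df_ltP|exact: (df_ren (fun k => if k is k.+1 then k.+3 else 0) dP)].
Qed.

Definition o1 (B : R -> Prop) := df (fun e => B (e 0)).
Definition o2 (B : R -> R -> Prop) := df (fun e => B (e 0) (e 1%N)).

Lemma o1_at (B : R -> Prop) i : o1 B -> df (fun e => B (e i)).
Proof. by move=> /(@df_ren _ _ _ (fun=> i)). Qed.

Lemma o2_at (B : R -> R -> Prop) i j : o2 B -> df (fun e => B (e i) (e j)).
Proof. by move=> /(@df_ren _ _ _ (fun k => if k is 0 then i else j)). Qed.

Lemma o2_l (B : R -> R -> Prop) x : o2 B -> o1 (B x).
Proof.
move=> oB; exact: (df_updc 1 x (o2_at 1 0 oB)).
Qed.

Lemma df_o1 P (t : (nat -> R) -> nat -> R) i : df P -> ren_cst t ->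
  forall e, o1 (fun y => P (upd (t e) i y)).
Proof.
move=> dP near_right e; apply: (df_comp (P := P)) dP => //.
by apply: ren_upd; apply: ren_c.
Qed.

Lemma o1P (B : R -> Prop) : o1 B -> exists (k : nat) (J : 'I_k -> set R),
  (forall i, point_or_open_interval (J i)) /\ forall x, B x <-> exists i, J i x.
Proof.
move=> [n nB]; have [A SA BA] : dfn S 1 (fun e => B (e 0)).
  by apply: (dfn_ren (s := fun=> 0%N)) nB.
have [k [J [hJ AJ]]] := (definable1P S A).1 SA.
exists k, J; split=> // x.
by have := BA (fun=> x); rewrite AJ /= !mxE.
Qed.

(** A definable set is a finite Boolean combination of points and rays, so a filter that decides all
    rays decides it. The filters used are the right germs at a point and the germs at minus
    infinity. *)
Lemma o1_dichotomy (F : set_system R) (FF : Filter F) (B : R -> Prop) : o1 B ->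
  (forall c : R, F [set y | y < c] \/ F [set y | c < y]) ->
  F [set y | B y] \/ F [set y | ~ B y].
Proof.
move=> /o1P [k [J [hJ BJ]]] Fc.
have dJ i : F (J i) \/ F (~` (J i)).
  have [[a ->]|[a [b ->]]] := hJ i.
    right; have [Fa|Fa] := Fc a; apply: filterS Fa => y /= h;
      by apply/eqP; rewrite ?(lt_eqF h) ?(gt_eqF h).
  suff [Fa Fb] : (F [set x : R | (a < x%:E)%E] \/ F [set x : R | ~ (a < x%:E)%E]) /\
    (F [set x : R | (x%:E < b)%E] \/ F [set x : R | ~ (x%:E < b)%E]).
    case: Fa => [Fa|Fa]; last by right; apply: filterS Fa => x /= + [].
    case: Fb => [Fb|Fb]; last by right; apply: filterS Fb => x /= + [].
    by left; apply: filterS2 Fa Fb.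
  split.
    case: a => [a| |].
    + have [Fa|Fa] := Fc a; [right|left]; apply: filterS Fa => y /=;
        rewrite lte_fin //.
      by move=> ya /(lt_trans ya); rewrite ltxx.
    + by right; apply: filterE => y /=.
    + by left; apply: filterE => y /=; rewrite ltNyr.
  case: b => [b| |].
  + have [Fa|Fa] := Fc b; [left|right]; apply: filterS Fa => y /=;
      rewrite lte_fin //.
    by move=> ya /(lt_trans ya); rewrite ltxx.
  + by left; apply: filterE => y /=; rewrite ltry.
  + by right; apply: filterE => y /=.
have [[i FJ]|nF] := pselect (exists i, F (J i)).
  by left; apply: filterS FJ => y Jy; apply/BJ; exists i.
right; have : F [set y | forall i, ~ J i y].
  apply: filter_forall => i; have [FJ|//] := dJ i.
  by exfalso; apply: nF; exists i.
by apply: filterS => y /= Jy /BJ [i]; apply: Jy.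
Qed.

Lemma o1_right B x : o1 B -> near_right x B \/ near_right x (fun y => ~ B y).
Proof.
pose F := [set P : set R | near_right x P].
have FF : Filter F.
  split=> [|P Q /= FP FQ|P Q PQ]; last exact: near_right_imp.
    by exists (x + 1) => //; lra.
  exact: near_right_and.
move=> oB; apply: (o1_dichotomy FF oB) => c.
have [xc|cx] := ltP x c; first by left; exists c.
by right; exists (x + 1); [lra|move=> y xy _; exact: le_lt_trans xy].
Qed.

Lemma o1_near_ninfty B : o1 B -> near_ninfty B \/ near_ninfty (fun y => ~ B y).
Proof.
pose F := [set P : set R | near_ninfty P].
have FF : Filter F.
  split=> [|P Q /= FP FQ|P Q PQ]; last exact: near_ninfty_imp.
    by exists 0.
  exact: near_ninfty_and.
by move=> oB; apply: (o1_dichotomy FF oB) => c; left; exists c.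
Qed.

(** One of the finitely many constituents is infinite, and it contains the open interval between any
    two of its points. *)
Lemma o1_infinite B : o1 B -> infinite_set [set y | B y] -> has_interval B.
Proof.
move=> /o1P [k [J [hJ BJ]]] infB.
have [i infJ] : exists i, infinite_set (J i).
  apply: contrapT => /forallNP fJ; apply: infB.
  have -> : [set y | B y] = \bigcup_(i in [set: 'I_k]) J i.
    by apply/seteqP; split=> [y /BJ [i Ji]|y [i _ Ji]]; [exists i|apply/BJ; exists i].
  by apply: bigcup_finite => [|i _]; [exact: finite_finset|apply: contrapT; exact: fJ].
have [x Jx] : exists x, J i x.
  apply: contrapT => /forallNP nJ; apply: infJ.
  by rewrite (_ : J i = set0)//; apply/seteqP; split.
have [y Jy yx] : exists2 y, J i y & y <> x.
  apply: contrapT => nJ; apply: infJ; apply: (@sub_finite_set _ _ [set x]) => //.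
  by move=> y Jy; apply: contrapT => yx; apply: nJ; exists y.
case: (hJ i) Jx Jy => [[a ->] /= xa ya|[a [b Jab]]]; first by rewrite xa ya in yx.
rewrite Jab /= => -[ax xb] [ay yb].
wlog xy : x y ax xb ay yb yx / x < y.
  move=> H; have [xy|yx'|xy] := ltgtP x y; first exact: (H x y).
    by apply: (H y x) => // xy; rewrite xy ltxx in yx'.
  by rewrite xy in yx.
exists x, y; split=> // z xz zy; apply/BJ; exists i; rewrite Jab; split.
  by apply: lt_trans ax _; rewrite lte_fin.
by apply: lt_trans yb; rewrite lte_fin.
Qed.

Lemma o1_finite B : o1 B -> ~ has_interval B -> finite_set [set y | B y].
Proof. by move=> oB nB; apply: contrapT => /(o1_infinite oB). Qed.

(** The index type is instantiated with Booleans, with cardinalities, with pairs of rationals, and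
    with a rational together with a type of monotonicity. *)
Lemma o1_cover (Q : countType) (X : Q -> R -> Prop) (a b : R) :
  (forall q, o1 (X q)) -> a < b ->
  (forall x, a < x -> x < b -> exists q, X q x) ->
  exists q a' b', [/\ a <= a', a' < b', b' <= b & forall x, a' < x -> x < b' -> X q x].
Proof.
move=> oX ab cov.
have [q /o1_infinite] : exists q, infinite_set [set x | X q x /\ (a < x /\ x < b)].
  apply: contrapT => /forallNP fX.
  have cU : countable (\bigcup_(q in [set: Q]) [set x | X q x /\ (a < x /\ x < b)]).
    apply: bigcup_countable => // q _; apply: finite_set_countable.
    by apply: contrapT; exact: fX.
  apply: has_interval_uncountable ab _ cU => x ax xb.
  by have [q Xq] := cov x ax xb; exists q.
case=> [|a' [b' [ab' H]]].
  by apply: df_and; [exact: oX|apply: df_and; [exact: df_gtc|exact: df_ltc]].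
exists q, a', b'; split=> //.
(* Otherwise the midpoint of [a'] and [min a b'] would lie in the interval found, yet to the left of
   [a]; the bound by [b] is symmetric. *)
- rewrite leNgt; apply/negP => a'a.
  have : a' < Num.min a b' by rewrite lt_min a'a.
  have : Num.min a b' <= b' by rewrite ge_min lexx orbT.
  have : Num.min a b' <= a by rewrite ge_min lexx.
  by move=> *; have [||_ []] := H ((a' + Num.min a b') / 2); lra.
- rewrite leNgt; apply/negP => bb'.
  have : a' <= Num.max b a' by rewrite le_max lexx orbT.
  have : Num.max b a' < b' by rewrite gt_max bb'.
  have : b <= Num.max b a' by rewrite le_max lexx.
  by move=> *; have [||_ [_]] := H ((b' + Num.max b a') / 2); lra.
by move=> x /H{}H /H [].
Qed.

(** An interval of such points would, by [o1_cover], contain an interval inside [B] or inside its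
    complement, and no point of the latter is of this kind. *)
Lemma o1_boundary B : o1 B ->
  finite_set [set y | ~ (near_pt y B \/ near_pt y (fun z => ~ B z))].
Proof.
move=> oB; apply: o1_finite.
  apply: df_not; apply: df_or; apply: df_near_pt.
    exact: (o1_at 0 oB).
  by apply: df_not; exact: (o1_at 0 oB).
move=> [a [b [ab H]]].
have [] := @o1_cover _ (fun (q : bool) x => if q then B x else ~ B x) a b _ ab.
- by case=> //; exact: df_not.
- by move=> x _ _; have [?|?] := pselect (B x); [exists true|exists false].
move=> q [a' [b' [aa' ab' bb' H']]].
apply: (H ((a' + b') / 2)); [lra|lra|].
by case: q H' => H'; [left|right]; exists a', b'; split=> //; lra.
Qed.

End DefinableLine.

(** * Cardinality of finite sets and its first-order form *)

Section Counting.
Variable T : choiceType.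
Implicit Types A B : set T.

(** Infinite sets receive the default value [0]; finiteness is therefore carried along wherever the
    number matters. *)
Definition ncard A : nat := #|` fset_set A|%fset.

Lemma ncard_eq A B : finite_set A -> (A #= B)%card -> ncard A = ncard B.
Proof.
move=> /finite_setP[n An] AB; rewrite /ncard (card_fset_set An).
by rewrite (@card_fset_set _ B n)// (card_eq_trans (card_esym AB) An).
Qed.

Lemma ncard_set0 : ncard set0 = 0%N.
Proof. by rewrite /ncard fset_set0. Qed.

Lemma ncard_eq0 A : finite_set A -> ncard A = 0%N -> A = set0.
Proof.
move=> fA /eqP; rewrite cardfs_eq0 => /eqP A0.
by rewrite -(fset_setK fA) A0; apply/seteqP; split.
Qed.

Lemma ncardD1 A y : finite_set A -> A y -> ncard A = (ncard (A `\ y)).+1.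
Proof.
move=> fA Ay; rewrite /ncard fset_setD1// (cardfsD1 y (fset_set A)).
by rewrite in_fset_set// mem_set// add1n.
Qed.

Lemma le_ncard A B : finite_set B -> A `<=` B -> (ncard A <= ncard B)%N.
Proof.
move=> fB AB; have fA := sub_finite_set AB fB.
apply: fsubset_leq_card; apply/fsubsetP => x; rewrite !in_fset_set//.
by move=> /set_mem/AB/mem_set.
Qed.

Lemma finite_set_seq A : finite_set A -> exists s : seq T, forall x, x \in s <-> A x.
Proof.
move=> fA; exists (enum_fset (fset_set A)) => x; rewrite (in_fset_set fA).
by split=> [/set_mem|/mem_set].
Qed.

(** Unfolds to [k] nested existential quantifiers, which makes bounds on the cardinality of a fiber
    first-order. *)
Fixpoint atleast k A : Prop :=
  if k is k'.+1 then exists2 y, A y & atleast k' (A `\ y) else True.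

Lemma atleastP k A : finite_set A -> atleast k A <-> (k <= ncard A)%N.
Proof.
elim: k A => [|k IH] A fA //=.
have fD y : finite_set (A `\ y) by apply: sub_finite_set fA => z [].
split=> [[y Ay /IH]|kA].
  by rewrite (ncardD1 fA Ay) ltnS; apply.
have [[y Ay]|A0] := pselect (exists y, A y).
  by exists y => //; apply/IH => //; rewrite -ltnS -ncardD1.
have A00 : A = set0 by apply/seteqP; split=> // y Ay; apply: A0; exists y.
by rewrite A00 ncard_set0 in kA.
Qed.

End Counting.

Section SeqBounds.
Variable R : realType.

Lemma seq_min (s : seq R) : s != [::] ->
  exists2 m, m \in s & forall y, y \in s -> m <= y.
Proof.
elim: s => // x [|x' s] IH _.
  by exists x; rewrite ?mem_seq1// => y; rewrite mem_seq1 => /eqP ->.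
have [m ms Hm] := IH isT.
have [xm|mx] := leP x m.
  exists x; rewrite ?mem_head// => y; rewrite in_cons => /predU1P[->//|/Hm].
  exact: le_trans.
exists m; first by rewrite in_cons ms orbT.
by move=> y; rewrite in_cons => /predU1P[->|/Hm//]; exact: ltW.
Qed.

Lemma finite_min (A : set R) : finite_set A -> A !=set0 ->
  exists2 m, A m & forall y, A y -> m <= y.
Proof.
move=> /finite_set_seq [s sA] [x /sA xs]; have [|m /sA Am Hm] := @seq_min s.
  by apply: contraTN xs => /eqP ->.
by exists m => // y /sA; apply: Hm.
Qed.

Lemma seq_apart (s : seq R) (y : R) : exists2 r, 0 < r &
  forall x, x \in s -> x != y -> r <= `|x - y|.
Proof.
elim: s => [|x s [r r0 IH]]; first by exists 1.
have [->|xy] := eqVneq x y.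
  exists r => // z; rewrite in_cons => /predU1P[->|/IH//].
  by rewrite eqxx.
exists (Num.min r `|x - y|); first by rewrite lt_min r0 normr_gt0 subr_eq0.
move=> z; rewrite in_cons => /predU1P[->|/IH{}IH /IH]; first by rewrite ge_min lexx orbT.
by rewrite ge_min => ->.
Qed.

Lemma seq_separated (s : seq R) : exists2 r, 0 < r &
  forall x y, x \in s -> y \in s -> x != y -> r <= `|x - y|.
Proof.
suff [r r0 H] : exists2 r, 0 < r & forall y, y \in s ->
    forall x, x \in s -> x != y -> r <= `|x - y|.
  by exists r => // x y xs ys; apply: H.
elim: {1}s => [|y t [r r0 IH]]; first by exists 1.
have [r' r'0 H] := seq_apart s y.
exists (Num.min r r'); first by rewrite lt_min r0.
move=> z; rewrite in_cons => /predU1P[-> x xs xy|zt x xs xz].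
  by rewrite ge_min H ?orbT.
by rewrite ge_min (IH z).
Qed.

Lemma seq_bounds (s : seq R) : exists m M, forall x, x \in s -> m < x /\ x < M.
Proof.
elim: s => [|x s [m [M IH]]]; first by exists 0, 0.
exists (Num.min m (x - 1)), (Num.max M (x + 1)) => z.
rewrite in_cons gt_min lt_max => /predU1P[->|/IH[-> ->]]//.
by split; apply/orP; right; lra.
Qed.

Lemma rat_between (x y : R) : x < y -> exists q : rat, x < ratr q /\ ratr q < y.
Proof. by move=> /rat_in_itvoo [q]; rewrite in_itv /= => /andP[]; exists q. Qed.

End SeqBounds.

(** * Sets that are large in given directions *)

Section InfinitelyMany.
Variables (R : realType) (S : ominimal_structure R).
Local Notation df := (df S).
Local Notation o1 := (o1 S).
Local Notation o2 := (o2 S).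
Implicit Types (e : nat -> R) (P Q : (nat -> R) -> Prop).

Lemma df_ncard k (A : (nat -> R) -> set R) : (forall e, finite_set (A e)) ->
  df (fun e => A (fun k => e k.+1) (e 0)) -> df (fun e => (k <= ncard (A e))%N).
Proof.
move=> fA dA; have {fA} := fun e => atleastP k (fA e).
move=> /df_ext; apply.
elim: k A dA => [|k IH] A dA /=; first exact: df_cst.
apply: (df_ex2 (P := fun y e => A e y) (Q := fun y e => atleast k (A e `\ y))) => //.
apply: (IH (fun e => A (fun k => e k.+1) `\ e 0)).
apply: df_and; last by apply: df_not; exact: df_eq.
exact: (df_ren (fun k => if k is k.+1 then k.+2 else 0) dA).
Qed.

Lemma df_ncard_eq k (A : (nat -> R) -> set R) : (forall e, finite_set (A e)) ->
  df (fun e => A (fun k => e k.+1) (e 0)) -> df (fun e => ncard (A e) = k).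
Proof.
move=> fA dA; have := df_and (df_ncard k fA dA) (df_not (df_ncard k.+1 fA dA)).
by apply: df_ext => e; split=> [[]|->]; lia.
Qed.

(* A definable set of reals contains an interval if and only if it is infinite. *)
Definition many i P e := has_interval (fun y => P (upd e i y)).

Lemma df_many i P : df P -> df (many i P).
Proof.
move=> dP; apply: (df_has_interval (P := fun y e => P (upd e i y))).
by apply: (df_comp (P := P)) dP; apply: ren_upd; exact: ren_ren.
Qed.

Lemma many_o1 i P e : df P -> o1 (fun y => P (upd e i y)).
Proof. by move=> dP; apply: (df_o1 (t := id)) => //; exact: ren_id. Qed.

Lemma has_interval_or (A B : R -> Prop) : o1 A -> o1 B ->
  has_interval (fun y => A y \/ B y) -> has_interval A \/ has_interval B.
Proof.
move=> oA oB /has_interval_infinite iAB; apply: contrapT => /not_orP[nA nB]; apply: iAB.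
rewrite (_ : [set y | _] = [set y | A y] `|` [set y | B y])//.
by rewrite finite_setU; split; [exact: (o1_finite oA)|exact: (o1_finite oB)].
Qed.

(** For each [x] of an interval there is an interval of suitable [y]. Shrunk to rational endpoints
    it ranges over a countable set, so one rational interval serves a whole interval of [x]; the
    resulting rectangle can be read in either order. *)
Lemma many_swap i j P e : df P -> i != j ->
  many i (many j P) e -> many j (many i P) e.
Proof.
move=> dP ij [a [b [ab H]]].
pose X (q : rat * rat) x := ratr q.1 < ratr q.2 :> R /\
  forall y, ratr q.1 < y -> y < ratr q.2 -> P (upd (upd e i x) j y).
have [||q [a' [b' [_ ab' _ Xq]]]] := o1_cover (S := S) (X := X) (a := a) (b := b) _ ab.
- move=> q; apply: df_and; first exact: df_cst.
  apply: df_fa; apply: df_imp; first exact: df_gtc.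
  apply: df_imp; first exact: df_ltc.
  apply: (df_comp (P := P)) dP; apply: ren_upd; apply: ren_upd; exact: ren_c.
- move=> x ax xb; have [c [d [cd Hx]]] := H x ax xb.
  have [q1 [cq1 q1d]] := rat_between cd; have [q2 [q12 q2d]] := rat_between q1d.
  by exists (q1, q2); split=> //= y y1 y2; apply: Hx; lra.
- exists (ratr q.1), (ratr q.2); have [|| q12 _] := Xq ((a' + b') / 2); [lra|lra|].
  split=> // y y1 y2; exists a', b'; split=> // x x1 x2.
  by rewrite -updC//; apply: (Xq x x1 x2).2.
Qed.

Definition manys (s : seq nat) P := foldr many P s.

Lemma df_manys s P : df P -> df (manys s P).
Proof. by move=> dP; elim: s => //= i s; exact: df_many. Qed.

Lemma many_imp i P Q e : (forall e, P e -> Q e) -> many i P e -> many i Q e.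
Proof. by move=> PQ; apply: has_interval_imp => y; exact: PQ. Qed.

Lemma manys_imp s P Q e : (forall e, P e -> Q e) -> manys s P e -> manys s Q e.
Proof. by elim: s e => //= [|i s IH] e PQ; [exact: PQ|apply: many_imp => e'; exact: IH]. Qed.

Lemma manys_or s P Q e : df P -> df Q ->
  manys s (fun e => P e \/ Q e) e -> manys s P e \/ manys s Q e.
Proof.
move=> dP dQ; elim: s e => //= i s IH e /(many_imp IH).
by apply: has_interval_or; exact/many_o1/df_manys.
Qed.

Lemma manys_dep s P e e' : (forall k, k \notin s -> e k = e' k) ->
  manys s P e -> manys s P e'.
Proof.
elim: s e e' => [|i s IH] e e' ee /=.
  by rewrite (_ : e = e')//; apply/funext => k; exact: ee.
apply: has_interval_imp => y; apply: IH => k ks; rewrite /upd; case: eqP => // ki.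
by apply: ee; rewrite inE negb_or ks andbT; apply/eqP.
Qed.

Lemma manys_ex s P e : manys s P e ->
  exists2 e', P e' & forall k, k \notin s -> e' k = e k.
Proof.
elim: s e => [|i s IH] e /=; first by exists e.
move=> [a [b [ab H]]]; have [||e' Pe' ee'] := IH _ (H ((a + b) / 2) _ _); [lra|lra|].
exists e' => // k; rewrite inE negb_or => /andP[ki ks].
by rewrite ee'// upd_other.
Qed.

Lemma manys_and s P Q e :
  (forall e e', (forall k, k \notin s -> e k = e' k) -> Q e -> Q e') ->
  manys s P e -> Q e -> manys s (fun e => P e /\ Q e) e.
Proof.
elim: s e => [|i s IH] e Qdep //=.
move=> [a [b [ab H]]] Qe; exists a, b; split=> // y ay yb.
apply: IH => [e1 e2 e12||].
- apply: Qdep => k; rewrite inE negb_or => /andP[_ ks]; exact: e12.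
- exact: H.
- apply: Qdep Qe => k; rewrite inE negb_or => /andP[ki _].
  by rewrite upd_other.
Qed.

Lemma many_manys_swap i s P e : df P -> i \notin s ->
  many i (manys s P) e -> manys s (many i P) e.
Proof.
move=> dP; elim: s e => //= j s IH e; rewrite inE negb_or => /andP[ij iS].
move=> /(many_swap (df_manys s dP) ij); apply: many_imp => e'; exact: IH.
Qed.

End InfinitelyMany.

(** * The monotonicity theorem *)

Section DefinableFunctions.
Variables (R : realType) (S : ominimal_structure R).
Local Notation df := (df S).
Local Notation o1 := (o1 S).
Local Notation o2 := (o2 S).
Implicit Types (e : nat -> R) (f : R -> R) (A : R -> R -> Prop).

Definition definable_fun f := o2 (fun x y => y = f x).

Lemma df_fun f i (P : R -> (nat -> R) -> Prop) : definable_fun f ->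
  df (fun e => P (e 0) (fun k => e k.+1)) -> df (fun e => P (f (e i)) e).
Proof.
move=> of_ dP; have dG : df (fun e => exists y, y = f (e i) /\ P y e).
  by apply: df_ex; apply: df_and => //; exact: (o2_at i.+1 0 of_).
apply: df_ext dG => e; split=> [[y [->]]//|Pe].
by exists (f (e i)).
Qed.

(** Where no [y] is related to [x], [xget] returns its default [0]; the graph is thus [A] completed
    by a definable set of pairs [(x, 0)]. *)
Lemma definable_fun_xget A : o2 A -> (forall x y z, A x y -> A x z -> y = z) ->
  definable_fun (fun x => xget 0 [set y | A x y]).
Proof.
move=> oA uA; have dA : df (fun e => A (e 0) (e 1%N) \/
    (~ exists y, A (e 0) y) /\ e 1%N = 0).
  apply: df_or => //; apply: df_and; last exact: df_eqc.
  by apply/df_not/df_ex; exact: (o2_at 1 0 oA).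
apply: df_ext dA => e; have [exA|nA] := pselect (exists y, A (e 0) y).
  have Ax : A (e 0) (xget 0 [set y | A (e 0) y]).
    by have [y Ay] := exA; exact: (@xgetI _ 0 [set y | A (e 0) y] y Ay).
  by split=> [[/uA|[[]]//]|->]; [exact|left].
rewrite xgetPN => [|y Ay]; last by apply: nA; exists y.
split=> [[Ae|[]]//|->]; last by right.
by exfalso; apply: nA; exists (e 1%N).
Qed.

(* [Some true], [Some false] and [None] stand for increasing, decreasing and
   constant. *)
Definition order_rel (c : option bool) (u v : R) : Prop :=
  match c with Some true => u < v | Some false => v < u | None => u = v end.

Lemma order_rel_trans c u v w : order_rel c u v -> order_rel c v w -> order_rel c u w.
Proof.
case: c => [[]|] /=; [exact: lt_trans|by move=> vu /lt_trans; apply|by move=> ->].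
Qed.

(** Stated with the order alone, so that it is first-order in every structure. *)
Definition cont_at f x := forall u v, u < f x -> f x < v -> near_pt x (fun z => u < f z /\ f z < v).

Lemma o2_order_rel f c : definable_fun f -> o2 (fun x y => order_rel c (f x) (f y)).
Proof.
move=> of_.
apply: (df_fun (P := fun u e => order_rel c u (f (e 1%N))) 0 of_).
apply: (df_fun (P := fun u e => order_rel c (e 0) u) 2 of_).
by case: c => [[]|]; [exact: df_ltP|exact: df_ltP|exact: df_eq].
Qed.

Lemma o1_cont_at f : definable_fun f -> o1 (cont_at f).
Proof.
move=> of_; apply: df_fa; apply: df_fa.
apply: (df_fun (P := fun y e => e 1%N < y -> y < e 0 ->
  near_pt (e 2) (fun z => e 1%N < f z /\ f z < e 0)) 2 of_).
apply: df_imp; first exact: df_ltP.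
apply: df_imp; first exact: df_ltP.
apply: df_near_pt.
apply: (df_fun (P := fun y e => e 3 < y /\ y < e 2) 0 of_).
by apply: df_and; exact: df_ltP.
Qed.

Definition monotone_on c f (a b : R) :=
  forall x y, a < x -> x < y -> y < b -> order_rel c (f x) (f y).

Lemma monotone_on_sub c f a b a' b' : a <= a' -> b' <= b ->
  monotone_on c f a b -> monotone_on c f a' b'.
Proof. by move=> aa bb H x y ax xy yb; apply: H; lra. Qed.

(* For each [x] the sign of [f y - f x] is constant for [y] in some [(x, q)] with
   [q] rational; on an interval where this sign and [q] do not depend on [x], [f]
   is monotone. *)
Lemma monotone_on_subitv f a b : definable_fun f -> a < b -> exists c a' b',
  [/\ a <= a', a' < b', b' <= b & monotone_on c f a' b'].
Proof.
move=> of_ ab.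
pose X (q : rat * option bool) x :=
  x < ratr q.1 /\ forall y, x < y -> y < ratr q.1 -> order_rel q.2 (f x) (f y).
have [||q [a' [b' [aa' ab' bb' Xq]]]] := o1_cover (S := S) (X := X) (a := a) (b := b) _ ab.
- move=> q; apply: df_and; first exact: df_ltc.
  apply: df_fa; apply: df_imp; first exact: df_ltP.
  apply: df_imp; first exact: df_ltc.
  exact: (o2_at 1 0 (o2_order_rel q.2 of_)).
- move=> x _ _; suff [c [d xd H]] : exists c, near_right x (fun y => order_rel c (f x) (f y)).
    by have [q [? ?]] := rat_between xd; exists (q, c); split=> // y ? ?; apply: H => //=; lra.
  have [H|H] := o1_right x (o2_l x (o2_order_rel (Some true) of_)); first by exists (Some true).
  have [H'|H'] := o1_right x (o2_l x (o2_order_rel (Some false) of_)); first by exists (Some false).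
  exists None; apply: near_right_imp (near_right_and H H') => y /= -[] /negP + /negP.
  by case: ltgtP.
(* The bound [y < ratr q.1] required at [x] comes from [y] itself satisfying [X q]. *)
- exists q.2, a', b'; split=> // x y ax xy yb; apply: (Xq x ax _).2 => //; first lra.
  by have [] := Xq y ltac:(lra) yb.
Qed.

(* The image of a strictly monotone definable function contains an interval, and
   over this interval the function has no jumps. *)
Lemma cont_at_subitv c f a b : definable_fun f -> a < b -> monotone_on c f a b ->
  exists a' b', [/\ a <= a', a' < b', b' <= b & forall x, a' < x -> x < b' -> cont_at f x].
Proof.
move=> of_ ab sf; case: c sf => [s|] sf; last first.
  exists a, b; split=> // x ax xb u v ux xv; exists a, b; split=> // y ay yb.
  suff -> : f y = f x by [].
  by have [xy|yx|->//] := ltgtP x y; [rewrite (sf x y)|rewrite (sf y x)].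
have finj x y : a < x -> x < b -> a < y -> y < b -> f x = f y -> x = y.
  move=> ax xb ay yb fxy; have [xy|yx|//] := ltgtP x y.
    by have := sf x y ax xy yb; rewrite /= fxy ltxx; case: (s).
  by have := sf y x ay yx xb; rewrite /= fxy ltxx; case: (s).
have fmono x y : a < x -> x < b -> a < y -> y < b -> f x < f y ->
    if s then x < y else y < x.
  move=> ax xb ay yb fxy; have [xy|yx|E] := ltgtP x y.
  - by have := sf x y ax xy yb; case: (s) => //= /(lt_trans fxy); rewrite ltxx.
  - by have := sf y x ay yx xb; case: (s) => //= /(lt_trans fxy); rewrite ltxx.
  - by move: fxy; rewrite E ltxx.
have /o1_infinite[|c [d [cd H]]] : o1 (fun y => exists x, a < x /\ (x < b /\ y = f x)).
- apply: df_ex; apply: df_and; first exact: df_gtc.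
  apply: df_and; first exact: df_ltc.
  exact: (o2_at 0 1 of_).
- have iab : infinite_set [set x | a < x /\ x < b].
    by apply: (@has_interval_infinite _ (fun x => a < x /\ x < b)); exists a, b; split.
  apply: contra_not iab => fI; rewrite -(@eq_finite_set _ _ (f @` [set x | a < x /\ x < b])).
    by apply: sub_finite_set fI => y [x /= [ax xb] <-]; exists x.
  apply: inj_card_eq => x y /set_mem[ax xb] /set_mem[ay yb]; exact: finj.
(* All of [(c, d)] consists of values of [f]. Between the preimages [p] and [q] of its two inner
   thirds the values stay in [(c1, d1)], which leaves attained values on both sides. *)
pose c1 := (2 * c + d) / 3; pose d1 := (c + 2 * d) / 3.
have [p [ap [pb cp]]] : exists x, a < x /\ (x < b /\ c1 = f x) by apply: H; rewrite /c1; lra.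
have [q [aq [qb dq]]] : exists x, a < x /\ (x < b /\ d1 = f x) by apply: H; rewrite /d1; lra.
have [cc1 [cd1 d1d]] : c < c1 /\ (c1 < d1 /\ d1 < d) by rewrite /c1 /d1; lra.
have pq : if s then p < q else q < p by apply: fmono; rewrite -?cp -?dq.
exists (if s then p else q), (if s then q else p); split; [by case: (s); exact: ltW| | by case: (s); exact: ltW|].
  by case: (s) pq.
move=> x px xq u v ux xv.
have [ax xb] : a < x /\ x < b by case: (s) px xq => ? ?; split; lra.
have [c1x xd1] : c1 < f x /\ f x < d1.
  rewrite cp dq; case: s sf fmono pq px xq {finj} => sf _ pq px xq.
    by split; apply: sf.
  by split; apply: (sf _ _ _ _ _).
(* [y1] and [y2] are values of [f] between [u] and [f x], respectively [f x] and [v]; by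
   monotonicity their preimages bound the required neighbourhood. *)
pose y1 := (Num.max u c1 + f x) / 2; pose y2 := (Num.min v d1 + f x) / 2.
have [? [? ?]] : u <= Num.max u c1 /\ (c1 <= Num.max u c1 /\ Num.max u c1 < f x).
  by rewrite !le_max !lexx orbT gt_max ux c1x.
have [? [? ?]] : Num.min v d1 <= v /\ (Num.min v d1 <= d1 /\ f x < Num.min v d1).
  by rewrite !ge_min !lexx orbT lt_min xv xd1.
have [x1 [ax1 [x1b y1E]]] : exists z, a < z /\ (z < b /\ y1 = f z).
  by apply: H; rewrite /y1; lra.
have [x2 [ax2 [x2b y2E]]] : exists z, a < z /\ (z < b /\ y2 = f z).
  by apply: H; rewrite /y2; lra.
have y1x : y1 < f x by rewrite /y1; lra.
have xy2 : f x < y2 by rewrite /y2; lra.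
have uy1 : u < y1 by rewrite /y1; lra.
have y2v : y2 < v by rewrite /y2; lra.
have x1x : if s then x1 < x else x < x1 by apply: fmono; rewrite -?y1E.
have xx2 : if s then x < x2 else x2 < x by apply: fmono; rewrite -?y2E.
exists (if s then x1 else x2), (if s then x2 else x1); split; [by case: (s) x1x xx2|by case: (s) x1x xx2|].
case: s sf {fmono finj pq px xq x1x xx2} => sf z h1 h2.
  have /= := sf x1 z ax1 h1 ltac:(lra); have /= := sf z x2 ltac:(lra) h2 x2b.
  by rewrite -y1E -y2E => ? ?; split; lra.
have /= := sf x2 z ax2 h1 ltac:(lra); have /= := sf z x1 ltac:(lra) h2 x1b.
by rewrite -y1E -y2E => ? ?; split; lra.
Qed.

Definition regular c f x := exists a b, [/\ a < x, x < b, monotone_on c f a b &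
  forall z, a < z -> z < b -> cont_at f z].

Lemma o1_regular c f : definable_fun f -> o1 (regular c f).
Proof.
move=> of_; have dR : df (fun e => exists a b, [/\ a < e 0, e 0 < b &
  (forall x y, a < x -> x < y -> y < b -> order_rel c (f x) (f y)) /\
  forall z, a < z -> z < b -> cont_at f z]).
  apply: df_ex; apply: df_ex; apply: df_and3; try exact: df_ltP.
  apply: df_and; apply: df_fa.
    apply: df_fa; apply: df_imp; first exact: df_ltP.
    apply: df_imp; first exact: df_ltP.
    apply: df_imp; first exact: df_ltP.
    exact: (o2_at 1 0 (o2_order_rel c of_)).
  apply: df_imp; first exact: df_ltP.
  apply: df_imp; first exact: df_ltP.
  exact: (o1_at 0 (o1_cont_at of_)).
by apply: df_ext dR => e; split=> [[a [b [? ? []]]]|[a [b []]]]; exists a, b.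
Qed.

(** The monotonicity theorem, pointwise: an interval of exceptional points would contain one on
    which [f] is monotone and continuous. *)
Lemma regular_finite f : definable_fun f -> finite_set [set x | ~ exists c, regular c f x].
Proof.
move=> of_; apply: o1_finite.
  apply/df_not; have := df_or (o1_regular None of_)
    (df_or (o1_regular (Some true) of_) (o1_regular (Some false) of_)).
  apply: df_ext => e; split=> [[?|[?|?]]|[[[]|] ?]]; [by exists None|
    by exists (Some true)|by exists (Some false)|by right; left|by right; right|by left].
move=> [a [b [ab H]]].
have [c [a1 [b1 [aa1 ab1 bb1 sf]]]] := monotone_on_subitv of_ ab.
have [a2 [b2 [aa2 ab2 bb2 cf]]] := cont_at_subitv of_ ab1 sf.
apply: (H ((a2 + b2) / 2)); [lra|lra|exists c, a2, b2; split=> //; try lra].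
exact: monotone_on_sub sf.
Qed.

End DefinableFunctions.

(** * Uniform finiteness *)

Section GoodFibers.
Variables (R : realType) (S : ominimal_structure R).
Local Notation df := (df S).
Local Notation o1 := (o1 S).
Local Notation o2 := (o2 S).
Implicit Types (e : nat -> R) (f : R -> R) (A : R -> R -> Prop) (B : R -> Prop).

Definition none_in (u v : R) B := forall y, u < y -> y < v -> ~ B y.

Definition one_in (u v : R) B := (exists y, [/\ u < y, y < v & B y]) /\
  forall y z, u < y -> y < v -> B y -> u < z -> z < v -> B z -> y = z.

(* A first-order condition ensuring that near [x] the fibers of [A] are
   obtained from the fiber at [x] by moving each of its points continuously. *)
Definition good A x :=
  (exists m M, near_pt x (fun x' => forall y, A x' y -> m < y /\ y < M)) /\
  forall y u0 v0, u0 < y -> y < v0 -> exists u v,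
    [/\ u0 < u, u < y & y < v] /\ v < v0 /\
    near_pt x (fun x' => (A x y -> one_in u v (A x')) /\ (~ A x y -> none_in u v (A x'))).

Lemma df_good (A : R -> R -> (nat -> R) -> Prop) i :
  df (fun e => A (e 0) (e 1%N) (fun k => e k.+2)) ->
  df (fun e => good (fun x y => A x y e) (e i)).
Proof.
move=> dA.
(* Under quantifiers the parameters sit further up in the environment; [dA'] adapts the hypothesis
   to every depth. *)
have dA' j k n (t : (nat -> R) -> nat -> R) : (forall e l, t e l = e (l + n)%N) ->
    df (fun e => A (e j) (e k) (t e)).
  move=> tE; rewrite (_ : t = fun e l => e (l + n)%N).
    exact: (df_ren (fun l => if l is l'.+2 then (l' + n)%N else if l is 0 then j else k) dA).
  by apply/funext => e; apply/funext => l.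
apply: df_and.
  apply: df_ex; apply: df_ex; apply: df_near_pt; apply: df_fa; apply: df_imp.
    by apply: (dA' 1 0 4)%N => e l; rewrite addnC.
  by apply: df_and; exact: df_ltP.
apply: df_fa; apply: df_fa; apply: df_fa.
apply: df_imp; first exact: df_ltP.
apply: df_imp; first exact: df_ltP.
apply: df_ex; apply: df_ex; apply: df_and; first by apply: df_and3; exact: df_ltP.
apply: df_and; first exact: df_ltP.
apply: df_near_pt; apply: df_and; apply: df_imp.
- by apply: (dA' _ _ 6)%N => e l; rewrite addnC.
- apply: df_and.
    apply: df_ex; apply: df_and3; try exact: df_ltP.
    by apply: (dA' _ _ 7)%N => e l; rewrite addnC.
  apply: df_fa; apply: df_fa.
  apply: df_imp; first exact: df_ltP.
  apply: df_imp; first exact: df_ltP.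
  apply: df_imp; first by apply: (dA' _ _ 8)%N => e l; rewrite addnC.
  apply: df_imp; first exact: df_ltP.
  apply: df_imp; first exact: df_ltP.
  apply: df_imp; first by apply: (dA' _ _ 8)%N => e l; rewrite addnC.
  exact: df_eq.
- by apply: df_not; apply: (dA' _ _ 6)%N => e l; rewrite addnC.
- apply: df_fa.
  apply: df_imp; first exact: df_ltP.
  apply: df_imp; first exact: df_ltP.
  by apply: df_not; apply: (dA' _ _ 7)%N => e l; rewrite addnC.
Qed.

(** The bounds [m] and [M] confine the fibers near [x] to a segment. Gluing the local boxes along it
    shows that, for one neighbourhood of [x], the fibers have points only in the boxes around points
    of the fiber at [x], and exactly one in each. Boxes of radius [r / 2] around points at distance
    at least [r] are disjoint, whence a bijection. *)
Lemma good_card A x : good A x -> finite_set [set y | A x y] ->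
  near_pt x (fun x' => ([set y | A x' y] #= [set y | A x y])%card).
Proof.
move=> [[m [M bd]] nrm] /finite_set_seq [s sA].
have [r r0 sep] := seq_separated s.
have /choice [uv uvP] : forall y, exists uv : R * R,
    [/\ y - r / 2 < uv.1, uv.1 < y & y < uv.2] /\ uv.2 < y + r / 2 /\
    near_pt x (fun x' => (A x y -> one_in uv.1 uv.2 (A x')) /\
                    (~ A x y -> none_in uv.1 uv.2 (A x'))).
  move=> y; have [|u [v H]] := nrm y (y - r / 2) (y + r / 2) ltac:(lra); first lra.
  by exists (u, v).
pose covered x' y := A x' y -> exists2 z, z \in s & (uv z).1 < y /\ y < (uv z).2.
(* The terms [x] and [x + 1] make the segment nondegenerate: when the fibers are empty, [m < M] may
   fail. *)
have cov : near_pt x (fun x' => forall y, Num.min m x <= y -> y <= Num.max M (x + 1) -> covered x' y).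
  apply: (@segment_chain _ (fun a b => near_pt x (fun x' => forall y, a <= y -> y <= b -> covered x' y))).
  - move=> a b c ab bc; apply: near_pt_imp (near_pt_and ab bc) => x' [H H'] y ay yc.
    by have [yb|/ltW by_] := leP y b; [exact: H|exact: H'].
  - have : Num.min m x <= x by rewrite ge_min lexx orbT.
    have : x + 1 <= Num.max M (x + 1) by rewrite le_max lexx orbT.
    lra.
  - move=> z _ _; have [[_ uz zv] [_ Hz]] := uvP z; exists (uv z).1, (uv z).2; split=> //.
    move=> a b ua ab bv _ _; apply: near_pt_imp Hz => x' [Hz1 Hz0] y ay yb Ay.
    have uy : (uv z).1 < y by exact: lt_le_trans ay.
    have yv : y < (uv z).2 by exact: le_lt_trans bv.
    have [Az|nAz] := pselect (A x z); first by exists z => //; apply/sA.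
    by have := Hz0 nAz y uy yv.
have one : near_pt x (fun x' => forall z, z \in s -> one_in (uv z).1 (uv z).2 (A x')).
  apply: near_pt_all => z /sA Az; have [_ [_ Hz]] := uvP z.
  by apply: near_pt_imp Hz => x' [/(_ Az)].
apply: near_pt_imp (near_pt_and bd (near_pt_and cov one)) => x' [{}bd [{}cov {}one]].
have /choice [g gP] : forall z, exists y, z \in s ->
    [/\ (uv z).1 < y, y < (uv z).2 & A x' y].
  move=> z; have [/one[[y Hy] _]|zs] := boolP (z \in s); first by exists y.
  by exists 0.
have -> : [set y | A x' y] = g @` [set y | A x y].
  apply/seteqP; split=> [y /= Ay|y [z /= /sA zs <-]]; last by have [] := gP z zs.
  have [my yM] := bd y Ay.
  have [||//|z zs [zy yz]] := cov y.
  - by rewrite ge_min ltW.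
  - by rewrite le_max ltW.
  exists z; first exact/sA.
  by have [? ? ?] := gP z zs; apply: (one z zs).2.
apply: inj_card_eq => y z /set_mem/sA ys /set_mem/sA zs gyz.
have [[? _ _] [? _]] := uvP y; have [[? _ _] [? _]] := uvP z.
have [? ? _] := gP y ys; have [? ? _] := gP z zs.
apply/eqP/negP => /negP yz; have := sep y z ys zs yz.
rewrite real_ler_normr ?num_real// => /orP[|]; lra.
Qed.

Lemma good_branches A k (fs : nat -> R -> R) (a b : R) x : a < x -> x < b ->
  (forall x', a < x' -> x' < b -> forall y, A x' y <-> exists2 i, (i < k)%N & y = fs i x') ->
  (forall x', a < x' -> x' < b -> forall i j, (i < k)%N -> (j < k)%N ->
     fs i x' = fs j x' -> i = j) ->
  (forall i, (i < k)%N -> cont_at (fs i) x) -> good A x.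
Proof.
move=> ax xb AE fsI fsC.
have near r : 0 < r -> near_pt x (fun x' => forall i, i \in iota 0 k ->
    fs i x - r < fs i x' /\ fs i x' < fs i x + r).
  move=> r0; apply: near_pt_all => i; rewrite mem_iota add0n => ik.
  by apply: fsC => //; lra.
have ax' : near_pt x (fun x' => a < x' /\ x' < b) by exists a, b; split.
have memk i : (i < k)%N -> i \in iota 0 k by rewrite mem_iota.
split.
  have [m [M mM]] := seq_bounds [seq fs i x | i <- iota 0 k].
  exists (m - 1), (M + 1); apply: near_pt_imp (near_pt_and ax' (near 1 ltr01)) => x' [[? ?] H] y.
  move=> /AE[]// i ik ->; have [? ?] := mM (fs i x) (map_f (fun i => fs i x) (memk i ik)).
  by have [? ?] := H i (memk i ik); lra.
move=> y u0 v0 uy yv.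
have [r r0 apart] := seq_apart [seq fs i x | i <- iota 0 k] y.
(* With a third of the separation, a branch not passing through [y] starts at distance at least
   [3 * d] from [y], moves by less than [d], and so stays out of the box of radius [d]. *)
pose d := Num.min r (Num.min (y - u0) (v0 - y)) / 3.
have [d0 [dr [du dv]]] : 0 < d /\ (3 * d <= r /\ (3 * d <= y - u0 /\ 3 * d <= v0 - y)).
  rewrite /d; set t := Num.min _ _.
  have : t <= r by rewrite ge_min lexx.
  have : t <= y - u0 by rewrite !ge_min lexx orbT.
  have : t <= v0 - y by rewrite !ge_min lexx !orbT.
  have : 0 < t by rewrite !lt_min r0 !subr_gt0 uy yv.
  by move=> *; do !split; lra.
exists (y - d), (y + d); do !split; try lra.
apply: near_pt_imp (near_pt_and ax' (near d d0)) => x' [[ax1 xb1] H].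
have far i : (i < k)%N -> fs i x != y -> ~ (y - d < fs i x' /\ fs i x' < y + d).
  move=> ik /(apart _ (map_f (fun i => fs i x) (memk i ik))).
  have := H i (memk i ik).
  by rewrite real_ler_normr ?num_real// => + /orP[]; lra.
split=> [/AE[]// i ik yE|nA z uz zv /AE[]// i ik zE]; last first.
  apply: (far i ik); last by rewrite -zE.
  by apply: contra_notN nA => /eqP yE; apply/AE => //; exists i.
have same j : (j < k)%N -> y - d < fs j x' -> fs j x' < y + d -> j = i.
  move=> jk h1 h2; apply: (fsI x) => //; rewrite -yE; apply: contrapT => /eqP yj.
  by apply: (far j jk yj).
split.
  exists (fs i x'); have [] := H i (memk i ik); rewrite -yE => ? ?.
  by split=> //; apply/AE => //; exists i.
move=> z w uz zv /AE[]// j jk zE uw wv /AE[]// l lk wE.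
have ji : j = i by apply: (same j jk); rewrite -zE.
have li : l = i by apply: (same l lk); rewrite -wE.
by rewrite zE wE ji li.
Qed.

(** The least point of the fiber is a definable function, continuous on a subinterval; removing it
    lowers [k] by one. *)
Lemma branches A k (a b : R) : o2 A -> a < b ->
  (forall x, finite_set [set y | A x y]) ->
  (forall x, a < x -> x < b -> ncard [set y | A x y] = k) ->
  exists (fs : nat -> R -> R) a' b', [/\ a <= a', a' < b', b' <= b &
    forall x, a' < x -> x < b' -> [/\
      forall y, A x y <-> exists2 i, (i < k)%N & y = fs i x,
      forall i j, (i < k)%N -> (j < k)%N -> fs i x = fs j x -> i = j &
      forall i, (i < k)%N -> cont_at (fs i) x]].
Proof.
elim: k A a b => [|k IH] A a b oA ab fA cA.
  exists (fun=> id), a, b; split=> // x ax xb; split=> // y.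
  split=> [Ay|[]//]; have := ncard_eq0 (fA x) (cA x ax xb).
  by move=> /seteqP[/(_ y Ay)].
pose M x y := A x y /\ forall z, A x z -> y <= z.
pose f x := xget 0 [set y | M x y].
have of_ : definable_fun S f.
  apply: definable_fun_xget.
    apply: df_and => //; apply: df_fa; apply: df_imp; first exact: (o2_at 1 0 oA).
    exact: df_leP.
  by move=> x y z [Ay Hy] [Az Hz]; apply/eqP; rewrite eq_le Hy// Hz.
have fP x : a < x -> x < b -> M x (f x).
  move=> ax xb; apply: (@xgetPex _ 0 [set y | M x y]).
  have [|m Am Hm] := finite_min (fA x); last by exists m.
  apply: contrapT => /set0P/negP/negPn/eqP A0.
  by have := cA x ax xb; rewrite A0 ncard_set0.
have [c [a1 [b1 [aa1 ab1 bb1 sf]]]] := monotone_on_subitv of_ ab.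
have [a2 [b2 [aa2 ab2 bb2 cf]]] := cont_at_subitv of_ ab1 sf.
pose A' x y := A x y /\ y <> f x.
have fA' x : finite_set [set y | A' x y] by apply: sub_finite_set (fA x) => y [].
have [||fs [a3 [b3 [aa3 ab3 bb3 H]]]] := IH A' a2 b2 _ ab2 fA'.
- by apply: df_and => //; apply: df_not; exact: (o2_at 0 1 of_).
- move=> x ax xb; have [||Af _] := fP x; [lra|lra|].
  have := ncardD1 (fA x) Af; rewrite cA; [|lra|lra].
  by move=> [] ->.
exists (fun i => if i is i'.+1 then fs i' else f), a3, b3; split=> //; [lra|lra|].
move=> x ax xb; have [A'E fsI fsC] := H x ax xb.
have [||Af _] := fP x; [lra|lra|].
split=> [y|i j|[_|i]].
- split=> [Ay|[[_ ->//|i ik yE]]].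
    have [->|/eqP yf] := eqVneq y (f x); first by exists 0.
    by have [i ik yE] := (A'E y).1 (conj Ay yf); exists i.+1.
  by have [] : A' x y by apply/A'E; exists i.
- case: i j => [|i] [|j] // ik jk E.
  + have [_ nE] : A' x (fs j x) by apply/A'E; exists j.
    by case: nE.
  + have [_ nE] : A' x (fs i x) by apply/A'E; exists i.
    by case: nE.
  + by rewrite (fsI i j).
- by apply: cf; lra.
- exact: fsC.
Qed.

(** On any interval of bad points the cardinality, having countably many values, is constant on a
    subinterval. There the fibers split, after further shrinking, into continuous branches, and such
    points are good. *)
Lemma bad_finite A : o2 A -> (forall x, finite_set [set y | A x y]) ->
  finite_set [set x | ~ good A x].
Proof.
move=> oA fA; apply: o1_finite.
  exact/df_not/(df_good (A := fun x y _ => A x y)).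
move=> [a [b [ab H]]].
have [||k [a1 [b1 [aa1 ab1 bb1 cA]]]] := o1_cover (S := S)
  (X := fun k x => ncard [set y | A x y] = k) (a := a) (b := b) _ ab.
- move=> k; apply: (@df_ncard_eq _ S k (fun e => [set y | A (e 0) y])) => [e|]; first exact: fA.
  exact: (o2_at 1 0 oA).
- by move=> x _ _; exists (ncard [set y | A x y]).
have [fs [a2 [b2 [aa2 ab2 bb2 br]]]] := branches oA ab1 fA cA.
apply: (H ((a2 + b2) / 2)); [lra|lra|].
have brx x : a2 < x -> x < b2 -> _ := br x.
apply: (@good_branches A k fs a2 b2); [lra|lra| | |].
- by move=> x ax xb; have [] := br x ax xb.
- by move=> x ax xb; have [] := br x ax xb.
- by have [||] := br ((a2 + b2) / 2); [lra|lra|].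
Qed.

End GoodFibers.

(** * Families of sets of reals depending on finitely many parameters *)

Section FamilyLemmas.
Variables (R : realType) (S : ominimal_structure R).
Local Notation df := (df S).
Implicit Types (e : nat -> R) (P Q : (nat -> R) -> Prop) (A : (nat -> R) -> set R).

Definition agree n e e' := forall k, (k < n)%N -> e k = e' k.

Definition dep n P := forall e e', agree n e e' -> P e -> P e'.

Definition fdep n A := forall e e', agree n e e' -> A e = A e'.

Definition dfs A := df (fun e => A (fun k => e k.+1) (e 0)).

Lemma agree_sym n e e' : agree n e e' -> agree n e' e.
Proof. by move=> H k kn; rewrite H. Qed.

Lemma agree_le m n e e' : (m <= n)%N -> agree n e e' -> agree m e e'.
Proof. by move=> mn H k km; apply: H; exact: leq_trans mn. Qed.

Lemma agree_upd n e e' i x : agree n e e' -> agree n (upd e i x) (upd e' i x).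
Proof. by move=> H k kn; rewrite /upd; case: eqP => // _; apply: H. Qed.

Lemma agree_updS n e e' x : agree n e e' -> agree n.+1 (upd e n x) (upd e' n x).
Proof.
move=> H k; rewrite ltnS leq_eqVlt /upd => /predU1P[->|kn]; first by rewrite eqxx.
by case: eqP => // _; apply: H.
Qed.

Lemma dfs_at A t j : dfs A -> ren_cst t -> df (fun e => A (t e) (e j)).
Proof.
move=> dA [s [c tE]].
apply: (df_comp (P := fun e => A (fun k => e k.+1) (e 0))
  (t := fun e k => if k is k'.+1 then t e k' else e j)) dA.
exists (fun k => if k is k'.+1 then s k' else Some j),
  (fun k => if k is k'.+1 then c k' else 0) => e [|k] //; exact: tE.
Qed.

Lemma dep_iff n P e e' : dep n P -> agree n e e' -> P e = P e'.
Proof.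
by move=> dP ee; apply/propext; split; apply: dP => //; exact: agree_sym.
Qed.

Lemma manys_depn n s P : dep n P -> dep n (manys s P).
Proof.
move=> dP; elim: s => //= i s IH e e' ee; apply: has_interval_imp => y.
exact/IH/agree_upd.
Qed.

Lemma manys_iota_dep d n P : dep n P -> dep d (manys (iota d (n - d)) P).
Proof.
move=> dP e e' ee Pe; pose e1 k := if (k < n)%N then e k else e' k.
apply: (manys_dep (e := e1)) => [k|].
  by rewrite mem_iota /e1 => ks; case: ifP => // kn; apply: ee; lia.
have dm := @manys_depn n (iota d (n - d)) P dP.
by apply: dm Pe => k kn; rewrite /e1 kn.
Qed.

Lemma dfs_many A d : dfs A ->
  df (fun e => ~ good (fun x y => A (upd e d x) y) (e d)).
Proof.
move=> dA; apply/df_not/(df_good (A := fun x y e => A (upd e d x) y)).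
by apply: dfs_at dA _; apply: ren_upd; exact: ren_ren.
Qed.

(** For finite [B], the number of points of [B] below [x] labels the gap containing [x], and does so
    definably. *)
Definition below (B : set R) x : set R := [set z | B z /\ z < x].

Lemma below_finite (B : set R) x : finite_set B -> finite_set (below B x).
Proof. by apply: sub_finite_set => z []. Qed.

Lemma ncard_below (B : set R) x y : finite_set B -> B x -> x < y ->
  (ncard (below B x) < ncard (below B y))%N.
Proof.
move=> fB Bx xy.
have fy : finite_set (below B y) by exact: below_finite.
rewrite (ncardD1 fy (y := x))// ltnS; apply: le_ncard.
  by apply: sub_finite_set fy => z [].
move=> z /= [Bz zx]; split; first by split=> //; exact: lt_trans xy.
by move=> zE; rewrite zE ltxx in zx.
Qed.

Lemma bound_all K (P : nat -> nat -> Prop) :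
  (forall i k l, (k <= l)%N -> P i k -> P i l) ->
  (forall i, (i <= K)%N -> exists k, P i k) ->
  exists k, forall i, (i <= K)%N -> P i k.
Proof.
move=> mono; elim: K => [|K IH] H.
  by have [k Pk] := H 0 isT; exists k => i; rewrite leqn0 => /eqP ->.
have [k Hk] := IH (fun i iK => H i (leqW iK)); have [l Hl] := H K.+1 (leqnn _).
exists (maxn k l) => i; rewrite leq_eqVlt => /predU1P[->|].
  by apply: mono Hl; exact: leq_maxr.
by rewrite ltnS => /Hk; apply: mono; exact: leq_maxl.
Qed.

End FamilyLemmas.

Section UniformFiniteness.
Variables (R : realType) (S : ominimal_structure R).
Local Notation df := (df S).
Local Notation dfs := (dfs S).
Implicit Types (e : nat -> R) (A B : (nat -> R) -> set R).

Definition uniformly_finite n := forall A, dfs A -> fdep n A ->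
  (forall e, finite_set (A e)) -> exists k, forall e, (ncard (A e) <= k)%N.

Section Step.
Variables (n : nat) (A : (nat -> R) -> set R).
Hypotheses (dA : dfs A) (nA : fdep n A) (fA : forall e, finite_set (A e)).
Hypothesis UF : forall n', (n' < n)%N -> uniformly_finite n'.

Let bdd (C : (nat -> R) -> Prop) := exists k, forall e, C e -> (ncard (A e) <= k)%N.

(* Over a [d]-cell the cardinality depends on the first [d] coordinates only, and
   the slices along the remaining coordinates are large in all these
   directions. *)
Let cell d (C : (nat -> R) -> Prop) := [/\ df C, dep n C,
  forall e, C e -> manys (iota d (n - d)) C e &
  forall e e', C e -> C e' -> agree d e e' -> ncard (A e) = ncard (A e')].

(* The part of [C] over the finitely many values in [B e] of the coordinate [d]
   lives over [n - 1] coordinates. *)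
Let thin_bdd d (C : (nat -> R) -> Prop) B i : (d < n)%N -> df C -> dep n C ->
  dfs B -> fdep d B -> (forall e, finite_set (B e)) ->
  bdd (fun e => [/\ C e, B e (e d) & ncard (below (B e) (e d)) = i]).
Proof.
move=> dn dC nC dB nB fB.
have fBlt e x : finite_set (below (B e) x) by exact: below_finite.
(* At most one [x] in [B e] has exactly [i] points of [B e] below it, so the existential merely
   substitutes this [x] for coordinate [d]. *)
pose Ai e := [set y | exists x, (B e x /\ ncard (below (B e) x) = i) /\
  (C (upd e d x) /\ A (upd e d x) y)].
have AiE e e' : (forall k, (k < n)%N -> k != d -> e k = e' k) -> Ai e = Ai e'.
  move=> ee; have BE : B e = B e' by apply: nB => k kd; apply: ee; [exact: ltn_trans dn|rewrite ltn_eqF].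
  have ux x : agree n (upd e d x) (upd e' d x).
    by move=> k kn; rewrite /upd; case: eqP => // /eqP; exact: ee.
  apply/seteqP; split=> y [x [Bx [Cx Ax]]]; exists x.
    by rewrite -BE -(nA (ux x)); split=> //; split=> //; exact: (nC _ _ (ux x)).
  by rewrite BE (nA (ux x)); split=> //; split=> //; exact: (nC _ _ (agree_sym (ux x))).
(* [Ai] ignores coordinate [d]. Reading coordinate [n.-1] from this vacant place leaves a family
   with [n.-1] parameters. *)
pose t (e : nat -> R) k := e (if k == n.-1 then d else k).
have [||||k Hk] := @UF n.-1 _ (fun e => Ai (t e)).
- by rewrite prednK// (leq_ltn_trans _ dn).
- apply: df_ex; apply: df_and.
    apply: df_and; first by apply: dfs_at dB _; exact: ren_ren.
    apply: df_ncard_eq => [e|]; first exact: fBlt.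
    by apply: df_and; [apply: dfs_at dB _; exact: ren_ren|exact: df_ltP].
  apply: df_and.
    by apply: (df_comp (P := C)) dC; apply: ren_upd; exact: ren_ren.
  by apply: dfs_at dA _; apply: ren_upd; exact: ren_ren.
- move=> e e' ee; apply: AiE => k kn kd; apply: ee.
  have [kE|/eqP kn1] := eqVneq k n.-1; first by move: kd; rewrite kE; lia.
  have {}kn1 : k <> n.-1 :> nat by [].
  by lia.
- move=> e; have [[x Bx]|nx] := pselect (exists x, B (t e) x /\ ncard (below (B (t e)) x) = i).
    apply: (@sub_finite_set _ _ (A (upd (t e) d x))); last exact: fA.
    move=> y [x' [[Bx' x'i] [_]]]; suff -> : x' = x by [].
    have [x'x|xx'|//] := ltgtP x' x.
      by have := ncard_below (fB _) Bx' x'x; rewrite x'i Bx.2 ltnn.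
    by have := ncard_below (fB _) Bx.1 xx'; rewrite x'i Bx.2 ltnn.
  by rewrite (_ : Ai _ = set0)//; apply/seteqP; split=> // y [x [Bx _]]; apply: nx; exists x.
exists k => e [Ce Be ei]; apply: leq_trans (Hk (fun k => if k == d then e n.-1 else e k)).
have -> : Ai (t (fun k => if k == d then e n.-1 else e k)) = Ai e.
  apply: AiE => l ln ld; rewrite /t; case: (eqVneq l n.-1) => [->|_].
    by rewrite eqxx.
  by rewrite (negPf ld).
apply: le_ncard => [|y Ay]; last by exists (e d); rewrite upd_id.
apply: (@sub_finite_set _ _ (A e)); last exact: fA.
move=> y [x [[Bx xi] [_]]]; suff -> : x = e d by rewrite upd_id.
have [xe|ex|//] := ltgtP x (e d).
  by have := ncard_below (fB _) Bx xe; rewrite xi ei ltnn.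
by have := ncard_below (fB _) Be ex; rewrite xi ei ltnn.
Qed.

(** Along coordinate [d], [C] is cut at the finitely many points of [B e], where its projection or
    the cardinality may jump. In each gap the cardinality does not depend on coordinate [d], so the
    part of [C] there is a [d]-cell; the part over the cuts is bounded by [thin_bdd]. As [B] has
    only [d < n] parameters, the number of gaps is bounded. *)
Let cell_bdd d C : (d <= n)%N -> cell d C -> bdd C.
Proof.
elim: d C => [|d IH] C dn [dC nC largeC cardC].
  have [[e0 Ce0]|C0] := pselect (exists e, C e).
    by exists (ncard (A e0)) => e Ce; rewrite (cardC e e0).
  by exists 0 => e Ce; exfalso; apply: C0; exists e.
pose s := iota d.+1 (n - d.+1).
have sE : iota d (n - d) = d :: s by rewrite /s -[in LHS](subnSK dn).
have ds : d \notin s by rewrite mem_iota ltnn.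
pose pC := manys s C.
have dpC : df pC by exact: df_manys.
have npC : dep d.+1 pC by exact: manys_iota_dep.
(* Points of [C] through which the cardinality cannot be transported in direction [d]. *)
pose Z e := C e /\ (~ good (fun x y => A (upd e d x) y) (e d) \/
  ~ near_pt (e d) (fun x => C (upd e d x))).
have dZ : df Z.
  apply: df_and => //; apply: df_or; first exact: dfs_many.
  apply/df_not/df_near_pt; apply: (df_comp (P := C)) dC; apply: ren_upd; exact: ren_ren.
have nZ : dep n Z.
  move=> e e' ee [Ce H]; split; first exact: nC Ce.
  rewrite -(ee d dn) (_ : (fun x y => A (upd e' d x) y) = (fun x y => A (upd e d x) y)).
    rewrite (_ : (fun x => C (upd e' d x)) = (fun x => C (upd e d x)))//.
    by apply/funext => x; apply: dep_iff nC _; exact/agree_upd/agree_sym.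
  by apply/funext => x; rewrite (nA (agree_upd d x ee)).
(* The cardinality over a point may be read off any point of [C] above it, so exceptional points
   force a cut only when they are large in the remaining directions. *)
pose J e := manys s Z e \/ ~ (near_pt (e d) (fun x => pC (upd e d x)) \/
  near_pt (e d) (fun x => ~ pC (upd e d x))).
pose B e := [set x | J (upd e d x)].
have dJ : df J.
  apply: df_or; first exact: df_manys.
  apply/df_not/df_or; apply: df_near_pt; last apply: df_not;
    by apply: (df_comp (P := pC)) dpC; apply: ren_upd; exact: ren_ren.
have nJ : dep d.+1 J.
  move=> e e' ee [Ze|bd]; [left|right]; first exact: manys_iota_dep nZ _ _ ee Ze.
  have <- : (fun x => pC (upd e d x)) = (fun x => pC (upd e' d x)).
    by apply/funext => x; exact: dep_iff npC (agree_upd d x ee).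
  have <- : (fun x => ~ pC (upd e d x)) = (fun x => ~ pC (upd e' d x)).
    by apply/funext => x; rewrite (dep_iff npC (agree_upd d x ee)).
  by rewrite -(ee d (ltnSn d)).
have dB : dfs B by apply: (df_comp (P := J)) dJ; apply: ren_upd; exact: ren_ren.
have nB : fdep d B.
  by move=> e e' ee; apply/funext => x; exact: dep_iff nJ (agree_updS x ee).
have bd_finite (P : (nat -> R) -> Prop) e : df P ->
    finite_set [set x | ~ (near_pt x (fun y => P (upd e d y)) \/ near_pt x (fun y => ~ P (upd e d y)))].
  by move=> dP; apply: (o1_boundary (S := S)); exact: many_o1.
have updF (T : Type) (F : (nat -> R) -> T) e x :
    (fun y => F (upd (upd e d x) d y)) = (fun y => F (upd e d y)).
  by apply/funext => y; rewrite upd_upd.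
have fB e : finite_set (B e).
  apply: (@sub_finite_set _ _ ([set x | manys s Z (upd e d x)] `|`
    [set x | ~ (near_pt x (fun y => pC (upd e d y)) \/ near_pt x (fun y => ~ pC (upd e d y)))])).
    move=> x [|]; first by left.
    by rewrite upd_same (updF _ pC) (updF _ (fun e => ~ pC e)); right.
  rewrite finite_setU; split; last exact: bd_finite.
  (* Exchanging the quantifiers makes direction [d] innermost; with all other coordinates fixed, the
     finiteness results for one parameter apply. *)
  apply: (o1_finite (many_o1 d e (df_manys s dZ))).
  move=> /(many_manys_swap dZ ds) /manys_ex [e' /has_interval_infinite + _]; apply.
  apply: (@sub_finite_set _ _ ([set x | ~ good (fun x y => A (upd e' d x) y) x] `|`
    [set x | ~ (near_pt x (fun y => C (upd e' d y)) \/ near_pt x (fun y => ~ C (upd e' d y)))])).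
    move=> x [Cx]; rewrite upd_same (updF _ C) (updF _ (fun e y => A e y)) => -[|nnb]; first by left.
    by right=> -[//|/near_pt_self].
  rewrite finite_setU; split; last exact: bd_finite.
  apply: bad_finite => [|x]; last exact: fA.
  by apply: (dfs_at (t := fun e => upd e' d (e 0)) 1) dA _; apply: ren_upd; exact: ren_c.
have fBlt e x : finite_set (below (B e) x) by exact: below_finite.
have [K HK] := UF dn dB nB fB.
(* off [B], membership in the projection and cardinality are locally constant *)
pose r e x1 x2 := pC (upd e d x1) -> pC (upd e d x2) /\ forall e1 e2, C e1 -> C e2 ->
  agree d.+1 (upd e d x1) e1 -> agree d.+1 (upd e d x2) e2 -> ncard (A e1) = ncard (A e2).
have pC_ex e : pC e -> exists2 e', C e' & agree d.+1 e e'.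
  move=> /manys_ex [e' Ce' ee']; exists e' => // k kd; rewrite ee'// mem_iota.
  by rewrite negb_and -ltnNge kd.
have pCI e e' : C e' -> agree d.+1 e e' -> pC e.
  by move=> /largeC + ee; apply: npC; exact: agree_sym.
have r_trans e x y z : r e x y -> r e y z -> r e x z.
  move=> rxy ryz px; have [py xy] := rxy px; have [pz yz] := ryz py; split=> // e1 e3 C1 C3 h1 h3.
  have [e2 C2 h2] := pC_ex _ py.
  by rewrite (xy e1 e2)//; exact: yz.
have r_loc e z : ~ B e z -> exists u v, [/\ u < z, z < v &
    forall x y, u < x -> x < y -> y < v -> r e x y].
  move=> /not_orP[nZz /contrapT]; rewrite upd_same (updF _ pC) (updF _ (fun e => ~ pC e)).
  case=> [nbp|[u [v [uz zv H]]]]; last first.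
    exists u, v; split=> // x y ux xy yv px; exfalso; apply: H px => //.
    exact: lt_trans xy yv.
  (* The slice of [C] over [z] is large and its part in [Z] is not, so some point [e'] of the slice
     avoids [Z]. *)
  have [] := @manys_or _ S s Z (fun e => C e /\ ~ Z e) (upd e d z) dZ.
  - by apply: df_and => //; exact: df_not.
  - apply: manys_imp (near_pt_self nbp) => e' Ce'.
    by have [?|?] := pselect (Z e'); [left|right].
  - by [].
  move=> /manys_ex [e' [Ce' nZe'] ee'].
  have e'd : e' d = z by rewrite ee'// upd_same.
  have [gd nbC] : good (fun x y => A (upd e' d x) y) z /\ near_pt z (fun x => C (upd e' d x)).
    by rewrite -e'd; split; apply: contrapT => H; apply: nZe'; split=> //; [left|right].
  have ag x : agree d.+1 (upd e d x) (upd e' d x).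
    move=> k kd; rewrite /upd; case: eqP => // /eqP kd'; rewrite ee'; first by rewrite upd_other.
    by rewrite mem_iota negb_and -ltnNge kd.
  have [u [v [uz zv H]]] := near_pt_and nbp (near_pt_and nbC (good_card gd (fA _))).
  have cE x e1 : u < x -> x < v -> C e1 -> agree d.+1 (upd e d x) e1 ->
      ncard (A e1) = ncard (A (upd e' d z)).
    move=> ux xv C1 h1; have [_ [Cx /(ncard_eq (fA _)) <-]] := H x ux xv.
    apply: cardC => // k kd; rewrite -(h1 k kd); exact: ag.
  exists u, v; split=> // x y ux xy yv px.
  have xv := lt_trans xy yv; have uy := lt_trans ux xy.
  split=> [|e1 e2 C1 C2 h1 h2]; first by have [] := H y uy yv.
  by rewrite (cE x)// (cE y).
have gap e x y : x <= y -> ~ B e x -> ~ B e y ->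
    ncard (below (B e) x) = ncard (below (B e) y) ->
    forall z, x <= z -> z <= y -> ~ B e z.
  move=> xy nBx nBy cxy z xz zy Bz.
  have zy' : z < y by rewrite lt_neqAle zy andbT; apply/eqP => zE; rewrite -zE in nBy.
  have := ncard_below (fB e) Bz zy'; rewrite -cxy ltnNge => /negP; apply.
  by apply: le_ncard => // w [Bw wx]; split=> //; exact: lt_le_trans xz.
pose G i e := ~ B e (e d) /\ ncard (below (B e) (e d)) = i.
have nG i : dep d.+1 (G i).
  move=> e e' ee [nBe ei]; have BE := nB _ _ (agree_le (leqnSn d) ee).
  by rewrite /G -BE -(ee d).
have cellG i : cell d (fun e => C e /\ G i e).
  split.
  - apply: df_and => //; apply: df_and.
      by apply/df_not; apply: (dfs_at (t := id) d dB); exact: ren_id.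
    apply: df_ncard_eq => [e|]; first exact: fBlt.
    by apply: df_and; [apply: dfs_at dB _; exact: ren_ren|exact: df_ltP].
  - move=> e e' ee [Ce Ge]; split; first exact: nC Ce.
    by apply: nG Ge; exact: agree_le ee.
  - move=> e [Ce Ge]; have [nBe ei] := Ge; rewrite sE /=; apply: (near_pt_itv (x := e d)).
    have nbp : near_pt (e d) (fun x => pC (upd e d x)).
      have [_ /contrapT] := (not_orP _ _).1 nBe.
      rewrite upd_same (updF _ pC) (updF _ (fun e => ~ pC e)) => -[//|/near_pt_self].
      by rewrite upd_id => npCe; exfalso; apply: npCe; exact: pCI Ce _.
    have [t tB] := finite_set_seq (fB e).
    (* As [e d] lies outside the finite set [B e], nearby points lie in the same gap. *)
    have nbB : near_pt (e d) (fun x => forall b, b \in t -> (b < x) = (b < e d) /\ b <> x).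
      apply: near_pt_all => b /tB Bb; have [be|eb|be] := ltgtP b (e d).
      + by apply: near_pt_imp (near_pt_gt be) => x bx; split=> // bE; rewrite bE ltxx in bx.
      + apply: near_pt_imp (near_pt_lt eb) => x xb; rewrite ltNge ltW//; split=> // bE.
        by rewrite bE ltxx in xb.
      + by rewrite be in Bb.
    apply: near_pt_imp (near_pt_and nbp nbB) => x [px Hx].
    apply: manys_and px _ => [e1 e2 e12|].
      apply: nG => k kd; apply: e12.
      by rewrite mem_iota negb_and -ltnNge kd.
    have BE : B (upd e d x) = B e by apply: nB => k kd; rewrite upd_other// ltn_eqF.
    split; rewrite BE upd_same; first by move=> /tB /Hx[].
    rewrite -ei; congr ncard; apply/seteqP; split=> b [Bb bx];
      have [xE _] := Hx b (iffRL (tB b) Bb); split=> //; by move: bx; rewrite xE.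
  - move=> e e' [Ce [nBe ei]] [Ce' [nBe' ei']] ee.
    wlog le : e e' Ce Ce' nBe nBe' ei ei' ee / e d <= e' d.
      move=> H; have [le|/ltW le] := leP (e d) (e' d); first exact: H.
      by symmetry; apply: H => //; exact: agree_sym.
    have BE : B e' = B e by apply: nB; exact: agree_sym.
    have ag : agree d.+1 (upd e d (e' d)) e'.
      by rewrite -{2}(upd_id e' d); exact: agree_updS.
    rewrite BE in nBe' ei'.
    move: le; rewrite le_eqVlt => /predU1P[ed|lt].
      by apply: cardC => //; rewrite -(upd_id e d) ed.
    have rr : r e (e d) (e' d).
      apply: segment_chain lt _; first exact: r_trans.
      move=> z ez ze'; have nBz : ~ B e z.
        by apply: (gap e (e d) (e' d)) => //; [exact: le_trans ze'|rewrite ei ei'].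
      have [u [v [uz zv H]]] := r_loc e z nBz.
      by exists u, v; split=> // x y ux xy yv _ _; exact: H.
    have pe : pC (upd e d (e d)) by rewrite upd_id; exact: pCI Ce _.
    by have [_ H] := rr pe; apply: H => //; rewrite upd_id.
have [k Hk] : exists k, forall i, (i <= K)%N -> forall e, C e ->
    ncard (below (B e) (e d)) = i -> (ncard (A e) <= k)%N.
  apply: bound_all => [i k l kl H e Ce ei|i iK]; first exact: leq_trans (H e Ce ei) kl.
  have [k1 H1] := IH _ (ltnW dn) (cellG i).
  have [k2 H2] := thin_bdd i dn dC nC dB nB fB.
  exists (maxn k1 k2) => e Ce ei; have [Be|nBe] := pselect (B e (e d)).
    by apply: leq_trans (leq_maxr _ _); exact: H2.
  by apply: leq_trans (leq_maxl _ _); exact: H1.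
exists k => e Ce; apply: (Hk _ _ e Ce erefl); apply: leq_trans (HK e).
by apply: le_ncard => // z [].
Qed.

(** The whole space is an [n]-cell: no direction remains, and the first [n] coordinates determine
    the fiber. *)
Lemma uniformly_finite_step : exists k, forall e, (ncard (A e) <= k)%N.
Proof.
have [|k Hk] := @cell_bdd n (fun=> True) (leqnn n); last by exists k => e; exact: Hk.
split=> //; first exact: df_cst; first by rewrite subnn.
by move=> e e' _ _ /nA ->.
Qed.

End Step.

Lemma uniform_finiteness n : uniformly_finite n.
Proof. by elim/ltn_ind: n => n IH A dA nA fA; exact: uniformly_finite_step dA nA fA IH. Qed.

End UniformFiniteness.

(** * Euler integration *)

Section EulerLine.
Variable R : realType.
Implicit Types (f g : R -> int) (x y : R) (B : R -> Prop).

Definition ind (P : Prop) : int := if `[<P>] then 1 else 0.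

Lemma indT (P : Prop) : P -> ind P = 1.
Proof. by move=> ?; rewrite /ind; case: asboolP. Qed.

Lemma indF (P : Prop) : ~ P -> ind P = 0.
Proof. by move=> ?; rewrite /ind; case: asboolP. Qed.

Lemma ind_ext (P Q : Prop) : (P <-> Q) -> ind P = ind Q.
Proof. by move=> PQ; rewrite /ind (propext PQ). Qed.

Lemma ind_and (P Q : Prop) : ind (P /\ Q) = ind P * ind Q.
Proof.
have [p|np] := pselect P; last by rewrite (indF np) mul0r indF// => -[].
by rewrite (indT p) mul1r; apply: ind_ext; split=> [[]|].
Qed.

Definition right_value f x : int := xget 0 [set v | near_right x (fun y => f y = v)].
Definition ninfty_value f : int := xget 0 [set v | near_ninfty (fun y => f y = v)].

Lemma right_value_eq f x v : near_right x (fun y => f y = v) -> right_value f x = v.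
Proof.
move=> fv; have := xgetI 0 (P := [set v | near_right x (fun y => f y = v)]) fv.
rewrite -/(right_value f x) /= => fr; have [y [<- <-]] := near_right_ex (near_right_and fr fv).
by [].
Qed.

Lemma ninfty_value_eq f v : near_ninfty (fun y => f y = v) -> ninfty_value f = v.
Proof.
move=> fv; have := xgetI 0 (P := [set v | near_ninfty (fun y => f y = v)]) fv.
rewrite -/(ninfty_value f) /= => fr; have [y [<- <-]] := near_ninfty_ex (near_ninfty_and fr fv).
by [].
Qed.

Definition jump f x : int := f x - right_value f x.

Lemma jump_nb f x v : near_pt x (fun y => f y = v) -> jump f x = 0.
Proof.
by move=> fv; rewrite /jump (near_pt_self fv) (right_value_eq (near_pt_rt fv)) subrr.
Qed.

Definition step_fun f := [/\ forall x, exists v, near_right x (fun y => f y = v),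
  exists v, near_ninfty (fun y => f y = v) & finite_set [set x | jump f x != 0]].

(* The Euler integral of a step function: a point contributes the difference
   between the value there and the value immediately to its right, so that
   points integrate to [1] and open intervals, bounded or not, to [-1]. *)
Definition euler f : int := \sum_(x <- fset_set [set x | jump f x != 0]) jump f x - ninfty_value f.

Lemma euler_seq f (s : seq R) : uniq s ->
  (forall x, jump f x != 0 -> x \in s) ->
  euler f = \sum_(x <- s) jump f x - ninfty_value f.
Proof.
move=> us sf; congr (_ - _).
have fs : finite_set [set x | jump f x != 0].
  by apply: (@sub_finite_set _ _ [set` s]) => [x /sf//|]; exact: finite_seq.
rewrite [RHS](bigID (fun x => jump f x != 0)) /= [X in _ + X]big1 ?addr0; last first.
  by move=> x; rewrite negbK => /eqP.
rewrite -[RHS]big_filter; apply: perm_big; apply: uniq_perm; first exact: fset_uniq.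
  exact: filter_uniq.
move=> x; rewrite mem_filter (in_fset_set fs).
apply/idP/idP => [/set_mem /= xs|/andP[xs _]]; last exact: mem_set.
by rewrite xs sf.
Qed.

Lemma step_support f : step_fun f -> exists2 s : seq R, uniq s &
  forall x, jump f x != 0 -> x \in s.
Proof.
move=> [_ _ fs]; exists (fset_set [set x | jump f x != 0]); first exact: fset_uniq.
by move=> x xs; rewrite in_fset_set//; exact: mem_set.
Qed.

Lemma right_value_lin f g c x : step_fun f -> step_fun g ->
  right_value (fun y => c * f y + g y) x = c * right_value f x + right_value g x.
Proof.
move=> [/(_ x)[v fv] _ _] [/(_ x)[w gw] _ _].
rewrite (right_value_eq fv) (right_value_eq gw); apply: right_value_eq.
by apply: near_right_imp (near_right_and fv gw) => y [-> ->].
Qed.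

Lemma jump_lin f g c x : step_fun f -> step_fun g ->
  jump (fun y => c * f y + g y) x = c * jump f x + jump g x.
Proof. by move=> sf sg; rewrite /jump right_value_lin//; ring. Qed.

Lemma step_lin f g c : step_fun f -> step_fun g -> step_fun (fun y => c * f y + g y).
Proof.
move=> sf sg; split=> [x||].
- have [/(_ x)[v fv] _ _] := sf; have [/(_ x)[w gw] _ _] := sg.
  by exists (c * v + w); apply: near_right_imp (near_right_and fv gw) => y [-> ->].
- have [_ [v fv] _] := sf; have [_ [w gw] _] := sg.
  by exists (c * v + w); apply: near_ninfty_imp (near_ninfty_and fv gw) => y [-> ->].
- have [_ _ ff] := sf; have [_ _ fg] := sg.
  apply: (@sub_finite_set _ _ ([set x | jump f x != 0] `|` [set x | jump g x != 0])).
    move=> x /=; rewrite jump_lin//; have [->|?] := eqVneq (jump f x) 0; last by left.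
    by rewrite mulr0 add0r; right.
  by rewrite finite_setU.
Qed.

Lemma euler_lin f g c : step_fun f -> step_fun g ->
  euler (fun y => c * f y + g y) = c * euler f + euler g.
Proof.
move=> sf sg; have [s us sS] := step_support sf; have [t ut tS] := step_support sg.
have uu := undup_uniq (s ++ t).
rewrite (euler_seq uu (f := f)); last first.
  by move=> x /sS xs; rewrite mem_undup mem_cat xs.
rewrite (euler_seq uu (f := g)); last first.
  by move=> x /tS xs; rewrite mem_undup mem_cat xs orbT.
rewrite (euler_seq uu); last first.
  move=> x; rewrite jump_lin// mem_undup mem_cat.
  have [->|/sS ->//] := eqVneq (jump f x) 0.
  by rewrite mulr0 add0r => /tS ->; rewrite orbT.
have -> : ninfty_value (fun y => c * f y + g y) = c * ninfty_value f + ninfty_value g.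
  have [_ [v fv] _] := sf; have [_ [w gw] _] := sg.
  rewrite (ninfty_value_eq fv) (ninfty_value_eq gw); apply: ninfty_value_eq.
  by apply: near_ninfty_imp (near_ninfty_and fv gw) => y [-> ->].
rewrite (eq_bigr (fun x => c * jump f x + jump g x)) => [|x _]; last exact: jump_lin.
by rewrite big_split /= -mulr_sumr; ring.
Qed.

Lemma step_eq f v : (forall x, f x = v) -> step_fun f.
Proof.
move=> fv; split=> [x||]; first by exists v, (x + 1) => //; lra.
  by exists v, 0.
rewrite (_ : [set x | _] = set0)//; apply/seteqP; split=> // x /=.
by rewrite (jump_nb (v := v)) ?eqxx//; exists (x - 1), (x + 1); split=> //; lra.
Qed.

Lemma euler0 : euler (fun=> 0) = 0.
Proof.
rewrite (euler_seq (s := [::]))// => [|x].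
  by rewrite big_nil (ninfty_value_eq (v := 0)) ?subrr//; exists 0.
by rewrite (jump_nb (v := 0)) ?eqxx//; exists (x - 1), (x + 1); split=> //; lra.
Qed.

Lemma euler_scale f c : step_fun f -> euler (fun y => c * f y) = c * euler f.
Proof.
move=> sf; have s0 : step_fun (fun=> 0) by exact: step_eq.
rewrite (_ : (fun y => c * f y) = fun y => c * f y + 0).
  by rewrite euler_lin// euler0 addr0.
by apply/funext => y; rewrite addr0.
Qed.

Lemma step_sum (I : Type) (r : seq I) (c : I -> int) (F : I -> R -> int) :
  (forall i, step_fun (F i)) -> step_fun (fun y => \sum_(i <- r) c i * F i y).
Proof.
move=> sF; elim: r => [|i r IH]; first by apply: (step_eq (v := 0)) => y; rewrite big_nil.
rewrite (_ : (fun y => _) = fun y => c i * F i y + \sum_(j <- r) c j * F j y).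
  exact: step_lin.
by apply/funext => y; rewrite big_cons.
Qed.

Lemma euler_sum (I : Type) (r : seq I) (c : I -> int) (F : I -> R -> int) :
  (forall i, step_fun (F i)) ->
  euler (fun y => \sum_(i <- r) c i * F i y) = \sum_(i <- r) c i * euler (F i).
Proof.
move=> sF; elim: r => [|i r IH].
  by rewrite big_nil -[RHS]euler0; congr euler; apply/funext => y; rewrite big_nil.
rewrite (_ : (fun y => _) = fun y => c i * F i y + \sum_(j <- r) c j * F j y).
  by rewrite euler_lin ?IH ?big_cons//; exact: step_sum.
by apply/funext => y; rewrite big_cons.
Qed.

Definition open_convex B := (forall x, B x -> near_pt x B) /\
  forall x y z, B x -> B z -> x <= y -> y <= z -> B y.

(** An open convex set omits its supremum, so only at a finite infimum can the value differ from the
    one immediately to the right. *)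
Lemma open_convex_right B x : open_convex B ->
  (forall a, (forall y, B y -> a <= y) -> (forall b, a < b -> exists2 y, B y & y < b) ->
    x <> a) ->
  (near_right x (fun y => ind (B y) = ind (B x))).
Proof.
move=> [oB cB] xa; have [Bx|nBx] := pselect (B x).
  by apply: near_right_imp (near_pt_rt (oB x Bx)) => y By; rewrite !indT.
rewrite (indF nBx); have [[z Bz zx]|nz] := pselect (exists2 z, B z & z < x).
  exists (x + 1) => [|y xy _]; first lra.
  by rewrite indF// => By; apply: nBx; apply: cB Bz By _ _; exact: ltW.
have lx y : B y -> x <= y by move=> By; rewrite leNgt; apply/negP => yx; apply: nz; exists y.
have [[b xb H]|nb_] := pselect (exists2 b, x < b & forall y, y < b -> ~ B y).
  by exists b => // y _ yb; rewrite indF//; exact: H.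
exfalso; apply: (xa x) => // b xb; apply: contrapT => nB; apply: nb_.
by exists b => // y yb By; apply: nB; exists y.
Qed.

(** If [B] is bounded below, the only jump is [0 - 1] at the infimum; otherwise there is no jump and
    the value [1] at minus infinity is subtracted. *)
Lemma euler_open_convex B : open_convex B -> (exists x, B x) ->
  step_fun (fun y => ind (B y)) /\ euler (fun y => ind (B y)) = -1.
Proof.
move=> ocB [x0 Bx0]; have [oB cB] := ocB.
have [[m mB]|nlb] := pselect (exists m, forall y, B y -> m <= y); last first.
  have below_ x : exists2 z, B z & z < x.
    apply: contrapT => nz; apply: nlb; exists x => y By.
    by rewrite leNgt; apply/negP => yx; apply: nz; exists y.
  have nB : near_ninfty (fun y => B y).
    exists x0 => y yx; have [z Bz zy] := below_ y.
    by apply: cB Bz Bx0 _ _; exact: ltW.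
  have right x : near_right x (fun y => ind (B y) = ind (B x)).
    apply: open_convex_right => // a Ba _ xa; have [z Bz za] := below_ a.
    by have := lt_le_trans za (Ba z Bz); rewrite ltxx.
  have j0 x : jump (fun y => ind (B y)) x = 0 by rewrite /jump (right_value_eq (right x)) subrr.
  split.
    split=> [x||]; first by exists (ind (B x)).
      by exists 1; apply: near_ninfty_imp nB => y; exact: indT.
    by rewrite (_ : [set x | _] = set0)//; apply/seteqP; split=> // x /=; rewrite j0 eqxx.
  rewrite (euler_seq (s := [::]))// => [|x]; last by rewrite j0 eqxx.
  by rewrite big_nil (ninfty_value_eq (v := 1))//; apply: near_ninfty_imp nB => y; exact: indT.
pose a := inf [set y | B y].
have hi : has_inf [set y | B y] by split; [exists x0|exists m].
have aB y : B y -> a <= y by move=> By; apply: ge_inf => //; exists m.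
have Ba b : a < b -> exists2 y, B y & y < b.
  move=> ab; have [y By] := inf_adherent (eps := b - a) ltac:(lra) hi.
  by rewrite -/a => ?; exists y => //; lra.
have nBa : ~ B a.
  move=> /oB [u [v [ua av H]]]; have := aB ((u + a) / 2) (H _ _ _).
  by move=> /(_ ltac:(lra) ltac:(lra)); lra.
have right x : x <> a -> near_right x (fun y => ind (B y) = ind (B x)).
  move=> xa; apply: open_convex_right => // a' a'B Ba' xa'; apply: xa.
  rewrite xa'; apply/eqP; rewrite eq_le !leNgt; apply/andP; split; apply/negP => lt.
    by have [y /a'B h /(le_lt_trans h)] := Ba _ lt; rewrite ltxx.
  by have [y /aB h /(le_lt_trans h)] := Ba' _ lt; rewrite ltxx.
have righta : near_right a (fun y => ind (B y) = 1).
  have ax0 : a < x0 by rewrite lt_neqAle aB// andbT; apply/eqP => E; rewrite -E in Bx0.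
  exists x0 => // y ay yx; apply: indT; have [z Bz zy] := Ba y ay.
  by apply: cB Bz Bx0 _ _; exact: ltW.
have nB : near_ninfty (fun y => ind (B y) = 0).
  exists a => y ya; apply: indF => By; have := le_lt_trans (aB y By) ya.
  by rewrite ltxx.
have j0 x : x <> a -> jump (fun y => ind (B y)) x = 0.
  by move=> xa; rewrite /jump (right_value_eq (right x xa)) subrr.
have supp x : jump (fun y => ind (B y)) x != 0 -> x \in [:: a].
  by move=> jx; rewrite mem_seq1; apply: contraNT jx => /eqP /j0 ->.
split.
  split=> [x||]; last by apply: (@sub_finite_set _ _ [set a]) => // x /supp; rewrite mem_seq1 => /eqP.
    by have [->|/eqP/right] := eqVneq x a; [exists 1|exists (ind (B x))].
  by exists 0.
by rewrite (euler_seq (s := [:: a]))// big_seq1 (ninfty_value_eq nB) subr0 /jump (right_value_eq righta) indF.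
Qed.

Lemma euler_point (c : R) :
  step_fun (fun y => ind (y = c)) /\ euler (fun y => ind (y = c)) = 1.
Proof.
have right x : near_right x (fun y => ind (y = c) = 0).
  have [cx|xc] := leP c x.
    by exists (x + 1) => [|y xy _]; [lra|apply: indF => yc; lra].
  by exists c => // y _ yc; apply: indF => E; rewrite E ltxx in yc.
have nc : near_ninfty (fun y => ind (y = c) = 0).
  by exists c => y yc; apply: indF => E; rewrite E ltxx in yc.
have j x : jump (fun y => ind (y = c)) x = ind (x = c) by rewrite /jump (right_value_eq (right x)) subr0.
have supp x : jump (fun y => ind (y = c)) x != 0 -> x \in [:: c].
  by rewrite j mem_seq1 => jx; apply: contraNT jx => /eqP E; rewrite indF.
split.
  split=> [x||]; [by exists 0|by exists 0|].
  by apply: (@sub_finite_set _ _ [set c]) => // x /supp; rewrite mem_seq1 => /eqP.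
by rewrite (euler_seq (s := [:: c]))// big_seq1 (ninfty_value_eq nc) subr0 j indT.
Qed.

End EulerLine.

(** * Constructible functions and their integrals *)

Section Constructible.
Variables (R : realType) (S : ominimal_structure R).
Local Notation df := (df S).
Local Notation o1 := (o1 S).
Implicit Types (e : nat -> R) (P : (nat -> R) -> Prop) (f g : (nat -> R) -> int).

(** A finite range is part of the notion because step functions are assembled from finitely many
    level sets; its survival under integration rests on uniform finiteness. *)
Definition constr f := (exists s : seq int, forall e, f e \in s) /\
  forall k, df (fun e => f e = k).

Lemma constr_ind P : df P -> constr (fun e => ind (P e)).
Proof.
move=> dP; split=> [|k].
  by exists [:: 0; 1] => e; rewrite /ind !inE; case: asboolP.
have [->|k0] := eqVneq k 0.
  apply: df_ext (df_not dP) => e; split=> [/indF//|]; rewrite /ind.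
  by case: asboolP.
have [->|k1] := eqVneq k 1.
  by apply: df_ext dP => e; split=> [/indT//|]; rewrite /ind; case: asboolP.
apply: df_ext (df_cst S False) => e; split=> // E; move: k0 k1; rewrite -E /ind.
by case: asboolP.
Qed.

Lemma constr_op (op : int -> int -> int) f g : constr f -> constr g ->
  constr (fun e => op (f e) (g e)).
Proof.
move=> [[s fs] df_] [[t gt_] dg]; split.
  by exists [seq op a b | a <- s, b <- t] => e; apply: allpairs_f.
move=> k; have dE : df (fun e => exists2 i, (i < size s)%N & f e = nth 0 s i /\
    exists2 j, (j < size t)%N & g e = nth 0 t j /\ op (nth 0 s i) (nth 0 t j) = k).
  apply: df_exn => i _; apply: df_and => //; apply: df_exn => j _.
  by apply: df_and => //; exact: df_cst.
apply: df_ext dE => e; split=> [[i _ [-> [j _ [-> ]]]]//|E].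
exists (index (f e) s); rewrite ?index_mem// nth_index//; split=> //.
by exists (index (g e) t); rewrite ?index_mem// nth_index.
Qed.

Lemma constr_cst (c : int) : constr (fun=> c).
Proof.
by split=> [|k]; [exists [:: c] => _; rewrite mem_seq1|exact: df_cst].
Qed.

Lemma constr_scale c f : constr f -> constr (fun e => c * f e).
Proof. exact: (constr_op (fun x y => x * y) (constr_cst c)). Qed.

Lemma constr_sum (I : Type) (r : seq I) (F : I -> (nat -> R) -> int) :
  (forall i, constr (F i)) -> constr (fun e => \sum_(i <- r) F i e).
Proof.
move=> cF; elim: r => [|i r IH].
  rewrite (_ : (fun e => _) = fun=> 0); first exact: constr_cst.
  by apply/funext => e; rewrite big_nil.
rewrite (_ : (fun e => _) = fun e => F i e + \sum_(j <- r) F j e).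
  exact: (constr_op (fun x y => x + y) (cF i) IH).
by apply/funext => e; rewrite big_cons.
Qed.

Lemma constr_comp f t : ren_cst t -> constr f -> constr (fun e => f (t e)).
Proof.
move=> near_right [[s fs] df_]; split; first by exists s.
by move=> k; exact: (df_comp near_right (df_ k)).
Qed.

Lemma ind_decomp (T : Type) (s : seq int) (f : T -> int) : (forall x, f x \in s) ->
  forall x, f x = \sum_(k <- undup s) k * ind (f x = k).
Proof.
move=> fs x; rewrite (bigD1_seq (f x)) ?undup_uniq ?mem_undup//= indT// mulr1.
rewrite big1 ?addr0// => k kf; rewrite indF ?mulr0// => E.
by rewrite E eqxx in kf.
Qed.

(** A germ decides each level set, so discarding one by one the values not taken near the point
    leaves a single value. *)
Lemma step_o1 (s : seq int) (g : R -> int) : (forall y, g y \in s) ->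
  (forall k, o1 (fun y => g y = k)) -> step_fun g.
Proof.
move=> gs og; split=> [x||].
- have : near_right x (fun y => g y \in s) by exists (x + 1) => //; lra.
  elim: (s) => [/near_right_ex[]//|k t IH] gt_; have [?|nk] := o1_right x (og k); first by exists k.
  apply: IH; apply: near_right_imp (near_right_and gt_ nk) => y [].
  by rewrite in_cons => /predU1P[].
- have : near_ninfty (fun y => g y \in s) by exists 0.
  elim: (s) => [/near_ninfty_ex[]//|k t IH] gt_; have [?|nk] := o1_near_ninfty (og k); first by exists k.
  apply: IH; apply: near_ninfty_imp (near_ninfty_and gt_ nk) => y [].
  by rewrite in_cons => /predU1P[].
- apply: (@sub_finite_set _ _ (\bigcup_(k in [set` s]) [set y |
      ~ (near_pt y (fun z => g z = k) \/ near_pt y (fun z => ~ (g z = k)))])).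
    move=> x /= jx; exists (g x) => //= -[gx|/near_pt_self//].
    by rewrite (jump_nb gx) eqxx in jx.
  by apply: bigcup_finite => [|k _]; [exact: finite_seq|exact: (o1_boundary (og k))].
Qed.

Lemma step_constr f e i : constr f -> step_fun (fun y => f (upd e i y)).
Proof.
move=> [[s fs] df_]; apply: (@step_o1 s) => // k.
exact: (many_o1 i e (df_ k)).
Qed.

Definition euler_at i f e : int := euler (fun y => f (upd e i y)).

Lemma ncard_sum (A : R -> Prop) (s : seq R) : uniq s -> (forall x, A x -> x \in s) ->
  \sum_(x <- s) ind (A x) = (ncard [set x | A x])%:Z.
Proof.
move=> us As; have fA : finite_set [set x | A x].
  by apply: (@sub_finite_set _ _ [set` s]) => [x /As//|]; exact: finite_seq.
have -> : ncard [set x | A x] = size [seq x <- s | `[< A x >]].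
  apply: perm_size; apply: uniq_perm; [exact: fset_uniq|exact: filter_uniq|] => x.
  rewrite (in_fset_set fA) mem_filter; apply/idP/andP => [/set_mem /= Ax|[/asboolP Ax _]].
    by split; [exact/asboolP|exact: As].
  exact: mem_set.
rewrite size_filter -sum1_count.
rewrite (big_morph Posz (id1 := 0) (op1 := +%R)) //.
by rewrite [RHS]big_mkcond /=; apply: eq_bigr => x _.
Qed.

(** Uniform finiteness enters the integration theory here: it bounds the possible counts. *)
Lemma constr_ncard (A : (nat -> R) -> set R) : dfs S A ->
  (forall e, finite_set (A e)) -> constr (fun e => (ncard (A e))%:Z).
Proof.
move=> dA fA; have [n nA] := dA.
have nnA : fdep n A.
  move=> e e' ee; apply/funext => y.
  pose c (e : nat -> R) k := if k is k'.+1 then e k' else y.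
  have ag : forall k, (k < n)%N -> c e k = c e' k.
    by case=> // k kn; apply: ee; exact: ltnW.
  apply/propext; split; first exact: (dfn_dep nA ag).
  by apply: (dfn_dep nA (e := c e') (e' := c e)) => k /ag ->.
have [k Hk] := @uniform_finiteness _ S n A dA nnA fA.
split=> [|j].
  by exists [seq Posz i | i <- iota 0 k.+1] => e; apply: map_f; rewrite mem_iota add0n ltnS; exact: Hk.
case: j => j; last by apply: df_ext (df_cst S False) => e; split.
apply: df_ext (df_ncard_eq j fA dA) => e; split=> [->//|[]//].
Qed.

(** Upward jumps, downward jumps and the germ at minus infinity are separated, so that the integral
    consists of two cardinalities and a truth value, each constructible when [B] varies in a
    family. *)
Lemma euler_ind (B : R -> Prop) : o1 B -> euler (fun y => ind (B y)) =
  (ncard [set x | B x /\ near_right x (fun y => ~ B y)])%:Z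
  - (ncard [set x | ~ B x /\ near_right x B])%:Z - ind (near_ninfty B).
Proof.
move=> oB; have sB : step_fun (fun y => ind (B y)).
  apply: (@step_o1 [:: 0; 1]) => [y|k]; first by rewrite /ind !inE; case: asboolP.
  exact: ((constr_ind oB).2 k).
have [s us sS] := step_support sB.
have jE x : jump (fun y => ind (B y)) x =
    ind (B x /\ near_right x (fun y => ~ B y)) + -1 * ind (~ B x /\ near_right x B).
  have contra : near_right x B -> near_right x (fun y => ~ B y) -> False.
    by move=> h h'; have [y []] := near_right_ex (near_right_and h h').
  rewrite !ind_and /jump; have [rB|rB] := o1_right x oB.
    rewrite (right_value_eq (v := 1)); last by apply: near_right_imp rB => y; exact: indT.
    rewrite (indT rB) (indF (P := near_right x _)) => [|h]; last exact: contra h.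
    by rewrite mulr0 add0r mulr1; have [h|h] := pselect (B x);
      [rewrite (indT h) indF|rewrite (indF h) indT].
  rewrite (right_value_eq (v := 0)); last by apply: near_right_imp rB => y; exact: indF.
  rewrite (indT rB) [ind (near_right x B)]indF => [|h]; last exact: contra h rB.
  by rewrite !mulr0 addr0 mulr1 subr0.
rewrite (euler_seq us sS); congr (_ - _).
  rewrite (eq_bigr _ (fun x _ => jE x)) big_split /= -mulr_sumr mulN1r.
  rewrite !ncard_sum// => x Hx; apply: sS; rewrite jE.
    by rewrite [ind (~ B x /\ _)]indT// [ind (_ /\ _)]indF// => -[?]; case: Hx.
  by rewrite indT// indF// => -[]; case: Hx.
have [h|h] := o1_near_ninfty oB.
  by rewrite indT//; apply: ninfty_value_eq; apply: near_ninfty_imp h => y; exact: indT.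
rewrite indF => [|h']; last by have [y []] := near_ninfty_ex (near_ninfty_and h h').
by apply: ninfty_value_eq; apply: near_ninfty_imp h => y; exact: indF.
Qed.

(** By linearity over the finitely many level sets it suffices to treat an indicator, for which
    [euler_ind] applies; the counted points are boundary points of the fiber, hence finite in
    number. *)
Lemma constr_euler_at i f : constr f -> constr (euler_at i f).
Proof.
move=> cf; have [[s fs] df_] := cf.
have -> : euler_at i f = fun e => \sum_(k <- undup s) k * euler_at i (fun e => ind (f e = k)) e.
  apply/funext => e; rewrite /euler_at -euler_sum => [|k]; last first.
    exact/(step_constr (f := fun e => ind (f e = k)))/constr_ind.
  by congr euler; apply/funext => y; exact: ind_decomp.
apply: constr_sum => k; apply: constr_scale; set P := fun e => f e = k.
have dP : df P := df_ k.
have dPu : df (fun e => P (upd (fun k => e k.+1) i (e 0))).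
  by apply: (df_comp (P := P)) dP; apply: ren_upd; exact: ren_ren.
have dPuu : df (fun e => P (upd (fun k => e k.+2) i (e 0))).
  by apply: (df_comp (P := P)) dP; apply: ren_upd; exact: ren_ren.
have oP e : o1 (fun y => P (upd e i y)) by exact: many_o1.
have fin (Q : (nat -> R) -> R -> Prop) : (forall e x, Q e x ->
    ~ (near_pt x (fun y => P (upd e i y)) \/ near_pt x (fun y => ~ P (upd e i y)))) ->
    forall e, finite_set [set x | Q e x].
  move=> H e; apply: sub_finite_set (o1_boundary (oP e)) => x; exact: H.
have -> : euler_at i (fun e => ind (P e)) = fun e =>
    (ncard [set x | P (upd e i x) /\ near_right x (fun y => ~ P (upd e i y))])%:Z
    - (ncard [set x | ~ P (upd e i x) /\ near_right x (fun y => P (upd e i y))])%:Z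
    - ind (near_ninfty (fun y => P (upd e i y))).
  by apply/funext => e; exact: (euler_ind (oP e)).
have no (Q : R -> Prop) x : near_right x Q -> near_right x (fun y => ~ Q y) -> False.
  by move=> h h'; have [y []] := near_right_ex (near_right_and h h').
apply: (constr_op (fun x y => x - y)); first apply: (constr_op (fun x y => x - y)).
- apply: constr_ncard.
    by apply: df_and => //; apply: df_near_right; exact: df_not.
  apply: fin => e x [Px rP] [/near_pt_rt|/near_pt_self//] h; exact: no rP.
- apply: constr_ncard.
    by apply: df_and; [exact: df_not|exact: df_near_right].
  apply: fin => e x [Px rP] [/near_pt_self//|/near_pt_rt]; exact: no.
- by apply: constr_ind; exact: df_near_ninfty.
Qed.

End Constructible.

(** * Exchange of two integrations *)

Section Fubini.
Variables (R : realType) (S : ominimal_structure R).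
Local Notation df := (df S).
Local Notation o1 := (o1 S).
Local Notation o2 := (o2 S).
Local Notation constr := (constr S).
Implicit Types (e : nat -> R) (f : R -> R) (g h : R -> R -> int) (X B : R -> Prop).

Definition constr1 (u : R -> int) := constr (fun e => u (e 0)).
Definition constr2 g := constr (fun e => g (e 0) (e 1%N)).

Definition euler_xy g := euler (fun x => euler (fun y => g x y)).
Definition euler_yx g := euler (fun y => euler (fun x => g x y)).
Definition fubini g := euler_xy g = euler_yx g.

Lemma constr2_at g t i j : constr2 g -> ren_cst t ->
  constr (fun e => g (t e i) (t e j)).
Proof.
move=> cg [s [c tE]]; apply: (constr_comp (f := fun e => g (e 0) (e 1%N))
  (t := fun e k => t e (if k is 0 then i else j))) cg.
by exists (fun k => s (if k is 0 then i else j)), (fun k => c (if k is 0 then i else j)) => e k; exact: tE.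
Qed.

Lemma constr2_ind (P : R -> R -> Prop) : o2 P -> constr2 (fun x y => ind (P x y)).
Proof. exact: constr_ind. Qed.

Lemma constr1_step u : constr1 u -> step_fun u.
Proof. by move=> /(step_constr (fun=> 0) 0); congr step_fun; apply/funext. Qed.

Section Planar.
Variable g : R -> R -> int.
Hypothesis cg : constr2 g.

Lemma step_l x : step_fun (g x).
Proof. exact: (step_constr (fun=> x) 1 cg). Qed.

Lemma step_r y : step_fun (g ^~ y).
Proof. exact: (step_constr (fun=> y) 0 cg). Qed.

Lemma step_euler_l : step_fun (fun x => euler (g x)).
Proof. exact: (step_constr (fun=> 0) 0 (constr_euler_at 1 cg)). Qed.

Lemma step_euler_r : step_fun (fun y => euler (g ^~ y)).
Proof. exact: (step_constr (fun=> 0) 1 (constr_euler_at 0 cg)). Qed.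

End Planar.

Lemma constr2_lin c g h : constr2 g -> constr2 h ->
  constr2 (fun x y => c * g x y + h x y).
Proof.
move=> cg ch; apply: (constr_op (fun a b => a + b)) ch.
exact: constr_scale.
Qed.

Lemma fubini_lin c g h : constr2 g -> constr2 h -> fubini g -> fubini h ->
  fubini (fun x y => c * g x y + h x y).
Proof.
move=> cg ch fg fh; rewrite /fubini /euler_xy /euler_yx.
rewrite (_ : (fun x => euler _) = fun x => c * euler (g x) + euler (h x)); last first.
  by apply/funext => x; rewrite euler_lin//; exact: step_l.
rewrite (_ : (fun y => euler _) = fun y => c * euler (g ^~ y) + euler (h ^~ y)); last first.
  by apply/funext => y; rewrite (@euler_lin _ (g ^~ y) (h ^~ y))//; exact: step_r.
rewrite !euler_lin; try exact: step_euler_l; try exact: step_euler_r.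
by move: fg fh; rewrite /fubini /euler_xy /euler_yx => -> ->.
Qed.

Lemma constr2_sum (I : Type) (r : seq I) (c : I -> int) (F : I -> R -> R -> int) :
  (forall i, constr2 (F i)) -> constr2 (fun x y => \sum_(i <- r) c i * F i x y).
Proof. by move=> cF; apply: constr_sum => i; apply: constr_scale; exact: cF. Qed.

Lemma fubini0 : fubini (fun _ _ => 0).
Proof. by rewrite /fubini /euler_xy /euler_yx euler0. Qed.

Lemma fubini_sum (I : Type) (r : seq I) (c : I -> int) (F : I -> R -> R -> int) :
  (forall i, constr2 (F i)) -> (forall i, fubini (F i)) ->
  fubini (fun x y => \sum_(i <- r) c i * F i x y).
Proof.
move=> cF fF; elim: r => [|i r IH].
  rewrite (_ : (fun x y => _) = fun _ _ => 0); first exact: fubini0.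
  by apply/funext => x; apply/funext => y; rewrite big_nil.
rewrite (_ : (fun x y => _) = fun x y => c i * F i x y + \sum_(j <- r) c j * F j x y).
  by apply: fubini_lin => //; exact: constr2_sum.
by apply/funext => x; apply/funext => y; rewrite big_cons.
Qed.

Lemma fubini_prod (u v : R -> int) : step_fun u -> step_fun v -> fubini (fun x y => u x * v y).
Proof.
move=> su sv; rewrite /fubini /euler_xy /euler_yx.
rewrite (_ : (fun x => euler _) = fun x => euler v * u x); last first.
  by apply/funext => x; rewrite euler_scale// mulrC.
rewrite (_ : (fun y => euler _) = fun y => euler u * v y); last first.
  apply/funext => y; rewrite [RHS]mulrC -euler_scale//.
  by congr euler; apply/funext => x; rewrite mulrC.
by rewrite !euler_scale// mulrC.
Qed.

Lemma open_convex_lt (c : R) : open_convex (fun y => y < c).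
Proof. by split=> [x xc|x y z _ zc _ yz]; [exact: near_pt_lt|exact: le_lt_trans zc]. Qed.

Lemma sum_ind0 (T : eqType) (s : seq T) (P : T -> Prop) :
  (forall t, t \in s -> ~ P t) -> \sum_(t <- s) ind (P t) = 0.
Proof. by move=> H; rewrite big_seq big1// => t /H; exact: indF. Qed.

Lemma sum_ind1 (T : eqType) (s : seq T) (P : T -> Prop) t : uniq s -> t \in s ->
  (forall u, P u <-> u = t) -> \sum_(t <- s) ind (P t) = 1.
Proof.
move=> us ts H; rewrite (bigD1_seq t)//= indT; last exact/H.
by rewrite big1 ?addr0// => u /eqP ut; apply: indF => /H.
Qed.

Section MonotoneArc.
Variables (f : R -> R) (X : R -> Prop) (c : option bool) (x0 : R).
Hypotheses (ocX : open_convex X) (Xx0 : X x0).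
Hypothesis monof : forall x y, X x -> X y -> x < y -> order_rel c (f x) (f y).
Hypothesis contf : forall x, X x -> cont_at f x.

(** The intermediate value theorem: by continuity, the side of a value that is never attained is
    locally constant, hence constant on the segment. *)
Lemma arc_ivt (y a b : R) : X a -> X b -> a < b ->
  (forall z, X z -> f z <> y) -> (f a < y) = (f b < y).
Proof.
move=> Xa Xb ab ny; apply: (@segment_chain _ (fun a b => (f a < y) = (f b < y))) ab _.
  by move=> x' y' z' -> ->.
move=> z az zb; have Xz : X z by exact: ocX.2 Xa Xb az zb.
have [fy|yf|/ny//] := ltgtP (f z) y.
  have [||u [v [uz zv H]]] := contf Xz (u := f z - 1) (v := y) => //; first lra.
  exists u, v; split=> // x1 x2 ux xx xv _ _.
  by have [_ ->] := H x1 ux (lt_trans xx xv); have [_ ->] := H x2 (lt_trans ux xx) xv.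
have [||u [v [uz zv H]]] := contf Xz (u := y) (v := f z + 1) => //; first lra.
exists u, v; split=> // x1 x2 ux xx xv _ _.
have [/ltW h1 _] := H x1 ux (lt_trans xx xv); have [/ltW h2 _] := H x2 (lt_trans ux xx) xv.
by rewrite !ltNge h1 h2.
Qed.

Lemma arc_image_convex y1 y y2 : (exists x, X x /\ y1 = f x) ->
  (exists x, X x /\ y2 = f x) -> y1 <= y -> y <= y2 -> exists x, X x /\ y = f x.
Proof.
move=> [x1 [X1 ->]] [x2 [X2 ->]]; rewrite le_eqVlt => /predU1P[<- _|y1y]; first by exists x1.
rewrite le_eqVlt => /predU1P[->|yy2]; first by exists x2.
apply: contrapT => ny; have {}ny z : X z -> f z <> y by move=> Xz E; apply: ny; exists z.
have [x12|x21|E] := ltgtP x1 x2.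
- by have := arc_ivt X1 X2 x12 ny; rewrite y1y ltNge (ltW yy2).
- by have := arc_ivt X2 X1 x21 ny; rewrite y1y ltNge (ltW yy2).
- by move: y1y yy2; rewrite E => h /(lt_trans h); rewrite ltxx.
Qed.

Lemma fubini_arc_cst : c = None ->
  fubini (fun x y => ind (X x /\ y = f x)) /\ fubini (fun x y => ind (X x /\ y < f x)).
Proof.
move=> cN; have fE x : X x -> f x = f x0.
  move=> Xx; have [xx|xx|->//] := ltgtP x x0.
    by have := monof Xx Xx0 xx; rewrite cN.
  by have := monof Xx0 Xx xx; rewrite cN.
have [sX _] := euler_open_convex ocX (ex_intro _ x0 Xx0).
split.
  rewrite (_ : (fun x y => _) = fun x y => ind (X x) * ind (y = f x0)).
    by apply: fubini_prod => //; exact: (euler_point (f x0)).1.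
  apply/funext => x; apply/funext => y; rewrite -ind_and; apply: ind_ext.
  by split=> -[Xx ->]; rewrite fE.
rewrite (_ : (fun x y => _) = fun x y => ind (X x) * ind (y < f x0)).
  apply: fubini_prod => //; apply: (euler_open_convex (open_convex_lt _) _).1.
  by exists (f x0 - 1); lra.
apply/funext => x; apply/funext => y; rewrite -ind_and; apply: ind_ext.
by split=> -[Xx]; rewrite fE.
Qed.

Lemma arc_inj s x y : c = Some s -> X x -> X y -> f x = f y -> x = y.
Proof.
move=> cS Xx Xy E; have [xy|yx|//] := ltgtP x y.
  by have := monof Xx Xy xy; rewrite cS E /= ltxx; case: (s).
by have := monof Xy Xx yx; rewrite cS E /= ltxx; case: (s).
Qed.

Lemma arc_image_open s : c = Some s -> open_convex (fun y => exists x, X x /\ y = f x).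
Proof.
move=> cS; split; last by move=> y1 y y2; exact: arc_image_convex.
move=> y [x [Xx ->]]; have [a [b [ax xb H]]] := ocX.1 x Xx.
have Xa : X ((a + x) / 2) by apply: H; lra.
have Xb : X ((x + b) / 2) by apply: H; lra.
have := monof Xa Xx ltac:(lra); have := monof Xx Xb ltac:(lra); rewrite cS.
case: (s) => /= h1 h2.
  exists (f ((a + x) / 2)), (f ((x + b) / 2)); split=> // y' /ltW h3 /ltW h4.
  by apply: arc_image_convex h3 h4; [exists ((a + x) / 2)|exists ((x + b) / 2)].
exists (f ((x + b) / 2)), (f ((a + x) / 2)); split=> // y' /ltW h3 /ltW h4.
by apply: arc_image_convex h3 h4; [exists ((x + b) / 2)|exists ((a + x) / 2)].
Qed.

(** Nonempty sections in either direction are single points, so the two iterated integrals are those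
    of the open convex sets [X] and [f(X)], both [-1]. *)
Lemma fubini_arc_graph s : c = Some s -> fubini (fun x y => ind (X x /\ y = f x)).
Proof.
move=> cS; rewrite /fubini /euler_xy /euler_yx.
rewrite (_ : (fun x => euler _) = fun x => ind (X x)); last first.
  apply/funext => x; have [sp ep] := euler_point (f x).
  rewrite (_ : (fun y => _) = fun y => ind (X x) * ind (y = f x)).
    by rewrite euler_scale// ep mulr1.
  by apply/funext => y; rewrite ind_and.
rewrite (_ : (fun y => euler _) = fun y => ind (exists x, X x /\ y = f x)); last first.
  apply/funext => y; have [[x [Xx yE]]|ny] := pselect (exists x, X x /\ y = f x).
    rewrite indT; last by exists x.
    have [_ <-] := euler_point x; congr euler; apply/funext => x'; apply: ind_ext.
    split=> [[Xx' yE']|->//].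
    by apply: (arc_inj cS Xx' Xx); rewrite -yE.
  rewrite indF// -[RHS](@euler0 R); congr euler; apply/funext => x; apply: indF => Xx.
  by apply: ny; exists x.
have [_ ->] := euler_open_convex ocX (ex_intro _ x0 Xx0).
by have [_ ->//] := euler_open_convex (arc_image_open cS)
  (ex_intro _ (f x0) (ex_intro _ x0 (conj Xx0 erefl))).
Qed.

(** Vertical sections are rays and horizontal ones are open convex subsets of [X]; both orders thus
    give [-1] times the integral [-1] of an open convex set. *)
Lemma fubini_arc_under s : c = Some s -> fubini (fun x y => ind (X x /\ y < f x)).
Proof.
move=> cS; rewrite /fubini /euler_xy /euler_yx.
have [sX eX] := euler_open_convex ocX (ex_intro _ x0 Xx0).
rewrite (_ : (fun x => euler _) = fun x => -1 * ind (X x)); last first.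
  apply/funext => x; have [|sp ep] := euler_open_convex (open_convex_lt (f x)).
    by exists (f x - 1); lra.
  rewrite (_ : (fun y => _) = fun y => ind (X x) * ind (y < f x)).
    by rewrite euler_scale// ep mulrC.
  by apply/funext => y; rewrite ind_and.
have [||sY eY] := @euler_open_convex _ (fun y => exists x, X x /\ y < f x).
- split=> [y [x [Xx yf]]|y1 y y2 _ [x [Xx yf]] _ yy].
    by apply: near_pt_imp (near_pt_lt yf) => y' ?; exists x.
  by exists x; split=> //; exact: le_lt_trans yf.
- by exists (f x0 - 1), x0; split=> //; lra.
rewrite (_ : (fun y => euler _) = fun y => -1 * ind (exists x, X x /\ y < f x)); last first.
  apply/funext => y; have [[x [Xx yf]]|ny] := pselect (exists x, X x /\ y < f x).
    rewrite indT ?mulr1; last by exists x.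
    apply: (euler_open_convex _ _).2; last by exists x.
    split=> [x' [Xx' yf']|x1 x' x2 [X1 y1] [X2 y2] xx xx'].
      have := near_pt_and (ocX.1 x' Xx') (contf Xx' (u := y) (v := f x' + 1) yf' ltac:(lra)).
      by apply: near_pt_imp => z [Xz []].
    have Xx' := ocX.2 _ _ _ X1 X2 xx xx'; split=> //.
    move: xx xx'; rewrite le_eqVlt => /predU1P[<-//|lt1].
    rewrite le_eqVlt => /predU1P[->//|lt2].
    have := monof X1 Xx' lt1; have := monof Xx' X2 lt2; rewrite cS.
    by case: (s) => /= h1 h2; [exact: lt_trans h2|exact: lt_trans h1].
  rewrite indF// mulr0 -[RHS](@euler0 R); congr euler; apply/funext => x; apply: indF => Xx.
  by apply: ny; exists x.
by rewrite !euler_scale// eX eY.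
Qed.

Lemma fubini_arc :
  fubini (fun x y => ind (X x /\ y = f x)) /\ fubini (fun x y => ind (X x /\ y < f x)).
Proof.
case E : c => [s|]; last exact: fubini_arc_cst.
by split; [exact: fubini_arc_graph E|exact: fubini_arc_under E].
Qed.

End MonotoneArc.

(** The boundary points cut the line into gaps, each inside [X] or disjoint from it. [Y i] is the
    part of [X] in the gap with [i] boundary points below, possibly empty; the list [s] holds the
    boundary points belonging to [X]. *)
Lemma o1_pieces X : o1 X -> exists (K : nat) (Y : nat -> R -> Prop) (s : seq R),
  [/\ forall i, o1 (Y i), forall i, open_convex (Y i), forall i x, Y i x -> X x &
  forall x, ind (X x) = \sum_(i <- iota 0 K) ind (Y i x) + \sum_(c <- s) ind (x = c)].
Proof.
move=> oX; pose F := [set y | ~ (near_pt y X \/ near_pt y (fun z => ~ X z))].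
have fF : finite_set F by exact: (o1_boundary (S := S)).
have oF : o1 F.
  by apply: df_not; apply: df_or; apply: df_near_pt; [|apply: df_not]; exact: (o1_at 0 oX).
have fbelow x : finite_set (below F x) by exact: below_finite.
pose Y i x := X x /\ ~ F x /\ ncard (below F x) = i.
have fFX : finite_set [set x | X x /\ F x] by apply: sub_finite_set fF => x [].
exists (ncard F).+1, Y, (fset_set [set x | X x /\ F x]); split.
- move=> i; apply: df_and => //; apply: df_and; first exact: df_not.
  apply: (@df_ncard_eq _ S i (fun e => below F (e 0))) => //.
  by apply: df_and; [exact: (o1_at 0 oF)|exact: df_ltP].
- have gap x y z i : Y i x -> Y i z -> x <= y -> y <= z -> ~ F y /\ ncard (below F y) = i.
    move=> [_ [nFx cx]] [_ [nFz cz]] xy yz.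
    have le1 : (i <= ncard (below F y))%N.
      by rewrite -cx; apply: le_ncard => // w [Fw wx]; split=> //; exact: lt_le_trans xy.
    have le2 : (ncard (below F y) <= i)%N.
      by rewrite -cz; apply: le_ncard => // w [Fw wx]; split=> //; exact: lt_le_trans yz.
    split; last by apply/eqP; rewrite eqn_leq le1 le2.
    move=> Fy; have yz' : y < z by rewrite lt_neqAle yz andbT; apply/eqP => E; rewrite E in Fy.
    by have := ncard_below fF Fy yz'; rewrite cz ltnNge le1.
  move=> i; split=> [x [Xx [nFx cx]]|x y z Yx Yz xy yz].
    have [t tF] := finite_set_seq fF.
    have nbF : near_pt x (fun y => forall b, b \in t -> (b < y) = (b < x) /\ b <> y).
      apply: near_pt_all => b /tF Fb; have [be|eb|be] := ltgtP b x.
      + by apply: near_pt_imp (near_pt_gt be) => y bx; split=> // bE; rewrite bE ltxx in bx.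
      + apply: near_pt_imp (near_pt_lt eb) => y xb; rewrite ltNge ltW//; split=> // bE.
        by rewrite bE ltxx in xb.
      + by rewrite be in Fb.
    have nbX : near_pt x X by have /contrapT[//|/near_pt_self] := nFx.
    apply: near_pt_imp (near_pt_and nbX nbF) => y [Xy Hy]; split=> //; split.
      by move=> /tF /Hy[].
    rewrite -cx; congr ncard; apply/seteqP; split=> b [Fb by_];
      have [bE _] := Hy b (iffRL (tF b) Fb); split=> //; by move: by_; rewrite bE.
  have [nFy cy] := gap x y z i Yx Yz xy yz; split; last by [].
  move: xy; rewrite le_eqVlt => /predU1P[<-|xy]; first by case: Yx.
  apply: (@segment_chain _ (fun a b => X a -> X b) x y) => //.
  + by move=> a b c ab bc /ab.
  + move=> w xw wy; have [nFw _] := gap x w z i Yx Yz xw (le_trans wy yz).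
    have /contrapT[[u [v [uw wv H]]]|[u [v [uw wv H]]]] := nFw; exists u, v; split=> // a b ua ab bv _ _ Xa.
      by apply: H => //; exact: lt_trans ab.
    by case: (H a ua (lt_trans ab bv)).
  + by case: Yx.
- by move=> i x [].
- move=> x; have inF c : c \in fset_set [set x | X x /\ F x] -> X c /\ F c.
    by rewrite in_fset_set// => /set_mem.
  have [Xx|nX] := pselect (X x); last first.
    rewrite indF// !sum_ind0// => [c /inF[Xc _] E|i _ [//]].
    by apply: nX; rewrite E.
  rewrite indT//; have [Fx|nFx] := pselect (F x).
    rewrite sum_ind0 => [|i _ [_ []]//]; rewrite (sum_ind1 (t := x)) ?fset_uniq//.
    by rewrite in_fset_set// mem_set.
  rewrite (sum_ind1 (t := ncard (below F x))) ?iota_uniq//.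
  - by rewrite sum_ind0// => c /inF[_ Fc] E; apply: nFx; rewrite E.
  - by rewrite mem_iota add0n /= ltnS; apply: le_ncard => // z [].
  - by move=> i; split=> [[_ [_ ->]]|->].
Qed.

Lemma fubini_ext g h : (forall x y, g x y = h x y) -> fubini g -> fubini h.
Proof.
by move=> gh; rewrite (_ : h = g)//; apply/funext => x; apply/funext => y; rewrite gh.
Qed.

(** An isolated point [c] contributes an integrand supported on the line [x = c], which is a product
    of functions of one variable. *)
Lemma fubini_pieces X (P : R -> R -> Prop) : o1 X -> o2 P ->
  (forall Y, o1 Y -> open_convex Y -> (forall x, Y x -> X x) ->
    fubini (fun x y => ind (Y x /\ P x y))) ->
  fubini (fun x y => ind (X x /\ P x y)).
Proof.
move=> oX oP H; have [K [Y [s [oY ocY YX XE]]]] := o1_pieces oX.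
apply: (@fubini_ext (fun x y => 1 * (\sum_(i <- iota 0 K) 1 * ind (Y i x /\ P x y))
    + \sum_(c <- s) 1 * ind (x = c /\ P x y))).
  move=> x y; rewrite mul1r ind_and XE mulrDl !mulr_suml.
  by congr (_ + _); apply: eq_bigr => i _; rewrite ind_and mul1r.
have cY i : constr2 (fun x y => ind (Y i x /\ P x y)).
  by apply: constr2_ind; apply: df_and => //; exact: oY.
have cc c : constr2 (fun x y => ind (x = c /\ P x y)).
  by apply: constr2_ind; apply: df_and => //; exact: df_eqc.
apply: fubini_lin; [exact: constr2_sum|exact: constr2_sum| |].
  by apply: fubini_sum => // i; apply: H => //; exact: YX.
apply: fubini_sum => // c.
apply: (@fubini_ext (fun x y => ind (x = c) * ind (P c y))).
  by move=> x y; rewrite -ind_and; apply: ind_ext; split=> -[->].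
apply: fubini_prod; first exact: (euler_point c).1.
by apply: (constr1_step (u := fun y => ind (P c y))); apply: constr_ind; exact: (o2_l c oP).
Qed.

(** Monotonicity of one fixed type near each point propagates along an open convex piece by
    [segment_chain], which turns the piece into a monotone arc. *)
Lemma fubini_regular X f c : definable_fun S f -> o1 X -> (forall x, X x -> regular c f x) ->
  fubini (fun x y => ind (X x /\ y = f x)) /\ fubini (fun x y => ind (X x /\ y < f x)).
Proof.
move=> of_ oX Xr.
have arc Y : o1 Y -> open_convex Y -> (forall x, Y x -> X x) ->
    fubini (fun x y => ind (Y x /\ y = f x)) /\ fubini (fun x y => ind (Y x /\ y < f x)).
  move=> oY ocY YX; have [[x0 Yx0]|nY] := pselect (exists x, Y x); last first.
    split; apply: fubini_ext fubini0 => x y; rewrite indF// => -[Yx _];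
      by apply: nY; exists x.
  apply: (@fubini_arc f Y c x0) => // [x y Yx Yy xy|x /YX/Xr [a [b [ax xb _]]]]; last exact.
  apply: (@segment_chain _ (fun a b => order_rel c (f a) (f b)) x y) => //.
    by move=> a b d; exact: order_rel_trans.
  move=> z xz zy; have [a [b [az zb sf _]]] := Xr z (YX z (ocY.2 x z y Yx Yy xz zy)).
  by exists a, b; split=> // u v au uv vb _ _; exact: sf.
have olt : o2 (fun x y => y < f x).
  by apply: (df_fun (P := fun v e => e 1%N < v) 0 of_); exact: df_ltP.
by split; apply: fubini_pieces => // Y oY ocY YX; [exact: (arc Y oY ocY YX).1|exact: (arc Y oY ocY YX).2].
Qed.

Lemma fubini_split X Y (P : R -> R -> Prop) : o1 X -> o1 Y -> o2 P ->
  fubini (fun x y => ind ((X x /\ Y x) /\ P x y)) ->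
  fubini (fun x y => ind ((X x /\ ~ Y x) /\ P x y)) ->
  fubini (fun x y => ind (X x /\ P x y)).
Proof.
move=> oX oY oP f1 f2; have oX' := oX : df (fun e => X (e 0)).
apply: (@fubini_ext (fun x y => 1 * ind ((X x /\ Y x) /\ P x y) + ind ((X x /\ ~ Y x) /\ P x y))).
  move=> x y; rewrite mul1r !ind_and; have [h|h] := pselect (Y x).
    by rewrite (indT h) [ind (~ _)]indF; [ring|apply].
  by rewrite (indF h) (indT h); ring.
apply: fubini_lin => //; apply: constr2_ind; apply: df_and => //; apply: df_and => //.
by apply: df_not; exact: oY.
Qed.

(** [X] is split according to the type of monotonicity of [f]. The remainder is finite, so its open
    convex pieces are empty. *)
Lemma fubini_graph_under X f : definable_fun S f -> o1 X ->
  fubini (fun x y => ind (X x /\ y = f x)) /\ fubini (fun x y => ind (X x /\ y < f x)).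
Proof.
move=> of_ oX.
have olt : o2 (fun x y => y < f x).
  by apply: (df_fun (P := fun v e => e 1%N < v) 0 of_); exact: df_ltP.
have main (P : R -> R -> Prop) : o2 P ->
    (forall Z c, o1 Z -> (forall x, Z x -> regular c f x) -> fubini (fun x y => ind (Z x /\ P x y))) ->
    fubini (fun x y => ind (X x /\ P x y)).
  move=> oP H; have oreg c := o1_regular c of_.
  pose X1 x := X x /\ ~ regular None f x.
  pose X2 x := X1 x /\ ~ regular (Some true) f x.
  have oX1 : o1 X1 by apply: df_and => //; exact/df_not/oreg.
  have oX2 : o1 X2 by apply: df_and => //; exact/df_not/oreg.
  apply: (fubini_split oX (oreg None)) => //.
    by apply: (H (fun x => X x /\ regular None f x) None) => [|x []//]; apply: df_and => //; exact: oreg.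
  apply: (fubini_split oX1 (oreg (Some true))) => //.
    by apply: (H (fun x => X1 x /\ regular (Some true) f x) (Some true)) => [|x []//]; apply: df_and => //; exact: oreg.
  apply: (fubini_split oX2 (oreg (Some false))) => //.
    by apply: (H (fun x => X2 x /\ regular (Some false) f x) (Some false)) => [|x []//]; apply: df_and => //; exact: oreg.
  apply: fubini_pieces => // [|Y oY ocY YX]; first by apply: df_and => //; exact/df_not/oreg.
  have [[x Yx]|nY] := pselect (exists x, Y x); last first.
    apply: fubini_ext fubini0 => x y; rewrite indF// => -[Yx _].
    by apply: nY; exists x.
  exfalso; apply: (has_interval_infinite (near_pt_itv (ocY.1 x Yx))).
  apply: sub_finite_set (regular_finite of_) => z /YX[[[_ n1] n2] n3] [[[]|]] //.
by split; apply: main => // Z c oZ Zr; have [] := fubini_regular of_ oZ Zr.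
Qed.

Definition discontinuity (u : R -> int) : set R := [set y | ~ near_pt y (fun z => u z = u y)].

Lemma discontinuity_finite u : constr1 u -> finite_set (discontinuity u).
Proof.
move=> [[s us] ou]; have {}us y : u y \in s := us (fun=> y).
apply: (@sub_finite_set _ _ (\bigcup_(k in [set` s]) [set y |
    ~ (near_pt y (fun z => u z = k) \/ near_pt y (fun z => ~ (u z = k)))])).
  by move=> y /= ny; exists (u y) => //= -[//|/near_pt_self].
by apply: bigcup_finite => [|k _]; [exact: finite_seq|exact: (o1_boundary (ou k))].
Qed.

Lemma continuous_constant (u : R -> int) (a b : R) : a < b ->
  (forall z, a <= z -> z <= b -> ~ discontinuity u z) -> u a = u b.
Proof.
move=> ab H; apply: (@segment_chain _ (fun a b => u a = u b)) ab _; first by move=> x y z ->.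
move=> z az zb; have /contrapT[p [q [pz zq K]]] := H z az zb.
by exists p, q; split=> // x y px xy yq _ _; rewrite !K//; lra.
Qed.

(** Induction on a bound, supplied by uniform finiteness, for the number of discontinuities of the
    sections [g x]. Without discontinuities [g] depends on [x] alone. Otherwise [g] differs from a
    function with fewer discontinuities by multiples of indicators of the graph and the subgraph of
    the least discontinuity [f]. *)
Lemma planar_fubini g0 : constr2 g0 -> fubini g0.
Proof.
have cl g x : constr2 g -> constr1 (g x).
  by move=> cg; apply: (constr2_at (t := fun e => upd e 1 x) 1 0 cg); apply: ren_updc; exact: ren_id.
have oD g : constr2 g -> o2 (fun x y => discontinuity (g x) y).
  move=> [[s gs] og]; apply: df_not.
  have dE : df (fun e => exists2 i, (i < size s)%N & g (e 0) (e 1%N) = nth 0 s i /\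
      near_pt (e 1%N) (fun z => g (e 0) z = nth 0 s i)).
    apply: df_exn => i _; apply: df_and; first exact: og.
    by apply: df_near_pt; exact: (@o2_at _ S (fun x y => g x y = nth 0 s i) 1 0 (og _)).
  apply: df_ext dE => e; split=> [[i _ [E]]|H].
    by apply: near_pt_imp => z; rewrite E.
  exists (index (g (e 0) (e 1%N)) s); first by rewrite index_mem; exact: (gs e).
  by rewrite nth_index//; exact: (gs e).
suff main K : forall g, constr2 g -> (forall x, (ncard (discontinuity (g x)) <= K)%N) -> fubini g.
  move=> cg; have [||e|K HK] := @uniform_finiteness _ S 1 (fun e => discontinuity (g0 (e 0))).
  - exact: (o2_at 1 0 (oD _ cg)).
  - by move=> e e' ee; rewrite (ee 0%N).
  - exact/discontinuity_finite/cl.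
  - by apply: (main K) => // x; exact: (HK (fun=> x)).
elim: K => [|K IH] g cg gK.
  apply: (@fubini_ext (fun x _ => g x 0 * 1)).
    move=> x y; rewrite mulr1; have nD z : ~ discontinuity (g x) z.
      have := gK x; rewrite leqn0 => /eqP /(ncard_eq0 (discontinuity_finite (cl g x cg))).
      by move=> /seteqP[/(_ z)].
    by have [y0|y0|->//] := ltgtP 0 y; [|symmetry]; apply: continuous_constant.
  by apply: fubini_prod; [exact: (step_r cg 0)|exact: (step_eq (v := 1))].
have [[s gs] og] := cg; have {}gs x y : g x y \in s := gs (fun k => if k is 0 then x else y).
have fD x := discontinuity_finite (cl g x cg).
pose D x := discontinuity (g x).
pose X x := exists y, D x y.
have oX : o1 X by apply: df_ex; exact: (o2_at 1 0 (oD _ cg)).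
pose M x y := D x y /\ forall z, D x z -> y <= z.
pose f x := xget 0 [set y | M x y].
have of_ : definable_fun S f.
  apply: definable_fun_xget.
    apply: df_and; first exact: (oD _ cg).
    apply: df_fa; apply: df_imp; first exact: (o2_at 1 0 (oD _ cg)).
    exact: df_leP.
  by move=> x y z [Ay Hy] [Az Hz]; apply/eqP; rewrite eq_le Hy// Hz.
have fP x : X x -> M x (f x).
  move=> Xx; apply: (@xgetPex _ 0 [set y | M x y]).
  by have [m Am Hm] := finite_min (fD x) Xx; exists m.
(* The values of [g x] just above, far below and at [f x]. Outside [X], where [f x] is the default
   [0], they are suppressed by the condition [X x]. *)
pose r x := right_value (g x) (f x); pose p x := ninfty_value (g x); pose q x := g x (f x).
have rP x : near_right (f x) (fun y => g x y = r x).
  by have [/(_ (f x))[v gv] _ _] := step_l cg x; rewrite /r (right_value_eq gv).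
have pP x : near_ninfty (fun y => g x y = p x).
  by have [_ [v gv] _] := step_l cg x; rewrite /p (ninfty_value_eq gv).
have gv v : df (fun e => g (e 1%N) (e 0) = v) by exact: (@o2_at _ S (fun x y => g x y = v) 1 0 (og v)).
have dr k : o1 (fun x => r x = k).
  have dR : df (fun e => near_right (f (e 0)) (fun y => g (e 0) y = k)).
    apply: (df_fun (P := fun v e => near_right v (fun y => g (e 0) y = k)) 0 of_).
    by apply: df_near_right; exact: (@o2_at _ S (fun x y => g x y = k) 2 0 (og k)).
  apply: df_ext dR => e; split=> [/right_value_eq//|<-]; exact: rP.
have cr : constr1 r.
  split=> //; exists s => e; have [y <-] := near_right_ex (rP (e 0)); exact: gs.
have cp : constr1 p.
  split; first by exists s => e; have [y <-] := near_ninfty_ex (pP (e 0)); exact: gs.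
  move=> k; have dN : df (fun e => near_ninfty (fun y => g (e 0) y = k)) by apply: df_near_ninfty; exact: gv.
  by apply: df_ext dN => e; split=> [/ninfty_value_eq//|<-]; exact: pP.
have cq : constr1 q.
  split; first by exists s => e; exact: gs.
  by move=> k; apply: (df_fun (P := fun v e => g (e 0) v = k) 0 of_); exact: gv.
(* Extending the value from the right of [f x] down to minus infinity removes the least
   discontinuity and creates none. *)
pose g' x y := if `[< X x /\ y <= f x >] then r x else g x y.
have g'1 x y : X x -> y <= f x -> g' x y = r x by move=> Xx yf; rewrite /g' asboolT.
have g'2 x y : ~ (X x /\ y <= f x) -> g' x y = g x y by move=> H; rewrite /g' asboolF.
have ole : o2 (fun x y => y <= f x).
  by apply: (df_fun (P := fun v e => e 1%N <= v) 0 of_); exact: df_leP.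
have cg' : constr2 g'.
  split.
    exists s => e; rewrite /g'; case: asboolP => _; last exact: gs.
    by have [y <-] := near_right_ex (rP (e 0)); exact: gs.
  move=> k; have dE : df (fun e => ((X (e 0) /\ e 1%N <= f (e 0)) /\ r (e 0) = k) \/
      (~ (X (e 0) /\ e 1%N <= f (e 0)) /\ g (e 0) (e 1%N) = k)).
    have dX : df (fun e => X (e 0) /\ e 1%N <= f (e 0)) by exact: df_and.
    by apply: df_or; apply: df_and => //; [exact: dr|exact: df_not].
  apply: df_ext dE => e; rewrite /g'; case: asboolP => H; last by split=> [[[]|[]]//|]; right.
  by split=> [[[]|[]]//|]; left.
have fg' : fubini g'.
  apply: IH => // x; have [Xx|nX] := pselect (X x); last first.
    rewrite (_ : discontinuity (g' x) = set0) ?ncard_set0//.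
    apply/seteqP; split=> // y; rewrite /discontinuity /=.
    rewrite (_ : g' x = g x); first by move=> Dy; apply: nX; exists y.
    by apply/funext => z; rewrite g'2// => -[].
  have [Df Hf] := fP x Xx.
  have := gK x; rewrite (ncardD1 (fD x) Df) ltnS; apply: leq_trans.
  apply: le_ncard; first by apply: sub_finite_set (fD x) => z [].
  move=> y; rewrite /discontinuity /= => Dy.
  have fy : f x < y.
    rewrite ltNge; apply/negP => yf; apply: Dy; rewrite g'1//.
    have [b fb Hb] := rP x; exists (y - 1), b; split; [lra|lra|] => z _ zb.
    have [zf|fz] := leP z (f x); first by rewrite g'1.
    by rewrite g'2 ?Hb// => -[_]; rewrite leNgt fz.
  split; last by move=> yE; rewrite yE ltxx in fy.
  move=> ng; apply: Dy; rewrite g'2; last by move=> [_]; rewrite leNgt fy.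
  apply: near_pt_imp (near_pt_and ng (near_pt_gt fy)) => z [gz fz].
  by rewrite g'2// => -[_]; rewrite leNgt fz.
have [[t tP] dP] : constr1 (fun x => p x - r x) by exact: (constr_op (fun a b => a - b) cp cr).
have [[t' tQ] dQ] : constr1 (fun x => q x - r x) by exact: (constr_op (fun a b => a - b) cq cr).
apply: (@fubini_ext (fun x y => 1 * (1 * g' x y +
    \sum_(k <- undup t) k * ind ((X x /\ p x - r x = k) /\ y < f x)) +
    \sum_(k <- undup t') k * ind ((X x /\ q x - r x = k) /\ y = f x))).
  move=> x y; rewrite !mul1r.
  rewrite (eq_bigr (fun k => ind (X x /\ y < f x) * (k * ind (p x - r x = k)))) => [|k _]; last first.
    by rewrite !ind_and; ring.
  rewrite [X in _ + X](eq_bigr (fun k => ind (X x /\ y = f x) * (k * ind (q x - r x = k)))) => [|k _]; last first.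
    by rewrite !ind_and; ring.
  rewrite -!mulr_sumr -(ind_decomp (f := fun x => p x - r x) (fun x => tP (fun=> x))).
  rewrite -(ind_decomp (f := fun x => q x - r x) (fun x => tQ (fun=> x))).
  have [Xx|nX] := pselect (X x); last first.
    by rewrite g'2 ?indF ?indF ?mul0r ?addr0// => -[].
  have [Df Hf] := fP x Xx.
  have [yf|[fy|yf]] : y < f x \/ (f x < y \/ y = f x) by case: ltgtP; auto.
  - rewrite g'1 ?ltW// (indT (conj Xx yf)) [ind (_ /\ y = _)]indF; last first.
      by move=> [_ E]; rewrite E ltxx in yf.
    suff -> : g x y = p x by ring.
    have [z zy <-] := near_ninfty_exlt y (pP x); symmetry; apply: continuous_constant => // w _ wy Dw.
    by have := le_lt_trans (le_trans (Hf w Dw) wy) yf; rewrite ltxx.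
  - rewrite g'2; last by move=> [_]; rewrite leNgt fy.
    rewrite [ind (_ /\ y < _)]indF; last by move=> [_ E]; have := lt_trans fy E; rewrite ltxx.
    rewrite [ind _]indF; last by move=> [_ E]; rewrite E ltxx in fy.
    by rewrite !mul0r !addr0.
  - rewrite g'1 ?yf// [ind (_ /\ _ < _)]indF; last by rewrite ltxx => -[].
    by rewrite indT// /q; ring.
have oXP k : o1 (fun x => X x /\ p x - r x = k) by apply: df_and => //; exact: dP.
have oXQ k : o1 (fun x => X x /\ q x - r x = k) by apply: df_and => //; exact: dQ.
have olt : o2 (fun x y => y < f x).
  by apply: (df_fun (P := fun v e => e 1%N < v) 0 of_); exact: df_ltP.
have c1 k : constr2 (fun x y => ind ((X x /\ p x - r x = k) /\ y < f x)).
  by apply: constr2_ind; apply: df_and => //; exact: oXP.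
have c2 k : constr2 (fun x y => ind ((X x /\ q x - r x = k) /\ y = f x)).
  by apply: constr2_ind; apply: df_and => //; exact: oXQ.
apply: fubini_lin.
- by apply: constr2_lin => //; exact: constr2_sum.
- exact: constr2_sum.
- apply: fubini_lin; [exact: cg'|exact: constr2_sum|exact: fg'|].
  by apply: fubini_sum => // k; exact: (fubini_graph_under of_ (oXP k)).2.
- by apply: fubini_sum => // k; exact: (fubini_graph_under of_ (oXQ k)).1.
Qed.

Lemma euler_at_swap i j (F : (nat -> R) -> int) : constr F -> i != j ->
  euler_at i (euler_at j F) = euler_at j (euler_at i F).
Proof.
move=> cF ij; apply/funext => e; rewrite /euler_at.
have cg : constr2 (fun x y => F (upd (upd e i x) j y)).
  apply: (constr_comp (t := fun e' => upd (upd e i (e' 0)) j (e' 1%N))) cF.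
  by apply: ren_upd; apply: ren_upd; exact: ren_c.
have := planar_fubini cg; rewrite /fubini /euler_xy /euler_yx => ->.
by congr euler; apply/funext => y; congr euler; apply/funext => x; rewrite updC.
Qed.

End Fubini.

(** * Iterated integrals over several coordinates *)

Section Iterated.
Variable R : realType.
Implicit Types (e : nat -> R) (F G : (nat -> R) -> int) (s t : seq nat).

Definition eulers s F := foldr (@euler_at R) F s.

(** Every integrand met on the way is a step function. This is what linearity of [eulers] requires,
    and it also makes sense for indicators of simplices that are not definable. *)
Fixpoint istep s F : Prop :=
  if s is i :: t then istep t F /\ forall e, step_fun (fun y => eulers t F (upd e i y))
  else True.

Lemma eulers_cat s t F : eulers (s ++ t) F = eulers s (eulers t F).
Proof. by rewrite /eulers foldr_cat. Qed.

Lemma istep_cat s t F : istep t F -> istep s (eulers t F) -> istep (s ++ t) F.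
Proof.
move=> tF; elim: s => //= i s IH [/IH sF H]; split=> // e.
by rewrite eulers_cat; exact: H.
Qed.

Lemma istep_lin s c F G : istep s F -> istep s G -> istep s (fun e => c * F e + G e)
  /\ eulers s (fun e => c * F e + G e) = fun e => c * eulers s F e + eulers s G e.
Proof.
elim: s => //= i s IH [iF sF] [iG sG]; have [iFG eFG] := IH iF iG; split.
  by split=> // e; rewrite eFG; exact: step_lin (sF e) (sG e).
by apply/funext => e; rewrite eFG /euler_at euler_lin.
Qed.

Lemma istep0 s : istep s (fun=> 0) /\ eulers s (fun=> 0) = fun=> 0.
Proof.
elim: s => //= i s [i0 e0]; rewrite e0; split; last by apply/funext => e; exact: euler0.
by split=> // e; exact: (step_eq (v := 0)).
Qed.

Lemma istep_scale s c F : istep s F -> istep s (fun e => c * F e)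
  /\ eulers s (fun e => c * F e) = fun e => c * eulers s F e.
Proof.
move=> iF; have [i0 e0] := istep0 s; have := istep_lin c iF i0; rewrite e0.
rewrite (_ : (fun e => c * F e + 0) = fun e => c * F e); last by apply/funext => e; rewrite addr0.
by move=> [? ->]; split=> //; apply/funext => e; rewrite addr0.
Qed.

Lemma istep_sum (I : Type) (r : seq I) s (c : I -> int) (F : I -> (nat -> R) -> int) :
  (forall i, istep s (F i)) -> istep s (fun e => \sum_(i <- r) c i * F i e)
  /\ eulers s (fun e => \sum_(i <- r) c i * F i e)
     = fun e => \sum_(i <- r) c i * eulers s (F i) e.
Proof.
move=> iF; elim: r => [|i r [IH1 IH2]].
  have [i0 e0] := istep0 s.
  rewrite (_ : (fun e => _) = fun=> 0); last by apply/funext => e; rewrite big_nil.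
  by rewrite e0; split=> //; apply/funext => e; rewrite big_nil.
rewrite (_ : (fun e => _) = fun e => c i * F i e + \sum_(j <- r) c j * F j e); last first.
  by apply/funext => e; rewrite big_cons.
have [? ->] := istep_lin (c i) (iF i) IH1; split=> //.
by apply/funext => e; rewrite big_cons IH2.
Qed.

Lemma eulers_local s F G e :
  (forall e', (forall k, k \notin s -> e' k = e k) -> F e' = G e') ->
  eulers s F e = eulers s G e.
Proof.
elim: s e => [|i s IH] e H /=; first exact: H.
congr euler; apply/funext => y; apply: IH => e' e'e; apply: H => k.
by rewrite inE negb_or => /andP[ki ks]; rewrite e'e// upd_other.
Qed.

Lemma eulers_ren s F (w : nat -> nat) e : injective w ->
  eulers (map w s) (fun e => F (fun k => e (w k))) e = eulers s F (fun k => e (w k)).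
Proof.
move=> wI; elim: s e => //= i s IH e; congr euler; apply/funext => y; rewrite IH.
by congr (eulers s F); apply/funext => k; rewrite /upd (inj_eq wI).
Qed.

Variable S : ominimal_structure R.

Lemma constr_eulers s F : constr S F -> constr S (eulers s F).
Proof. by move=> cF; elim: s => //= i s; exact: constr_euler_at. Qed.

Lemma constr_istep s F : constr S F -> istep s F.
Proof.
move=> cF; elim: s => //= i s IH; split=> // e.
by apply: (step_constr (S := S)); exact: constr_eulers.
Qed.

(** Each integration from [s] is moved past those of [t] one at a time. *)
Lemma eulers_swap s t F : constr S F -> (forall i, i \in s -> i \notin t) ->
  eulers s (eulers t F) = eulers t (eulers s F).
Proof.
move=> cF; elim: s => //= i s IH H.
rewrite IH => [|j js]; last by apply: H; rewrite inE js orbT.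
have: i \notin t by apply: H; rewrite inE eqxx.
elim: t {IH H} => //= j t IH; rewrite inE negb_or => /andP[ij it].
rewrite (euler_at_swap (S := S))// ?IH//.
by apply: constr_eulers; exact: constr_eulers.
Qed.

End Iterated.

(** * Simplices and complexes *)

Section OpenHull.
Variable R : realType.
Implicit Types (e : nat -> R).

(** Forgetting coordinates can make the vertices of a simplex dependent, so the class stable under
    projection is that of relatively open hulls of arbitrary points, read on the first [n]
    coordinates. *)
Definition hull k (V : 'I_k -> nat -> R) n e := exists t : 'I_k -> R,
  [/\ forall i, 0 < t i, \sum_i t i = 1 & forall j, (j < n)%N -> e j = \sum_i t i * V i j].

(** The rows span the direction space of the affine span; the rank is the dimension of the hull. *)
Definition hull_dirs d (V : 'I_d.+1 -> nat -> R) n : 'M[R]_(d, n) :=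
  \matrix_(i < d, j < n) (V (lift ord0 i) j - V ord0 j).

(* The [n]-th coordinate direction is parallel to the affine span of the hull. *)
Definition hull_vertical k (V : 'I_k -> nat -> R) n := exists a : 'I_k -> R,
  \sum_i a i = 0 /\ forall j, (j <= n)%N -> \sum_i a i * V i j = (j == n)%:R.

Lemma hull_fiber_convex k (V : 'I_k -> nat -> R) n e x y z :
  hull V n.+1 (upd e n x) -> hull V n.+1 (upd e n z) -> x <= y -> y <= z ->
  hull V n.+1 (upd e n y).
Proof.
move=> hx hz; rewrite le_eqVlt => /predU1P[<-//|xy] yz; have xz : 0 < z - x by lra.
have [t [t0 t1 tE]] := hx; have [u [u0 u1 uE]] := hz.
pose l := (y - x) / (z - x).
have l0 : 0 < l by rewrite divr_gt0// subr_gt0.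
have l1 : l <= 1 by rewrite ler_pdivrMr// mul1r lerB.
exists (fun i => (1 - l) * t i + l * u i); split.
- move=> i; have := mulr_gt0 l0 (u0 i); have := t0 i.
  have : 0 <= (1 - l) * t i by apply: mulr_ge0; [lra|exact: ltW].
  lra.
- by rewrite big_split /= -!mulr_sumr t1 u1; ring.
- move=> j jn; rewrite (eq_bigr (fun i => (1 - l) * (t i * V i j) + l * (u i * V i j))) => [|i _].
    rewrite big_split /= -!mulr_sumr -(tE j jn) -(uE j jn) /upd; case: eqP => _; last by ring.
    by rewrite /l; field; rewrite subr_eq0 gt_eqF// -subr_gt0.
  by ring.
Qed.

(** Moving the weights along a vertical direction moves the last coordinate alone, and small moves
    keep the weights positive. *)
Lemma hull_fiber_open k (V : 'I_k -> nat -> R) n e y : hull_vertical V n ->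
  hull V n.+1 (upd e n y) -> near_pt y (fun y => hull V n.+1 (upd e n y)).
Proof.
move=> [a [a0 aE]] [t [t0 t1 tE]].
have : near_pt y (fun y' => forall i, i \in enum 'I_k -> 0 < t i + (y' - y) * a i).
  (* The summand [1] keeps the denominator positive when [a i] vanishes. *)
  apply: near_pt_all => i _; pose r := t i / (`|a i| + 1).
  have r0 : 0 < r by rewrite divr_gt0//; have := normr_ge0 (a i); lra.
  exists (y - r), (y + r); split; [lra|lra|] => z z1 z2.
  have zr : `|z - y| < r by rewrite ltr_norml; apply/andP; split; lra.
  have : `|(z - y) * a i| <= `|z - y| * (`|a i| + 1) by rewrite normrM ler_wpM2l//; lra.
  have : `|z - y| * (`|a i| + 1) < t i.
    by rewrite -ltr_pdivlMr//; have := normr_ge0 (a i); lra.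
  have := ler_norm (- ((z - y) * a i)); rewrite normrN; lra.
apply: near_pt_imp => z tz; exists (fun i => t i + (z - y) * a i); split.
- by move=> i; apply: tz; rewrite mem_enum.
- by rewrite big_split /= -mulr_sumr t1 a0; ring.
- move=> j jn; rewrite (eq_bigr (fun i => t i * V i j + (z - y) * (a i * V i j))) => [|i _].
    rewrite big_split /= -mulr_sumr -(tE j jn) (aE j jn) /upd; case: eqP => _; rewrite ?mulr1 ?mulr0 ?addr0//.
    by ring.
  by ring.
Qed.

(** Two points on a vertical line yield, as the normalized difference of their weights, a vertical
    direction. *)
Lemma hull_fiber_uniq k (V : 'I_k -> nat -> R) n e x y : ~ hull_vertical V n ->
  hull V n.+1 (upd e n x) -> hull V n.+1 (upd e n y) -> x = y.
Proof.
move=> nv [t [t0 t1 tE]] [u [u0 u1 uE]]; apply: contrapT => /eqP xy; apply: nv.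
have yx : y - x != 0 by rewrite subr_eq0 eq_sym.
exists (fun i => (u i - t i) / (y - x)); split.
  by rewrite -mulr_suml sumrB t1 u1 subrr mul0r.
move=> j jn; rewrite (eq_bigr (fun i => (u i * V i j - t i * V i j) / (y - x))) => [|i _].
  rewrite -mulr_suml sumrB -(tE j)// -(uE j)// /upd; case: eqP => _; first by rewrite divff.
  by rewrite subrr mul0r.
by ring.
Qed.

Lemma hull_proj k (V : 'I_k -> nat -> R) n e :
  hull V n e <-> exists y, hull V n.+1 (upd e n y).
Proof.
split=> [[t [t0 t1 tE]]|[y [t [t0 t1 tE]]]].
  exists (\sum_i t i * V i n), t; split=> // j; rewrite ltnS leq_eqVlt /upd.
  by case: eqP => [->//|_] /= /tE.
exists t; split=> // j jn; have := tE j (ltnW jn).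
by rewrite upd_other// ltn_eqF.
Qed.

Lemma hull_verticalP d (V : 'I_d.+1 -> nat -> R) n :
  hull_vertical V n <-> (delta_mx (0 : 'I_1) (ord_max : 'I_n.+1) <= hull_dirs V n.+1)%MS.
Proof.
split=> [[a [a0 aE]]|/submxP[u uE]].
  apply/submxP; exists (\row_i a (lift ord0 i)); apply/rowP => j.
  rewrite !mxE /= (eq_bigr (fun i => a (lift ord0 i) * V (lift ord0 i) j - a (lift ord0 i) * V ord0 j)).
    rewrite sumrB -mulr_suml.
    have -> : \sum_i a (lift ord0 i) = - a ord0.
      by apply/eqP; rewrite -addr_eq0 addrC -(big_ord_recl d a) a0.
    rewrite mulNr opprK addrC -(big_ord_recl d (fun i => a i * V i j)) aE; last by rewrite -ltnS.
    by rewrite -val_eqE.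
  by move=> i _; rewrite !mxE mulrBr.
exists (fun i => if unlift ord0 i is Some i' then u 0 i' else - \sum_i' u 0 i').
split=> [|j jn].
  rewrite big_ord_recl unlift_none; under [X in _ + X]eq_bigr do rewrite liftK.
  by rewrite addNr.
have := congr1 (fun v : 'rV_n.+1 => v 0 (Ordinal (jn : (j < n.+1)%N))) uE.
rewrite !mxE /= -val_eqE /= => ->.
rewrite big_ord_recl unlift_none mulNr mulr_suml addrC -sumrB.
by apply: eq_bigr => i _; rewrite liftK !mxE mulrBr.
Qed.

(** Rank and nullity for the projection [P] forgetting the last coordinate: its kernel is the
    vertical line, which meets the direction space in itself or in zero. *)
Lemma rank_hull_dirs d (V : 'I_d.+1 -> nat -> R) n :
  \rank (hull_dirs V n.+1) = (\rank (hull_dirs V n) + `[< hull_vertical V n >])%N.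
Proof.
pose P : 'M[R]_(n.+1, n) := \matrix_(i, j) (i == widen_ord (leqnSn n) j)%:R.
set M := hull_dirs V n.+1; pose v : 'rV[R]_n.+1 := delta_mx 0 ord_max.
have MP : hull_dirs V n = M *m P.
  apply/matrixP => i j; rewrite !mxE (bigD1 (widen_ord (leqnSn n) j))//= !mxE eqxx mulr1.
  by rewrite big1 ?addr0// => l /negPf lj; rewrite !mxE lj mulr0.
have vP : v *m P = 0.
  apply/rowP => j; rewrite -rowE !mxE -val_eqE /= gtn_eqF//.
have kerP (u : 'rV[R]_n.+1) : u *m P = 0 -> u = u 0 ord_max *: v.
  move=> uP; apply/rowP => j; rewrite !mxE; case: (unliftP ord_max j) => [j' ->|->]; last first.
    by rewrite !eqxx mulr1.
  have := congr1 (fun v : 'rV_n => v 0 j') uP; rewrite !mxE.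
  rewrite (bigD1 (widen_ord (leqnSn n) j'))//= !mxE eqxx mulr1 big1 ?addr0; last first.
    by move=> l /negPf lj; rewrite !mxE lj mulr0.
  have -> : widen_ord (leqnSn n) j' = lift ord_max j'.
    by apply: val_inj; rewrite /= /bump leqNgt ltn_ord.
  by move=> ->; rewrite eq_sym (negPf (neq_lift _ _)) mulr0.
rewrite -(mxrank_mul_ker M P) MP; congr addn.
have vker : (v <= kermx P)%MS by apply/sub_kermxP.
case: asboolP => [/hull_verticalP vM|nv].
  apply/eqP; rewrite eqn_leq; apply/andP; split.
    apply: leq_trans (mxrankS (capmxSr _ _)) _.
    suff : (kermx P <= v)%MS by move=> /mxrankS; rewrite mxrank_delta.
    apply/rV_subP => u /sub_kermxP /kerP ->; exact: scalemx_sub.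
  have vMK : (v <= M :&: kermx P)%MS by rewrite sub_capmx vM.
  by have := mxrankS vMK; rewrite mxrank_delta.
apply/eqP; rewrite mxrank_eq0; apply/eqP/row_matrixP => i; rewrite row0.
have := row_sub i (M :&: kermx P)%MS; rewrite sub_capmx => /andP[uM /sub_kermxP /kerP uE].
set u := row i _ in uM uE *; have [u0|u0] := eqVneq (u 0 ord_max) 0.
  by rewrite uE u0 scale0r.
exfalso; apply: nv; apply/hull_verticalP; rewrite -/v.
have -> : v = (u 0 ord_max)^-1 *: u by rewrite {2}uE scalerA mulVf// scale1r.
exact: scalemx_sub.
Qed.

(** Integrating the last coordinate, the fibers over the projected hull are open intervals, giving
    [-1], or points, giving [1], according to whether forgetting that coordinate lowers the
    dimension. The signs accumulate to the parity of the rank. *)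
Lemma euler_hull d (V : 'I_d.+1 -> nat -> R) n :
  istep (iota 0 n) (fun e => ind (hull V n e)) /\
  eulers (iota 0 n) (fun e => ind (hull V n e)) = fun=> (-1) ^+ \rank (hull_dirs V n).
Proof.
elim: n => [|n [IH1 IH2]].
  split=> //; apply/funext => e /=; rewrite (eqP (_ : \rank _ == 0%N)) ?expr0; last first.
    by rewrite -leqn0 rank_leq_col.
  (* With no coordinate left the hull is everything, and equal weights witness this. *)
  apply: indT; exists (fun=> d.+1%:R^-1); split=> //.
  by rewrite sumr_const card_ord -[_ *+ _]mulr_natr mulVf// pnatr_eq0.
have key e : step_fun (fun y => ind (hull V n.+1 (upd e n y))) /\
    euler_at n (fun e => ind (hull V n.+1 e)) e = (-1) ^+ `[< hull_vertical V n >] * ind (hull V n e).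
  rewrite /euler_at; have [|nh] := pselect (hull V n e); last first.
    have -> : (fun y => ind (hull V n.+1 (upd e n y))) = fun=> 0.
      by apply/funext => y; apply: indF => hy; apply: nh; apply/hull_proj; exists y.
    by rewrite euler0 indF// mulr0; split=> //; exact: (step_eq (v := 0)).
  move=> hn; rewrite indT// mulr1; have [y hy] := (hull_proj V n e).1 hn.
  case: asboolP => hv.
    rewrite expr1; apply: euler_open_convex; last by exists y.
    split=> [x|x1 x x2]; first exact: hull_fiber_open.
    exact: hull_fiber_convex.
  rewrite expr0 (_ : (fun y => _) = fun x => ind (x = y)); first exact: euler_point.
  apply/funext => x; apply: ind_ext; split=> [hx|->//].
  exact: hull_fiber_uniq hv hx hy.
have eE : euler_at n (fun e => ind (hull V n.+1 e)) =
    fun e => (-1) ^+ `[< hull_vertical V n >] * ind (hull V n e).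
  by apply/funext => e; have [] := key e.
have [i1 e1] := istep_scale ((-1) ^+ `[< hull_vertical V n >]) IH1.
rewrite -addn1 iotaD add0n; split.
  apply: istep_cat; last by rewrite /eulers /= addn1 eE.
  by split=> // e /=; rewrite addn1; have [] := key e.
rewrite eulers_cat /= addn1 eE e1 IH2; apply/funext => e.
by rewrite rank_hull_dirs exprD mulrC.
Qed.

End OpenHull.

(** * The characteristic of a complex as an iterated integral *)

Section ComplexCharacteristic.
Variable R : realType.
Implicit Types (e : nat -> R).

Definition env_of_row n (x : 'rV[R]_n) : nat -> R :=
  fun k => if insub k is Some j then x ord0 j else 0.

Lemma open_simplex_hull n d (v : 'I_d.+1 -> 'rV[R]_n) e :
  open_simplex v (row_env n e) <-> hull (fun i => env_of_row (v i)) n e.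
Proof.
have E (t : 'I_d.+1 -> R) j (jn : (j < n)%N) : \sum_i t i * env_of_row (v i) j =
    (\sum_i t i *: v i) ord0 (Ordinal jn).
  rewrite summxE; apply: eq_bigr => i _; rewrite mxE /env_of_row insubT/=.
  by congr (_ * v i _ _); apply: val_inj.
split=> -[t [t0 t1 te]]; exists t; split=> //.
  by move=> j jn; rewrite E -te mxE.
by apply/rowP => i; rewrite mxE te// (E t i (ltn_ord i)); congr (fun_of_matrix _ _ _); apply: val_inj.
Qed.

Lemma rank_affinely_independent n d (v : 'I_d.+1 -> 'rV[R]_n) :
  affinely_independent v -> \rank (hull_dirs (fun i => env_of_row (v i)) n) = d.
Proof.
move=> /eqP rk; rewrite -[RHS]rk; congr mxrank; apply/matrixP => i j.
by rewrite !mxE /env_of_row !valK.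
Qed.

Lemma euler_open_simplex n d (v : 'I_d.+1 -> 'rV[R]_n) : affinely_independent v ->
  istep (iota 0 n) (fun e => ind (open_simplex v (row_env n e))) /\
  eulers (iota 0 n) (fun e => ind (open_simplex v (row_env n e))) = fun=> (-1) ^+ d.
Proof.
move=> /rank_affinely_independent rd.
rewrite (_ : (fun e => _) = fun e => ind (hull (fun i => env_of_row (v i)) n e)).
  by have := euler_hull (fun i => env_of_row (v i)) n; rewrite rd.
by apply/funext => e; apply: ind_ext; exact: open_simplex_hull.
Qed.

(** A point is an open simplex of dimension [0]. *)
Lemma euler_row_point n (c : 'rV[R]_n) :
  eulers (iota 0 n) (fun e => ind (row_env n e = c)) = fun=> 1.
Proof.
have vi : affinely_independent (fun _ : 'I_1 => c).
  by rewrite /affinely_independent /row_free flatmx0 mxrank0.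
have [_] := euler_open_simplex vi; rewrite expr0 => <-; congr eulers.
apply/funext => e; apply: ind_ext; split=> [->|[t [_ t1 ->]]].
  by exists (fun=> 1); split=> //; rewrite big_ord1// scale1r.
by move: t1; rewrite !big_ord1 => ->; rewrite scale1r.
Qed.

Lemma complex_char_cells n (K : gen_complex R n) :
  complex_char K = \sum_(s : simplex K) (-1) ^+ sdim s.
Proof.
(* Affine independence bounds the dimensions by [n], so that the sum defining [complex_char] covers
   every cell. *)
have dn (s : simplex K) : (sdim s < n.+1)%N.
  by rewrite ltnS; have /eqP <- := vertex_indep s; exact: rank_leq_col.
rewrite [RHS](partition_big (fun s => Ordinal (dn s)) predT)//=.
apply: eq_bigr => i _; rewrite (eq_bigr (fun=> (-1) ^+ i)) => [|s /eqP <-//].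
rewrite sumr_const -mulr_natr; congr (_ * _).
rewrite natz; congr Posz; apply: eq_card => s; rewrite !inE -val_eqE.
Qed.

Lemma euler_realization n (K : gen_complex R n) :
  eulers (iota 0 n) (fun e => ind (realization K (row_env n e))) = fun=> complex_char K.
Proof.
pose F (s : simplex K) e := ind (cell s (row_env n e)).
have [sF eF] : (forall s : simplex K, istep (iota 0 n) (F s)) /\
    forall s : simplex K, eulers (iota 0 n) (F s) = fun=> (-1) ^+ sdim s.
  by split=> s; have [] := euler_open_simplex (vertex_indep s).
rewrite (_ : (fun e => _) = fun e => \sum_(s <- index_enum (simplex K)) 1 * F s e).
  have [_ ->] := istep_sum (index_enum (simplex K)) (fun=> 1) sF.
  apply/funext => e; rewrite complex_char_cells; apply: eq_bigr => s _.
  by rewrite eF mul1r.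
apply/funext => e; have [[s _ Ks]|nK] := pselect (realization K (row_env n e)).
  rewrite indT; last by exists s.
  rewrite (bigD1 s)//= [F s e]indT// mulr1 big1 ?addr0// => s' ss'.
  rewrite [F s' e]indF ?mulr0// => Ks'.
  have : (cell s `&` cell s') (row_env n e) by [].
  by rewrite cell_disjoint// => E; rewrite E eqxx in ss'.
rewrite indF// big1// => s _; rewrite [F s e]indF ?mulr0// => Ks.
by apply: nK; exists s.
Qed.

End ComplexCharacteristic.

(** * Invariance of the characteristic *)

Section Characteristic.
Variables (R : realType) (S : ominimal_structure R).
Implicit Types (e : nat -> R).

Lemma constr_set n (A : set 'rV[R]_n) : S n A ->
  constr S (fun e => ind (A (row_env n e))).
Proof. by move=> SA; apply: constr_ind; exists n, A. Qed.

(* The graph of a definable triangulation is integrated in both orders. *)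
Lemma has_char_euler m (B : set 'rV[R]_m) c : has_char S B c ->
  eulers (iota 0 m) (fun e => ind (B (row_env m e))) = fun=> c.
Proof.
move=> [n [K [T [[_ [T' [_ T'T TT']]] [SK SB SG] <-]]]].
(* [w] places the target coordinates after those of the source; [sh] reads them back. *)
pose w k := (n + k)%N; have wI : injective w by exact: addnI.
have wm : map w (iota 0 m) = iota n m by rewrite -iotaDl addn0.
pose sh e k : R := e (w k).
pose F e := ind (graph T (row_env (n + m) e)).
have cF : constr S F by exact: constr_set.
have GE e : graph T (row_env (n + m) e) <->
    exists x, set_val x = row_env n e /\ set_val (T x) = row_env m (sh e).
  split=> [[x _ xE]|[x [xE TE]]].
    exists x; split.
      by have := congr1 lsubmx xE; rewrite row_mxKl row_env_l.
    by have := congr1 rsubmx xE; rewrite row_mxKr row_env_r.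
  by exists x => //; rewrite -[RHS]hsubmxK row_env_l row_env_r xE TE.
have inner1 : eulers (iota n m) F = fun e => ind (realization K (row_env n e)).
  apply/funext => e; have [Kx|nKx] := pselect (realization K (row_env n e)).
    rewrite indT//; pose x : realization K := SigSub (mem_set Kx).
    rewrite (eulers_local (G := fun e => ind (row_env m (sh e) = set_val (T x)))).
      rewrite -wm (eulers_ren _ (fun e => ind (row_env m e = set_val (T x))))//.
      by rewrite euler_row_point.
    move=> e' e'e; apply: ind_ext; rewrite GE.
    have e'n : row_env n e' = row_env n e.
      by apply/row_env_eqP => k kn; rewrite e'e// mem_iota negb_and -ltnNge kn.
    split=> [[x' [x'E E]]|E]; last by exists x; rewrite e'n E.
    by rewrite -E; congr (set_val (T _)); apply: val_inj; rewrite /= -e'n.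
  rewrite indF//; have [_ e0] := istep0 R (iota n m).
  rewrite (eulers_local (G := fun=> 0)) ?e0// => e' e'e; apply: indF => /GE [x [xE _]].
  have e'n : row_env n e' = row_env n e.
    by apply/row_env_eqP => k kn; rewrite e'e// mem_iota negb_and -ltnNge kn.
  by apply: nKx; rewrite -e'n -xE; exact: set_mem (valP x).
have inner2 : eulers (iota 0 n) F = fun e => ind (B (row_env m (sh e))).
  apply/funext => e.
  have shE e' : (forall k, k \notin iota 0 n -> e' k = e k) ->
      row_env m (sh e') = row_env m (sh e).
    by move=> e'e; apply/row_env_eqP => k km; apply: e'e; rewrite mem_iota /w; lia.
  have [By|nBy] := pselect (B (row_env m (sh e))).
    rewrite indT//; pose y : B := SigSub (mem_set By).
    rewrite (eulers_local (G := fun e => ind (row_env n e = set_val (T' y)))).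
      by rewrite euler_row_point.
    move=> e' /shE e'e; apply: ind_ext; rewrite GE; split=> [[x [xE TE]]|xE].
      rewrite -xE; congr set_val; rewrite -[LHS]T'T; congr T'.
      by apply: val_inj; rewrite /= -e'e.
    by exists (T' y); rewrite TT' e'e.
  rewrite indF//; have [_ e0] := istep0 R (iota 0 n).
  rewrite (eulers_local (G := fun=> 0)) ?e0// => e' /shE e'e; apply: indF => /GE [x [_ TE]].
  by apply: nBy; rewrite -e'e -TE; exact: set_mem (valP (T x)).
have := eulers_swap (s := iota 0 n) (t := iota n m) cF.
rewrite inner1 inner2 euler_realization => sw; apply/funext => e.
(* The comparison is made at an environment whose coordinates from [n] on are those of [e]. *)
have /(congr1 (@^~ (fun k => e (k - n)%N))) := sw ltac:(by move=> i; rewrite !mem_iota; lia).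
rewrite -wm (eulers_ren _ (fun e => ind (B (row_env m e))))// => ->.
by congr eulers; apply/funext => k; rewrite /w addKn.
Qed.

End Characteristic.

(** * Comparison of two decompositions of a function *)

Section Integral.
Variables (R : realType) (S : ominimal_structure R) (m : nat) (A : set 'rV[R]_m).
Variables (X : topologicalType) (beta : X -> A).
Hypothesis beta_inj : injective beta.

Lemma has_space_char_definable (U : set X) c : has_space_char S beta U c ->
  S m (model beta U).
Proof. by move=> [n [K [T [_ []]]]]. Qed.

Lemma model_beta (U : set X) x : model beta U (set_val (beta x)) <-> U x.
Proof.
split=> [[y Uy /val_inj/beta_inj <-//]|Ux]; by exists x.
Qed.

(** Transported by [beta] and extended by zero, the two sums are one function on the ambient space.
    Integrating it through either decomposition gives the two totals, with no common refinement of
    the pieces. *)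
Lemma weighted_char_eq (I J : finType) (U : I -> set X) (V : J -> set X)
    (a cU : I -> int) (b cV : J -> int) :
  (forall i, has_space_char S beta (U i) (cU i)) ->
  (forall j, has_space_char S beta (V j) (cV j)) ->
  (forall x, \sum_i a i * \1_(U i) x = \sum_j b j * \1_(V j) x) ->
  \sum_i a i * cU i = \sum_j b j * cV j.
Proof.
move=> hU hV UV.
pose F (W : set X) e := ind (model beta W (row_env m e)).
have eulerE (L : finType) (W : L -> set X) (d cW : L -> int) :
    (forall l, has_space_char S beta (W l) (cW l)) ->
    eulers (iota 0 m) (fun e => \sum_(l <- index_enum L) d l * F (W l) e) =
    fun=> \sum_l d l * cW l.
  move=> hW; have iW l : istep (iota 0 m) (F (W l)).
    by apply: (constr_istep (S := S)); apply/constr_set/has_space_char_definable/hW.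
  have [_ ->] := istep_sum (index_enum L) d iW; apply/funext => e.
  by apply: eq_bigr => l _; rewrite (has_char_euler (hW l)).
have /(congr1 (@^~ (fun=> 0))) := eulerE I U a cU hU.
rewrite (_ : (fun e => _) = fun e => \sum_(j <- index_enum J) b j * F (V j) e).
  by rewrite (eulerE J V b cV hV).
apply/funext => e.
have [[x xE]|nx] := pselect (exists x, set_val (beta x) = row_env m e).
  have FE W : F W e = \1_W x.
    rewrite /F -xE (ind_ext (model_beta W x)) indicE.
    by have [h|h] := pselect (W x); [rewrite indT// mem_set|rewrite indF// memNset].
  rewrite (eq_bigr _ (fun i _ => congr1 ( *%R (a i)) (FE (U i)))).
  by rewrite UV; apply: eq_bigr => j _; rewrite FE.
have F0 W : F W e = 0 by apply: indF => -[x _ xE]; apply: nx; exists x.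
by rewrite !big1// => l _; rewrite F0 mulr0.
Qed.

End Integral.

Theorem theorem4p1 (R : realType) (S : ominimal_structure R)
    (m : nat) (A : set 'rV[R]_m) (defA : S m A)
    (X : topologicalType) (beta : X -> A) (hbeta : homeomorphism beta)
    (h : X -> nat) (hHCF : HCF S beta (fun x => (h x)%:Z))
    (I : finType) (U : I -> set X)
    (tameU : forall i, tame S beta (U i))
    (hU : forall x, (h x)%:Z = \sum_(i : I) (\1_(U i) x : int))
    (N : int) (N0 : N != 0)
    (charU : forall i, has_space_char S beta (U i) N)
    (v : int) (hv : has_euler_integral S beta (fun x => (h x)%:Z) v) :
  #|I|%:R = N%:~R^-1 * v%:~R :> rat.
Proof.
have [_ [beta' [_ betaK _]]] := hbeta.
have [n [K [T [c [chi [_ charT hT vE]]]]]] := hv.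
(* The supports carry weight [1] and the cells of the triangulation the weights [c]; both families
   decompose [h]. *)
have vN : v = #|I|%:Z * N.
  rewrite vE -(weighted_char_eq (can_inj betaK) (a := fun=> 1) charU charT).
    by rewrite sumr_const mul1r -mulr_natl natz.
  by move=> x; rewrite -hT hU; apply: eq_bigr => i _; rewrite mul1r.
by rewrite vN intrM mulrCA mulVf ?intr_eq0// mulr1.
Qed.
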